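(* Let $P(z)$ be a critically injective polynomial over $\mathbb{C}$ of degree $n$ with only simple zeros, which is a uniqueness polynomial for meromorphic functions and has at least two distinct critical points, say $\gamma$ and $\delta$. Suppose that the total numbers of distinct $P(\gamma)$-points and distinct $P(\delta)$-points of $P(z)$ (i.e. of distinct zeros of $P(z)-P(\gamma)$ and $P(z)-P(\delta)$) are $p$ and $q$ respectively, with $|p-q|\geq 3$. If for every complex number $d\notin\{P(\gamma),P(\delta)\}$ the polynomial $P(z)-d$ has at least $\min\{p+3,q+3\}$ distinct zeros, then $P(z)$ is a strong uniqueness polynomial for meromorphic functions.
   Context: A polynomial $P$ is a uniqueness polynomial for meromorphic functions (UPM) if for any two non-constant meromorphic functions $f,g$ on $\mathbb{C}$, $P(f)\equiv P(g)$ implies $f\equiv g$. It is a strong uniqueness polynomial for meromorphic functions (SUPM) if for any two non-constant meromorphic functions $f,g$ on $\mathbb{C}$ and any non-zero constant $A\in\mathbb{C}$, $P(f)\equiv AP(g)$ implies $f\equiv g$. Critical points of $P$ are the zeros of $P'$. $P$ is critically injective if $P(\alpha)\neq P(\beta)$ for any two distinct zeros $\alpha,\beta$ of $P'$. *)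

(* Defs.v *)
(* MathComp / MathComp-Analysis world. *)
From HB Require Import structures.
From mathcomp Require Import all_boot all_order all_algebra.
From mathcomp Require Import all_classical all_reals all_analysis.
From mathcomp Require Import complex.

Set Implicit Arguments.
Unset Strict Implicit.
Unset Printing Implicit Defensive.

Import Order.TTheory GRing.Theory Num.Theory.
Import numFieldNormedType.Exports.

Local Open Scope classical_set_scope.
Local Open Scope ring_scope.

(* The complex numbers.  Giving R[i] as a numClosedFieldType is what makes the
   topology of numFieldNormedType available on it; differentiating along the
   direction 1 over this scalar field is complex differentiation. *)
Definition Cplx (R : realType) : numClosedFieldType := R[i]%C.

(* Meromorphic functions on the plane are represented by their values in
   C U {oo}, the poles being the points with value None.  At a finite value
   the function is finite and complex differentiable; as this holds at every
   finite point, it is holomorphic off its poles.  The second clause makes the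
   poles isolated, with |f| tending to oo there (in particular it excludes the
   constant oo); the order on Cplx R compares real elements as in R. *)
Definition meromorphic (R : realType) (f : Cplx R -> option (Cplx R)) : Prop :=
  forall z0 : Cplx R,
    if f z0 is Some _ then
      (\forall z \near z0, isSome (f z)) /\
      derivable (fun z : Cplx R => odflt 0 (f z)) z0 1
    else
      forall M : R, \forall z \near z0^',
        exists2 w : Cplx R, f z = Some w & (M%:C%C : Cplx R) < `|w|.

Definition nonconstant (R : realType) (f : Cplx R -> option (Cplx R)) : Prop :=
  exists z w : Cplx R, f z <> f w.

(* P(f) and A P(g) are identical as meromorphic functions: they agree at every
   point that is a pole of neither f nor g, hence off an isolated set. *)
Definition poly_comp_eq (R : realType) (P : {poly Cplx R}) (A : Cplx R)
    (f g : Cplx R -> option (Cplx R)) : Prop :=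
  forall z u v : Cplx R, f z = Some u -> g z = Some v -> P.[u] = A * P.[v].

Definition UPM (R : realType) (P : {poly Cplx R}) : Prop :=
  forall f g : Cplx R -> option (Cplx R),
    meromorphic f -> meromorphic g -> nonconstant f -> nonconstant g ->
    poly_comp_eq P 1 f g -> f =1 g.

Definition SUPM (R : realType) (P : {poly Cplx R}) : Prop :=
  forall (f g : Cplx R -> option (Cplx R)) (A : Cplx R),
    meromorphic f -> meromorphic g -> nonconstant f -> nonconstant g ->
    A != 0 -> poly_comp_eq P A f g -> f =1 g.

Definition critical_point (R : realType) (P : {poly Cplx R}) (z : Cplx R) : Prop :=
  root P^`() z.

Definition critically_injective (R : realType) (P : {poly Cplx R}) : Prop :=
  forall a b : Cplx R,
    critical_point P a -> critical_point P b -> a != b -> P.[a] != P.[b].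

Definition only_simple_zeros (R : realType) (P : {poly Cplx R}) : Prop :=
  forall z : Cplx R, root P z -> mup z P = 1%N.

(* The distinct d-points of P. *)
Definition points_of (R : realType) (P : {poly Cplx R}) (d : Cplx R) : set (Cplx R) :=
  [set z | root (P - d%:P) z].

(* Main.v *)
(* For A = 1 this is the UPM hypothesis.  For A <> 1 no nonconstant f, g satisfy
   P(f) = A P(g), by a metric of negative curvature.  The form
   dx / P'(y) = A dy / P'(x) on the curve P(x) = A P(y) pulls back to
   f' / P'(g) dz.  A common critical pair (a, b), i.e. P(a) = A P(b), is a
   singular point of the curve, and by critical injectivity each critical point
   lies in at most one such pair; multiplying the form by X(x) Y(y), where X and
   Y collect the member of smaller multiplicity of every pair, makes it
   holomorphic.  The point counts say that whichever of gamma and delta has fewer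
   P-points has multiplicity (as a zero of P') exceeding that of its partner by at
   least 3, whence deg X + deg Y <= n - 4.  With H the pulled back form,
   S = n - 3 - deg X - deg Y > 0 and
     W = |H|^4 ((1 + |f|^2) (1 + |g|^2))^S,
   the metric W^(1/4) |dz| extends over the poles and has curvature bounded above
   by a negative constant, so the Ahlfors-Schwarz lemma on larger and larger discs
   forces W = 0, hence f' = 0. *)
Require Import Defs.
From HB Require Import structures.
From mathcomp Require Import all_boot all_order all_algebra.
From mathcomp Require Import finmap.
From mathcomp Require Import all_classical all_reals all_analysis.
From mathcomp Require Import complex.
From mathcomp Require Import ring lra zify.

Set Implicit Arguments.
Unset Strict Implicit.
Unset Printing Implicit Defensive.

Import Order.TTheory GRing.Theory Num.Theory.
Import numFieldNormedType.Exports.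

Local Open Scope classical_set_scope.
Local Open Scope ring_scope.

(** The exponents in W are dictated by the poles. On the curve f and g become infinite together and
    at the same rate. With H = f' X(f) / P1(g), deg X = dX and deg P1 = n - 1 - deg Y = S + 2 + dX,
    near a pole H has the size of (1/f)' f^(-S). So |H|^4 contributes |f|^(-4S), and the S-th power
    of the two sphere factors contributes |f|^(4S): the two cancel exactly, which is why W extends
    over the poles in the coordinates 1/f and 1/g. The curvature itself is never computed. At a
    maximum of W against the Poincare weight of a disc, rotations of the sphere and an automorphism
    of the disc move f, g and z to 0. The inequality between Laplacians then becomes one between
    first derivatives, obtained from the mean value property of a single holomorphic factor. The
    function theory required is therefore small: Cauchy's formula on circles, holomorphy of the
    derivative, division by w - p and removable singularities. *)

(** * Real-valued modulus on the complex numbers *)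

Section Modulus.
Variable R : realType.
Implicit Types (x y : R) (z w : Cplx R).

Definition rc x : Cplx R := x%:C%C.
(** The norm of [Cplx R] takes its values in [Cplx R] itself; a modulus in [R] brings the estimates
    within reach of [lra] and [nra]. *)
Definition cnorm z : R := Normc.normc z.

Lemma normE z : `|z| = rc (cnorm z).
Proof. by []. Qed.

Lemma rcD x y : rc (x + y) = rc x + rc y. Proof. exact: rmorphD. Qed.
Lemma rcB x y : rc (x - y) = rc x - rc y. Proof. exact: rmorphB. Qed.
Lemma rcN x : rc (- x) = - rc x. Proof. exact: rmorphN. Qed.
Lemma rcM x y : rc (x * y) = rc x * rc y. Proof. exact: rmorphM. Qed.
Lemma rcV x : rc x^-1 = (rc x)^-1. Proof. exact: fmorphV. Qed.
Lemma rc0 : rc 0 = 0. Proof. by []. Qed.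
Lemma rc1 : rc 1 = 1. Proof. by []. Qed.
Lemma rc_nat n : rc n%:R = n%:R. Proof. exact: rmorph_nat. Qed.
Lemma rc_inj : injective rc. Proof. exact: complexI. Qed.
Lemma rc_le x y : (rc x <= rc y) = (x <= y). Proof. exact: lecR. Qed.
Lemma rc_lt x y : (rc x < rc y) = (x < y). Proof. exact: ltcR. Qed.
Lemma rc_eq0 x : (rc x == 0) = (x == 0).
Proof. by rewrite -rc0 (inj_eq rc_inj). Qed.

Lemma cnormM z w : cnorm (z * w) = cnorm z * cnorm w.
Proof. exact: Normc.normcM. Qed.
Lemma cnorm0 : cnorm 0 = 0. Proof. exact: Normc.normc0. Qed.
Lemma cnorm1 : cnorm 1 = 1. Proof. exact: Normc.normc1. Qed.
Lemma cnormV z : cnorm z^-1 = (cnorm z)^-1.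
Proof. exact: Normc.normcV. Qed.
Lemma cnorm_ge0 z : 0 <= cnorm z.
Proof. by rewrite -rc_le -normE rc0. Qed.
Lemma cnorm_eq0 z : (cnorm z == 0) = (z == 0).
Proof. by rewrite -rc_eq0 -normE normr_eq0. Qed.
Lemma cnorm_gt0 z : (0 < cnorm z) = (z != 0).
Proof. by rewrite lt_def cnorm_eq0 cnorm_ge0 andbT. Qed.
Lemma cnormX z n : cnorm (z ^+ n) = cnorm z ^+ n.
Proof. by elim: n => [|n IH]; rewrite ?expr0 ?cnorm1 // !exprS cnormM IH. Qed.
Lemma cnormN z : cnorm (- z) = cnorm z.
Proof. by apply: rc_inj; rewrite -!normE normrN. Qed.
Lemma cnormB z w : cnorm (z - w) = cnorm (w - z).
Proof. by rewrite -cnormN opprB. Qed.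
Lemma cnormD z w : cnorm (z + w) <= cnorm z + cnorm w.
Proof. by rewrite -rc_le rcD -!normE ler_normD. Qed.
Lemma cnormD3 z w v : cnorm (z - v) <= cnorm (z - w) + cnorm (w - v).
Proof. by rewrite -[z - v](subrKA w) cnormD. Qed.
Lemma cnorm_rc x : cnorm (rc x) = `|x|.
Proof. by rewrite /cnorm /= expr0n /= addr0 sqrtr_sqr. Qed.
Lemma cnorm_nat n : cnorm n%:R = n%:R.
Proof. by rewrite -rc_nat cnorm_rc normr_nat. Qed.

Lemma cnorm_sqr z : cnorm z ^+ 2 = complex.Re z ^+ 2 + complex.Im z ^+ 2.
Proof. by case: z => a b /=; rewrite sqr_sqrtr // addr_ge0 ?sqr_ge0. Qed.
Lemma Re_cnorm z : `|complex.Re z| <= cnorm z.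
Proof.
rewrite -(ler_pXn2r (_ : 0 < 2)%N) ?nnegrE ?cnorm_ge0 //.
by rewrite cnorm_sqr real_normK ?num_real // lerDl sqr_ge0.
Qed.
Lemma Im_cnorm z : `|complex.Im z| <= cnorm z.
Proof.
rewrite -(ler_pXn2r (_ : 0 < 2)%N) ?nnegrE ?cnorm_ge0 //.
by rewrite cnorm_sqr real_normK ?num_real // lerDr sqr_ge0.
Qed.
Lemma cnorm_ReIm z : cnorm z <= `|complex.Re z| + `|complex.Im z|.
Proof.
rewrite -(ler_pXn2r (_ : 0 < 2)%N) ?nnegrE ?cnorm_ge0 ?addr_ge0 //.
rewrite cnorm_sqr sqrrD !real_normK ?num_real //.
by rewrite addrAC lerDl mulrn_wge0 // mulr_ge0.
Qed.

Lemma ReB z w : complex.Re (z - w) = complex.Re z - complex.Re w.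
Proof. by case: z w => [? ?] [? ?]. Qed.
Lemma ImB z w : complex.Im (z - w) = complex.Im z - complex.Im w.
Proof. by case: z w => [? ?] [? ?]. Qed.
Lemma Re_rc x : complex.Re (rc x) = x. Proof. by []. Qed.
End Modulus.

Arguments rc : simpl never.
Arguments cnorm : simpl never.

(** * Continuity relative to a set, in epsilon-delta form *)

Section Continuity.
Variable R : realType.
Local Notation C := (Cplx R).
Implicit Types (D : C -> Prop) (f g : C -> C) (z : C) (P Q : C -> Prop).

(** The set [D] will be [setT] for functions on the plane and [I01] for paths. The point [z] is
    included, so punctured statements carry [w != z] inside [P]. *)
Definition nearby D z P : Prop :=
  exists2 d : R, 0 < d & forall w, D w -> cnorm (w - z) < d -> P w.

Lemma nearbyI D z P Q : nearby D z P -> nearby D z Q ->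
  nearby D z (fun w => P w /\ Q w).
Proof.
move=> [d d0 hd] [e e0 he]; exists (Num.min d e); first by rewrite lt_min d0.
by move=> w Dw; rewrite lt_min => /andP[wd we]; split; [exact: hd|exact: he].
Qed.

Lemma nearbyW D z P Q : (forall w, D w -> P w -> Q w) -> nearby D z P ->
  nearby D z Q.
Proof. by move=> PQ [d d0 hd]; exists d => // w Dw /(hd w Dw); exact: PQ. Qed.

Lemma nearby_all D z P : (forall w, D w -> P w) -> nearby D z P.
Proof. by move=> h; exists 1 => // w /h. Qed.

Lemma nearby_sub D D' z P : (forall w, D' w -> D w) -> nearby D z P ->
  nearby D' z P.
Proof. by move=> DD [d d0 hd]; exists d => // w /DD; exact: hd. Qed.

Lemma nearbyT D z P : nearby setT z P -> nearby D z P.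
Proof. exact: nearby_sub. Qed.

Lemma nearby_pt D z P : D z -> nearby D z P -> P z.
Proof. by move=> Dz [d d0]; apply => //; rewrite subrr cnorm0. Qed.

Lemma nearby_ball z (r : R) : 0 < r ->
  nearby setT z (fun w => cnorm (w - z) < r).
Proof. by exists r. Qed.

Lemma nearby_nearby z P : nearby setT z P ->
  nearby setT z (fun w => nearby setT w P).
Proof.
move=> [d d0 hd]; exists (d / 2); first by lra.
move=> w _ hw; exists (d / 2); first by lra.
by move=> v _ hv; apply: hd => //; have := cnormD3 v w z; lra.
Qed.

Definition cont D f z : Prop :=
  forall e : R, 0 < e -> nearby D z (fun w => cnorm (f w - f z) < e).

Lemma cont_near D f g z : f z = g z -> nearby D z (fun w => f w = g w) ->
  cont D f z -> cont D g z.
Proof.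
move=> efg fg fz e e0; apply: nearbyW (nearbyI fg (fz e e0)) => w _ [<- ].
by rewrite efg.
Qed.

Lemma cont_cst D (c : C) z : cont D (fun=> c) z.
Proof. by move=> e e0; apply: nearby_all => w _; rewrite subrr cnorm0. Qed.

Lemma cont_id D z : cont D id z.
Proof. by move=> e e0; exists e. Qed.

Lemma contD D f g z : cont D f z -> cont D g z -> cont D (fun w => f w + g w) z.
Proof.
move=> fz gz e e0; have e20 : 0 < e / 2 by lra.
apply: nearbyW (nearbyI (fz _ e20) (gz _ e20)) => w _ [].
by have := cnormD (f w - f z) (g w - g z); rewrite addrACA -opprD; lra.
Qed.

Lemma contN D f z : cont D f z -> cont D (fun w => - f w) z.
Proof.
by move=> fz e e0; apply: nearbyW (fz e e0) => w _; rewrite -opprD cnormN.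
Qed.

Lemma contB D f g z : cont D f z -> cont D g z -> cont D (fun w => f w - g w) z.
Proof. by move=> fz /contN; exact: contD. Qed.

Lemma cont_bounded D f z : cont D f z ->
  nearby D z (fun w => cnorm (f w) < cnorm (f z) + 1).
Proof.
move=> /(_ 1 ltr01); apply: nearbyW => w _.
by have := cnormD (f w - f z) (f z); rewrite subrK; lra.
Qed.

Lemma contM D f g z : cont D f z -> cont D g z -> cont D (fun w => f w * g w) z.
Proof.
move=> fz gz e e0.
have p0 := cnorm_ge0 (g z); have q0 := cnorm_ge0 (f z).
pose M := cnorm (f z) + cnorm (g z) + 1.
have M0 : 0 < M by rewrite /M; lra.
have e20 : 0 < e / (2 * M) by rewrite divr_gt0 // mulr_gt0.
apply: nearbyW (nearbyI (cont_bounded fz) (nearbyI (fz _ e20) (gz _ e20))).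
move=> w _ [h1 [h2 h3]].
have -> : f w * g w - f z * g z = f w * (g w - g z) + (f w - f z) * g z.
  by ring.
apply: le_lt_trans (cnormD _ _) _; rewrite !cnormM.
have a0 := cnorm_ge0 (f w).
have b1 : cnorm (f w) * cnorm (g w - g z) <= M * cnorm (g w - g z).
  by apply: ler_wpM2r; [exact: cnorm_ge0|rewrite /M; lra].
have b2 : cnorm (f w - f z) * cnorm (g z) <= M * cnorm (f w - f z).
  by rewrite mulrC; apply: ler_wpM2r; [exact: cnorm_ge0|rewrite /M; lra].
have b3 : M * cnorm (g w - g z) < M * (e / (2 * M)) by rewrite ltr_pM2l.
have b4 : M * cnorm (f w - f z) < M * (e / (2 * M)) by rewrite ltr_pM2l.
have b5 : M * (e / (2 * M)) = e / 2 by field; exact: lt0r_neq0.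
by rewrite b5 in b3 b4; lra.
Qed.

Lemma cont_neq0 D f z : cont D f z -> f z != 0 ->
  nearby D z (fun w => cnorm (f z) / 2 < cnorm (f w)).
Proof.
move=> fz; rewrite -cnorm_gt0 => h.
have h2 : 0 < cnorm (f z) / 2 by lra.
apply: nearbyW (fz _ h2) => w _.
by have := cnormD (f z - f w) (f w); rewrite subrK (cnormB (f z)); lra.
Qed.

Lemma cont_nz D f z : cont D f z -> f z != 0 -> nearby D z (fun w => f w != 0).
Proof.
move=> fz f0; apply: nearbyW (cont_neq0 fz f0) => w _.
by rewrite -!cnorm_gt0; apply: le_lt_trans; rewrite divr_ge0 // cnorm_ge0.
Qed.

Lemma contV D f z : cont D f z -> f z != 0 -> cont D (fun w => (f w)^-1) z.
Proof.
move=> fz f0 e e0.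
have n0 : 0 < cnorm (f z) by rewrite cnorm_gt0.
have e20 : 0 < e * (cnorm (f z) ^+ 2 / 2).
  by rewrite mulr_gt0 // divr_gt0 // exprn_gt0.
apply: nearbyW (nearbyI (cont_nz fz f0) (nearbyI (cont_neq0 fz f0) (fz _ e20))).
move=> w _ [w0 [h1 h2]].
have -> : (f w)^-1 - (f z)^-1 = (f z - f w) / (f w * f z) by field; apply/andP.
rewrite cnormM cnormV cnormM cnormB ltr_pdivrMr; last by rewrite mulr_gt0 // cnorm_gt0.
apply: lt_le_trans h2 _; rewrite ler_pM2l // expr2 mulrAC.
by rewrite ler_pM2r //; lra.
Qed.

Lemma contM_div D f g z : cont D f z -> cont D g z -> g z != 0 ->
  cont D (fun w => f w / g w) z.
Proof. by move=> fz gz g0; apply: contM => //; exact: contV. Qed.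

Lemma contX D f z n : cont D f z -> cont D (fun w => f w ^+ n) z.
Proof.
move=> fz; elim: n => [|n IH]; first exact: cont_cst.
apply: (@cont_near _ (fun w => f w * f w ^+ n)); first by rewrite exprS.
  by apply: nearby_all => w _; rewrite exprS.
exact: contM.
Qed.

Lemma cont_comp D D' f g z : (forall w, D w -> D' (f w)) -> cont D f z ->
  cont D' g (f z) -> cont D (fun w => g (f w)) z.
Proof.
move=> DD' fz gz e e0; have [d d0 hd] := gz e e0.
by apply: nearbyW (fz d d0) => w Dw; apply: hd; exact: DD'.
Qed.

End Continuity.

(** * Complex derivatives relative to a set *)

Section Derivative.
Variable R : realType.
Local Notation C := (Cplx R).
Implicit Types (D : C -> Prop) (f g : C -> C) (z : C).

(* Caratheodory's formulation, relative to a set: it covers both complex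
   differentiation ([D] open) and differentiation of paths ([D] a segment). *)
Definition cder D f z (l : C) : Prop :=
  exists phi : C -> C, [/\ phi z = l, cont D phi z &
    forall w, D w -> f w - f z = phi w * (w - z)].

(** The little-o form serves where only an estimate is at hand, as for primitives and for integrals
    depending on a parameter. *)
Lemma cderP D f z l : cder D f z l <->
  forall e : R, 0 < e -> nearby D z (fun w =>
    cnorm (f w - f z - l * (w - z)) <= e * cnorm (w - z)).
Proof.
split=> [[phi [<- cphi fE]] e e0|h].
  apply: nearbyW (cphi e e0) => w Dw hw.
  by rewrite fE // -mulrBl cnormM ler_wpM2r ?cnorm_ge0 // ltW.
exists (fun w => if w == z then l else (f w - f z) / (w - z)); split.
- by rewrite eqxx.
- move=> e e0; have e20 : 0 < e / 2 by lra.
  apply: nearbyW (h _ e20) => w Dw; rewrite eqxx.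
  case: eqVneq => [->|wz]; first by move=> _; rewrite subrr cnorm0.
  have n0 : 0 < cnorm (w - z) by rewrite cnorm_gt0 subr_eq0.
  have wz0 : w - z != 0 by rewrite subr_eq0.
  have -> : (f w - f z) / (w - z) - l = (f w - f z - l * (w - z)) / (w - z).
    by field.
  rewrite cnormM cnormV -ler_pdivrMr // => h1; lra.
- move=> w Dw; case: eqVneq => [->|wz]; first by rewrite !subrr mulr0.
  by rewrite divfK // subr_eq0.
Qed.

Lemma cder_near D f g z l : f z = g z -> nearby D z (fun w => f w = g w) ->
  cder D f z l -> cder D g z l.
Proof.
move=> efg fg /cderP h; apply/cderP => e e0.
by apply: nearbyW (nearbyI fg (h e e0)) => w _ [<-]; rewrite efg.
Qed.

Lemma cder_eq D f z l l' : l = l' -> cder D f z l -> cder D f z l'.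
Proof. by move=> ->. Qed.

Lemma cder_cont D f z l : cder D f z l -> cont D f z.
Proof.
move=> [phi [_ c h]].
apply: (@cont_near _ _ (fun w => f z + phi w * (w - z))).
- by rewrite subrr mulr0 addr0.
- by apply: nearby_all => w Dw; rewrite -h // addrC subrK.
- apply: contD; first exact: cont_cst.
  by apply: contM => //; apply: contB; [exact: cont_id|exact: cont_cst].
Qed.

Lemma cder_cst D c z : cder D (fun=> c) z 0.
Proof.
by exists (fun=> 0); split=> // [|w _]; [exact: cont_cst|rewrite subrr mul0r].
Qed.

Lemma cder_id D z : cder D id z 1.
Proof.
by exists (fun=> 1); split=> // [|w _]; [exact: cont_cst|rewrite mul1r].
Qed.

Lemma cderD D f g z l m : cder D f z l -> cder D g z m ->
  cder D (fun w => f w + g w) z (l + m).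
Proof.
move=> [p [<- cp hp]] [q [<- cq hq]]; exists (fun w => p w + q w).
split=> //; first exact: contD.
by move=> w Dw; rewrite mulrDl -hp // -hq //; ring.
Qed.

Lemma cderM D f g z l m : cder D f z l -> cder D g z m ->
  cder D (fun w => f w * g w) z (l * g z + f z * m).
Proof.
move=> [p [<- cp hp]] dg; have cg := cder_cont dg.
have [q [<- cq hq]] := dg.
exists (fun w => p w * g w + f z * q w).
split=> //.
  by apply: contD; apply: contM => //; exact: cont_cst.
move=> w Dw; rewrite mulrDl mulrAC -hp // -[f z * q w * _]mulrA -hq //; ring.
Qed.

Lemma cderMl D f z l c : cder D f z l -> cder D (fun w => c * f w) z (c * l).
Proof.
by move=> h; apply: cder_eq (cderM (cder_cst D c z) h); rewrite mul0r add0r.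
Qed.

Lemma cderN D f z l : cder D f z l -> cder D (fun w => - f w) z (- l).
Proof.
move=> /(cderMl (-1)); rewrite mulN1r; apply: cder_near; first by rewrite mulN1r.
by apply: nearby_all => w _; rewrite mulN1r.
Qed.

Lemma cderB D f g z l m : cder D f z l -> cder D g z m ->
  cder D (fun w => f w - g w) z (l - m).
Proof. by move=> hf /cderN; exact: cderD. Qed.

Lemma cderV D f z l : cder D f z l -> f z != 0 ->
  cder D (fun w => (f w)^-1) z (- l / f z ^+ 2).
Proof.
move=> df f0; have cf := cder_cont df.
have [p [<- cp hp]] := df; have nz := cont_nz cf f0.
(* The slope [- p w / (f w * f z)] is correct only where [f w != 0], so the local little-o form is
   used in place of an identity on all of [D]. *)
apply/cderP => e e0.
have : cont D (fun w => - p w / (f w * f z)) z.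
  apply: contM; first exact: contN.
  by apply: contV; [apply: contM => //; exact: cont_cst|rewrite mulf_neq0].
move=> /(_ e e0) h; apply: nearbyW (nearbyI nz h) => w Dw [fw0 h1].
have -> : (f w)^-1 - (f z)^-1 = (- p w / (f w * f z)) * (w - z).
  have /(congr1 (fun t => - t / (f w * f z))) := hp _ Dw => hw.
  rewrite mulrAC mulNr -hw; field; exact/andP.
by rewrite -mulrBl cnormM ler_wpM2r ?cnorm_ge0 // expr2 ltW.
Qed.

Lemma cder_div D f g z l m : cder D f z l -> cder D g z m -> g z != 0 ->
  cder D (fun w => f w / g w) z ((l * g z - f z * m) / g z ^+ 2).
Proof.
move=> df dg g0; apply: cder_eq (cderM df (cderV dg g0)); field => //.
Qed.

Lemma cder_comp D D' f g z l m : (forall w, D w -> D' (f w)) ->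
  cder D f z l -> cder D' g (f z) m -> cder D (fun w => g (f w)) z (m * l).
Proof.
move=> DD' df; have cf := cder_cont df.
have [p [<- cp hp]] := df; move=> [q [<- cq hq]].
exists (fun w => q (f w) * p w); split=> //.
  by apply: contM => //; exact: cont_comp cq.
by move=> w Dw; rewrite -mulrA -hp // -hq //; exact: DD'.
Qed.

Lemma cderX D f z l n : cder D f z l ->
  cder D (fun w => f w ^+ n) z (n%:R * f z ^+ n.-1 * l).
Proof.
move=> df; elim: n => [|n IH].
  by rewrite !mul0r; exact: cder_cst.
apply: (@cder_near _ (fun w => f w * f w ^+ n)); first by rewrite exprS.
  by apply: nearby_all => w _; rewrite exprS.
apply: cder_eq (cderM df IH); case: n {IH} => [|n] /=; first by ring.
by rewrite exprS; ring.
Qed.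

Lemma cder_unique f z l m : cder setT f z l -> cder setT f z m -> l = m.
Proof.
move=> /cderP hl /cderP hm; apply/eqP; rewrite -subr_eq0 -cnorm_eq0.
apply/eqP/le_anti; rewrite cnorm_ge0 andbT leNgt; apply/negP => h.
have e0 : 0 < cnorm (l - m) / 4 by lra.
have [d d0 hd] := nearbyI (hl _ e0) (hm _ e0).
set v := rc (d / 2); have zv : z + v - z = v by rewrite addrAC subrr add0r.
have vE : cnorm v = d / 2 by rewrite cnorm_rc ger0_norm; lra.
have [] := hd (z + v) I; first by rewrite zv vE; lra.
rewrite zv vE => h1 h2.
have : cnorm ((l - m) * v) <= cnorm (l - m) / 2 * (d / 2).
  have -> : (l - m) * v = (f (z + v) - f z - m * v) - (f (z + v) - f z - l * v).
    by ring.
  by have := cnormD (f (z + v) - f z - m * v) (- (f (z + v) - f z - l * v)); rewrite cnormN; lra.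
rewrite cnormM vE; nra.
Qed.

Lemma cder_horner D (p : {poly C}) z : cder D (horner p) z p^`().[z].
Proof.
elim/poly_ind: p => [|p c IH].
  rewrite deriv0 horner0; apply: (@cder_near _ (fun=> 0)) (cder_cst _ _ _) => //.
    by rewrite horner0.
  by apply: nearby_all => w _; rewrite horner0.
apply: (@cder_near _ (fun w => p.[w] * w + c)).
- by rewrite hornerMXaddC.
- by apply: nearby_all => w _; rewrite hornerMXaddC.
rewrite derivD derivC addr0 derivM derivX mulr1 hornerD hornerMX.
apply: cder_eq (cderD (cderM IH (cder_id D z)) (cder_cst D c z)).
by rewrite mulr1 addr0.
Qed.

Lemma cont_horner D (p : {poly C}) z : cont D (horner p) z.
Proof. exact: cder_cont (cder_horner _ _ _). Qed.

End Derivative.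

(** * Integration over the unit interval through primitives *)

Section UnitInterval.
Variable R : realType.
Local Notation C := (Cplx R).
Implicit Types (f g phi : C -> C) (z : C).

(** The interval sits inside the complex numbers so that a path is again a map of [C] to itself and
    [cder] applies to it. *)
Definition I01 z : Prop := exists2 t : R, 0 <= t <= 1 & z = rc t.

Lemma I01_rc (t : R) : 0 <= t <= 1 -> I01 (rc t).
Proof. by move=> h; exists t. Qed.

Lemma I01_0 : I01 0. Proof. by exists 0; rewrite ?rc0 ?lexx ?ler01. Qed.
Lemma I01_1 : I01 1. Proof. by exists 1; rewrite ?rc1 ?lexx ?ler01. Qed.

Lemma cder_real (h : R -> R) (t l : R) : is_derive t 1 h l ->
  cder I01 (fun z => rc (h (complex.Re z))) (rc t) (rc l).
Proof.
move=> [dh dhE]; apply/cderP => e e0.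
move: dh; rewrite /derivable => /cvg_ex[/= m hm].
have ml : m = l by rewrite -dhE; apply/esym/cvg_lim.
move: hm => /cvgrPdist_le /(_ e e0); rewrite ml => /nbhs_ballP [d /= d0 hd].
exists d => // w [s s01 ->]; rewrite -rcB cnorm_rc => sd; rewrite !Re_rc.
have [->|st] := eqVneq s t; first by rewrite !(subrr, mulr0, cnorm0, normr0).
have st0 : s - t != 0 by rewrite subr_eq0.
have := hd (s - t); rewrite /ball /= sub0r normrN => /(_ sd st0) h1.
rewrite -rcM -rcB -rcB cnorm_rc.
rewrite [_ *: 1]mulr1 subrK in h1.
have -> : h s - h t - l * (s - t) = - (l - (s - t)^-1 * (h s - h t)) * (s - t).
  by field.
by rewrite normrM normrN ler_wpM2r.
Qed.

Lemma continuous_antiderivative (h : R -> R) : continuous h ->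
  exists H : R -> R, forall t : R, 0 <= t <= 1 -> is_derive t 1 H (h t).
Proof.
(* Integrating from [-1], and up to [2] below, keeps [[0, 1]] in the open interval where the
   fundamental theorem gives a two-sided derivative. *)
move=> ch; exists (fun x => \int[lebesgue_measure]_(t in [set` `[-1, x]]) h t)%R.
move=> t /andP[t0 t1].
have ih : lebesgue_measure.-integrable `[-1, 2]%classic (EFin \o h).
  apply: continuous_compact_integrable; first exact: segment_compact.
  exact: continuous_subspaceT.
have [||H1 H2] := @continuous_FTC1_closed R h (-1) t 2 _ ih _ (ch t); try lra.
exact: DeriveDef H1 (etrans (esym (derive1E _ _)) H2).
Qed.

(** An integral is the increment of a primitive, so linearity, substitution and integration by parts
    are rules for derivatives. *)
Definition isint phi (I : C) : Prop :=
  exists2 Phi : C -> C, forall z, I01 z -> cder I01 Phi z (phi z) &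
    I = Phi 1 - Phi 0.

Definition contI phi : Prop := forall z, I01 z -> cont I01 phi z.

(** Extends a function on [[0, 1]] by constants to the whole line, where [continuous_antiderivative]
    and the extreme value theorem can take it. *)
Lemma contI_clamp (h : C -> R) :
  (forall z, I01 z -> cont I01 (fun w => rc (h w)) z) ->
  continuous (fun t : R => h (rc (Num.max 0 (Num.min 1 t)))).
Proof.
move=> ch t; pose k (s : R) := Num.max 0 (Num.min 1 s).
have k01 s : 0 <= k s <= 1.
  by rewrite /k le_max lexx /= ge_max ler01 ge_min lexx.
have kl (s : R) : `|k s - k t| <= `|s - t|.
  have := ler_norm (s - t); have := ler_norm (t - s); rewrite distrC => h1 h2.
  rewrite ler_norml /k; apply/andP.
  case: (leP 1 s) => s1; case: (leP 1 t) => t1;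
  rewrite ?(max_r (ler01 : 0 <= 1 :> R)); split; try lra;
  by rewrite /Num.max; repeat case: ifP; lra.
apply/cvgrPdist_lt => e e0.
have [d d0 hd] := ch _ (I01_rc (k01 t)) e e0.
apply/nbhs_ballP; exists d => //= s; rewrite /ball /= (distrC t) => st.
have := hd _ (I01_rc (k01 s)); rewrite -!rcB !cnorm_rc => h1.
by rewrite distrC; apply: h1; exact: le_lt_trans (kl s) st.
Qed.

Lemma clampE (t : R) : 0 <= t <= 1 -> Num.max 0 (Num.min 1 t) = t.
Proof. by move=> /andP[t0 t1]; rewrite min_r // max_r. Qed.

Definition ci : C := 'i%C.

Lemma ReImE z : z = rc (complex.Re z) + ci * rc (complex.Im z).
Proof. exact: complexE. Qed.

Lemma cont_Re D f z : cont D f z -> cont D (fun w => rc (complex.Re (f w))) z.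
Proof.
move=> fz e e0; apply: nearbyW (fz e e0) => w _.
by rewrite -rcB cnorm_rc -ReB; apply: le_lt_trans; exact: Re_cnorm.
Qed.

Lemma cont_Im D f z : cont D f z -> cont D (fun w => rc (complex.Im (f w))) z.
Proof.
move=> fz e e0; apply: nearbyW (fz e e0) => w _.
by rewrite -rcB cnorm_rc -ImB; apply: le_lt_trans; exact: Im_cnorm.
Qed.

Lemma isint_exists phi : contI phi -> exists I, isint phi I.
Proof.
move=> cphi.
have [U HU] := continuous_antiderivative (contI_clamp
  (fun z zI => cont_Re (cphi z zI))).
have [V HV] := continuous_antiderivative (contI_clamp
  (fun z zI => cont_Im (cphi z zI))).
pose Phi z : C := rc (U (complex.Re z)) + ci * rc (V (complex.Re z)).
exists (Phi 1 - Phi 0); exists Phi => // z [t t01 ->].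
rewrite [phi _]ReImE; apply: cderD; last apply: cderMl.
  by have := HU t t01; rewrite clampE // => /cder_real.
by have := HV t t01; rewrite clampE // => /cder_real.
Qed.

Lemma half_pow_small (K e : R) : 0 < e -> exists n : nat, K / 2 ^+ n < e.
Proof.
move=> e0; pose n := (Num.truncn (`|K| / e)).+1; exists n.
have h1 : `|K| / e < n%:R by apply: truncnS_gt; rewrite divr_ge0 ?ltW.
have h2 : (n%:R : R) <= 2 ^+ n by rewrite -natrX ler_nat ltnW // ltn_expl.
rewrite ltr_pdivrMr ?exprn_gt0 // mulrC -ltr_pdivrMr //.
apply: lt_le_trans h2; apply: le_lt_trans h1.
by apply: ler_wpM2r; [rewrite invr_ge0 ltW|exact: ler_norm].
Qed.

(** The intervals of radius [2 K / 2^n] around [u n] are nested, and the supremum of their left ends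
    lies in all of them. *)
Lemma geometric_limit_real (u : nat -> R) (K : R) :
  (forall n, `|u n.+1 - u n| <= K / 2 ^+ n) ->
  exists l : R, forall n, `|u n - l| <= 2 * K / 2 ^+ n.
Proof.
move=> hu; pose a n := u n - 2 * K / 2 ^+ n; pose b n := u n + 2 * K / 2 ^+ n.
have hS n : (2 ^+ n.+1 : R)^-1 = (2 ^+ n)^-1 / 2 by rewrite exprS invfM mulrC.
have aS n : a n <= a n.+1 by have := hu n; rewrite /a hS ler_norml; lra.
have bS n : b n.+1 <= b n by have := hu n; rewrite /b hS ler_norml; lra.
have am m n : (m <= n)%N -> a m <= a n.
  by move=> /subnK <-; elim: (n - m)%N => // k IH; exact: le_trans (aS _).
have bm m n : (m <= n)%N -> b n <= b m.
  by move=> /subnK <-; elim: (n - m)%N => // k IH; exact: le_trans (bS _) _.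
have ab n : a n <= b n.
  have : 0 <= K / 2 ^+ n by apply: le_trans (hu n).
  by rewrite /a /b; lra.
have sA : has_sup [set a n | n in setT].
  split; first by exists (a 0), 0.
  by exists (b 0) => _ [n _ <-]; apply: le_trans (ab n) _; exact: bm.
exists (sup [set a n | n in setT]) => n; rewrite ler_distlC.
apply/andP; split.
  by apply: sup_upper_bound => //; exists n.
apply: ge_sup => //; first by exists (a 0), 0.
move=> _ [m _ <-]; have [mn|/ltnW nm] := leqP m n.
  by apply: le_trans (ab n); exact: am.
by apply: le_trans (ab m) _; exact: bm.
Qed.

Lemma geometric_limit (u : nat -> C) (K : R) :
  (forall n, cnorm (u n.+1 - u n) <= K / 2 ^+ n) ->
  exists l : C, forall n, cnorm (u n - l) <= 4 * K / 2 ^+ n.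
Proof.
move=> hu.
have [n|x hx] := @geometric_limit_real (fun n => complex.Re (u n)) K.
  by rewrite -ReB; apply: le_trans (Re_cnorm _) (hu n).
have [n|y hy] := @geometric_limit_real (fun n => complex.Im (u n)) K.
  by rewrite -ImB; apply: le_trans (Im_cnorm _) (hu n).
exists (rc x + ci * rc y) => n; apply: le_trans (cnorm_ReIm _) _.
have := hx n; have := hy n; rewrite ReB ImB.
have -> : complex.Re (rc x + ci * rc y) = x by rewrite /=; ring.
have -> : complex.Im (rc x + ci * rc y) = y by rewrite /=; ring.
by lra.
Qed.

(** The mean value inequality, by bisection: if the increment of the primitive exceeds [M], one half
    of each interval exceeds its share, and these halves shrink to a point where the derivative
    would have modulus above [M]. *)
Lemma isint_bound phi I (M : R) : isint phi I ->
  (forall z, I01 z -> cnorm (phi z) <= M) -> cnorm I <= M.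
Proof.
move=> [Phi dPhi ->] hM; rewrite leNgt; apply/negP => hlt.
pose e := cnorm (Phi 1 - Phi 0) - M.
have e0 : 0 < e by rewrite /e; lra.
pose M' := M + e / 2.
pose bad (p : R * R) := M' * (p.2 - p.1) < cnorm (Phi (rc p.2) - Phi (rc p.1)).
pose mid (p : R * R) := (p.1 + p.2) / 2.
pose step (p : R * R) :=
  if bad (p.1, mid p) then (p.1, mid p) else (mid p, p.2).
pose u n := iter n step (0, 1).
have uS n : u n.+1 = step (u n) by [].
have ub n : bad (u n).
  elim: n => [|n]; first by rewrite /bad /= rc0 rc1 /M' /e; lra.
  rewrite uS; case: (u n) => a b; rewrite /step.
  case: ifPn => //; rewrite /bad /mid /= -!leNgt => h1 h2.
  have := cnormD3 (Phi (rc b)) (Phi (rc ((a + b) / 2))) (Phi (rc a)).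
  by lra.
have uE n : [/\ 0 <= (u n).1, (u n).2 <= 1 & (u n).2 - (u n).1 = 1 / 2 ^+ n].
  elim: n => [|n]; first by rewrite /= expr0 subr0 divr1.
  rewrite uS; case: (u n) => a b [/= a0 b1 E].
  have p0 : 0 < 1 / 2 ^+ n :> R by rewrite divr_gt0 // exprn_gt0.
  have hS : (1 / 2 ^+ n.+1 : R) = 1 / 2 ^+ n / 2.
    by rewrite exprS; field; rewrite expf_neq0.
  by rewrite /step; case: ifP => _; rewrite /mid /= hS -E; split; lra.
have p0 n : 0 < 1 / 2 ^+ n :> R by rewrite divr_gt0 // exprn_gt0.
have [n|l hl] := @geometric_limit_real (fun n => (u n).1) 1.
  have [_ _ E] := uE n; have := p0 n; rewrite -E uS; case: (u n) => a b /=.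
  rewrite /step; case: ifP => _ /=; first by rewrite subrr normr0 => /ltW.
  by rewrite /mid /= ler_norml => h; apply/andP; split; lra.
have l01 : 0 <= l <= 1.
  apply/andP; split; rewrite leNgt; apply/negP => h.
    have [n hn] := @half_pow_small 2 (- l) ltac:(lra).
    by have := hl n; have [] := uE n; have := p0 n; rewrite mulr1 ler_norml; lra.
  have [n hn] := @half_pow_small 2 (l - 1) ltac:(lra).
  by have := hl n; have [] := uE n; have := p0 n; rewrite mulr1 ler_norml; lra.
have /cderP dl := dPhi _ (I01_rc l01).
(* The end points lie within [2 / 2^n] and [3 / 2^n] of [l], so the two errors add up to at most
   [5 e / 16] times the length, below the margin [e / 2] in [M']. *)
have e40 : 0 < e / 16 by lra.
have [d d0 hd] := dl _ e40.
have [n hn] := half_pow_small 3 d0.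
have := ub n; have [an bn E] := uE n; have q0 := p0 n; have := hl n.
rewrite mulr1; move: an bn E; rewrite /bad; case: (u n) => a b /= a0 b1 E hal.
have ha : cnorm (rc a - rc l) <= 2 / 2 ^+ n by rewrite -rcB cnorm_rc.
have hb : cnorm (rc b - rc l) <= 3 / 2 ^+ n.
  by rewrite -rcB cnorm_rc; move: hal; rewrite !ler_norml; lra.
have Ia : I01 (rc a) by apply: I01_rc; lra.
have Ib : I01 (rc b) by apply: I01_rc; lra.
have da := hd _ Ia ltac:(lra); have db := hd _ Ib ltac:(lra).
have -> : Phi (rc b) - Phi (rc a) = (Phi (rc b) - Phi (rc l) - phi (rc l) * (rc b - rc l))
   - (Phi (rc a) - Phi (rc l) - phi (rc l) * (rc a - rc l)) + phi (rc l) * (rc b - rc a).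
  by ring.
set x := (Phi (rc b) - Phi (rc l) - _) in db *.
set y := (Phi (rc a) - Phi (rc l) - _) in da *.
have h1 := cnormD (x - y) (phi (rc l) * (rc b - rc a)).
have h2 := cnormD x (- y); rewrite cnormN in h2.
have h3 : cnorm (phi (rc l) * (rc b - rc a)) <= M * (b - a).
  rewrite cnormM -rcB cnorm_rc ger0_norm; last by lra.
  by apply: ler_wpM2r; [lra|apply: hM; exact: I01_rc].
have h4 : e / 16 * cnorm (rc b - rc l) <= e / 16 * (3 / 2 ^+ n).
  by apply: ler_wpM2l => //; lra.
have h5 : e / 16 * cnorm (rc a - rc l) <= e / 16 * (2 / 2 ^+ n).
  by apply: ler_wpM2l => //; lra.
rewrite /M' E in h3 *; move: h1 h2 h3 h4 h5 q0.
set v := (2 ^+ n)^-1 => h1 h2 h3 h4 h5 q0.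
have : 0 < e * v by rewrite mulr_gt0 //; lra.
by lra.
Qed.
End UnitInterval.

(** * Linearity and uniqueness of the integral *)

Section Integral.
Variable R : realType.
Local Notation C := (Cplx R).
Implicit Types (f g phi psi : C -> C) (z : C).

Lemma isint_ext phi psi I : (forall z, I01 z -> phi z = psi z) ->
  isint phi I -> isint psi I.
Proof. by move=> h [P dP ->]; exists P => // z zI; rewrite -h //; exact: dP. Qed.

Lemma isintD phi psi I J : isint phi I -> isint psi J ->
  isint (fun z => phi z + psi z) (I + J).
Proof.
move=> [P dP ->] [Q dQ ->]; exists (fun z => P z + Q z); last by ring.
by move=> z zI; apply: cderD; [exact: dP|exact: dQ].
Qed.

Lemma isintMl phi I c : isint phi I -> isint (fun z => c * phi z) (c * I).
Proof.
move=> [P dP ->]; exists (fun z => c * P z); last by rewrite mulrBr.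
by move=> z zI; apply: cderMl; exact: dP.
Qed.

Lemma isintB phi psi I J : isint phi I -> isint psi J ->
  isint (fun z => phi z - psi z) (I - J).
Proof.
move=> h1 /(isintMl (-1)); rewrite mulN1r => /(isintD h1).
by apply: isint_ext => z _; rewrite mulN1r.
Qed.

Lemma isint_unique phi I J : isint phi I -> isint phi J -> I = J.
Proof.
move=> hI hJ; apply/eqP; rewrite -subr_eq0 -cnorm_eq0.
apply/eqP/le_anti; rewrite cnorm_ge0 andbT.
by apply: isint_bound (isintB hI hJ) _ => z _; rewrite subrr cnorm0.
Qed.

Lemma isint_cst (c : C) : isint (fun=> c) c.
Proof.
exists (fun z => c * z); last by rewrite mulr1 mulr0 subr0.
by move=> z zI; apply: cder_eq (cderMl c (cder_id _ _)); rewrite mulr1.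
Qed.

Definition cint phi : C := xget 0 [set I : C | isint phi I].

Lemma cintE phi I : isint phi I -> cint phi = I.
Proof. by move=> h; apply: (isint_unique _ h); exact: (@xgetI _ _ _ I). Qed.

Lemma cintP phi : contI phi -> isint phi (cint phi).
Proof. by move=> /isint_exists [I h]; rewrite (cintE h). Qed.

End Integral.

(** * Integrals along segments, Goursat's theorem and primitives on a disc *)

Section Segment.
Variable R : realType.
Local Notation C := (Cplx R).
Implicit Types (f g : C -> C) (a b c z w : C) (r : R).

Definition disc c r w : Prop := cnorm (w - c) < r.
Definition cdisc c r w : Prop := cnorm (w - c) <= r.

Lemma cdisc_disc c r s w : s < r -> cdisc c s w -> disc c r w.
Proof. by move=> h; move/le_lt_trans; apply. Qed.

Lemma disc_nearby c r w : disc c r w -> nearby setT w (disc c r).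
Proof.
move=> h; exists (r - cnorm (w - c)); first by rewrite subr_gt0.
by move=> v _ hv; rewrite /disc; have := cnormD3 v w c; lra.
Qed.

Definition seg_point a b z := a + z * (b - a).

Lemma seg_point_cdisc c r a b z : I01 z -> cdisc c r a -> cdisc c r b ->
  cdisc c r (seg_point a b z).
Proof.
move=> [t /andP[t0 t1] ->] ha hb; rewrite /cdisc.
have -> : seg_point a b (rc t) - c = rc (1 - t) * (a - c) + rc t * (b - c).
  by rewrite rcB rc1 /seg_point; ring.
apply: le_trans (cnormD _ _) _; rewrite !cnormM !cnorm_rc !ger0_norm; try lra.
have h1 : (1 - t) * cnorm (a - c) <= (1 - t) * r by apply: ler_wpM2l => //; lra.
have h2 : t * cnorm (b - c) <= t * r by apply: ler_wpM2l.
by lra.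
Qed.

Lemma seg_point_disc c r a b z : I01 z -> disc c r a -> disc c r b ->
  disc c r (seg_point a b z).
Proof.
move=> zI ha hb; have h : Num.max (cnorm (a - c)) (cnorm (b - c)) < r.
  by rewrite gt_max; apply/andP.
by apply: cdisc_disc h _; apply: seg_point_cdisc => //; rewrite /cdisc le_max lexx ?orbT.
Qed.

Lemma cder_seg_point D a b z : cder D (seg_point a b) z (b - a).
Proof.
apply: cder_eq (cderD (cder_cst _ _ _) (cderM (cder_id _ _) (cder_cst _ _ _))).
by ring.
Qed.

Lemma cont_seg_point D a b z : cont D (seg_point a b) z.
Proof. exact: cder_cont (cder_seg_point _ _ _ _). Qed.

Lemma seg_point0 a b : seg_point a b 0 = a. Proof. by rewrite /seg_point mul0r addr0. Qed.
Lemma seg_point1 a b : seg_point a b 1 = b. Proof. by rewrite /seg_point mul1r addrC subrK. Qed.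

Definition isseg f a b (I : C) := isint (fun z => f (seg_point a b z) * (b - a)) I.
Definition seg f a b := cint (fun z => f (seg_point a b z) * (b - a)).

Lemma isseg_exact f F a b :
  (forall z, I01 z -> cder setT F (seg_point a b z) (f (seg_point a b z))) ->
  isseg f a b (F b - F a).
Proof.
move=> h; exists (fun z => F (seg_point a b z)); last by rewrite seg_point0 seg_point1.
move=> z zI; apply: cder_eq (@cder_comp _ _ setT _ _ _ _ _ _ (cder_seg_point _ _ _ _) (h z zI)) => //.
Qed.

Lemma isseg_bound f a b I (M : R) : isseg f a b I ->
  (forall z, I01 z -> cnorm (f (seg_point a b z)) <= M) -> cnorm I <= M * cnorm (b - a).
Proof.
move=> h hM; apply: isint_bound h _ => z zI.
by rewrite cnormM ler_wpM2r ?cnorm_ge0 //; exact: hM.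
Qed.

Lemma isseg_rev f a b I : isseg f a b I -> isseg f b a (- I).
Proof.
move=> [P dP ->]; exists (fun z => P (1 - z)); last first.
  by rewrite subrr subr0 opprB.
have h1 z : I01 z -> I01 (1 - z).
  by move=> [t t01 ->]; rewrite -rc1 -rcB; apply: I01_rc; lra.
move=> z zI.
have d1 : cder (@I01 R) (fun z => 1 - z) z (0 - 1).
  by apply: cderB; [exact: cder_cst|exact: cder_id].
apply: cder_eq (cder_comp h1 d1 (dP _ (h1 _ zI))).
have -> : seg_point a b (1 - z) = seg_point b a z by rewrite /seg_point; ring.
by ring.
Qed.

Lemma isseg_half f a b I J : let m := (a + b) / 2 in
  isseg f a b I -> isseg f a m J -> isseg f m b (I - J).
Proof.
move=> m [P dP ->] hJ.
have h2 : rc 2 = 2 :> C by exact: rc_nat.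
have n2 : (2 : C) != 0 by rewrite pnatr_eq0.
have hh : I01 (2^-1 : C).
  by rewrite -h2 -rcV; apply: I01_rc; lra.
have -> : J = P 2^-1 - P 0.
  apply: isint_unique hJ _.
  exists (fun z => P (z / 2)); last by rewrite mul1r mul0r.
  have h z : I01 z -> I01 (z / 2).
    by move=> [t t01 ->]; rewrite -h2 -rcV -rcM; apply: I01_rc; lra.
  have d z : cder (@I01 R) (fun z => z / 2) z (1 * 2^-1 + z * 0).
    by apply: cderM; [exact: cder_id|exact: cder_cst].
  move=> z zI; apply: cder_eq (cder_comp h (d z) (dP _ (h _ zI))).
  have -> : seg_point a b (z / 2) = seg_point a m z by rewrite /seg_point /m; field.
  by rewrite /m; field.
exists (fun z => P ((z + 1) / 2)); last first.
  by rewrite add0r mul1r -[1 + 1]/2 divff //; ring.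
have h z : I01 z -> I01 ((z + 1) / 2).
  by move=> [t t01 ->]; rewrite -h2 -rcV -rc1 -rcD -rcM; apply: I01_rc; lra.
have d z : cder (@I01 R) (fun z => (z + 1) / 2) z ((1 + 0) * 2^-1 + (z + 1) * 0).
  by apply: cderM; [apply: cderD; [exact: cder_id|exact: cder_cst]|exact: cder_cst].
move=> z zI; apply: cder_eq (cder_comp h (d z) (dP _ (h _ zI))).
have -> : seg_point a b ((z + 1) / 2) = seg_point m b z by rewrite /seg_point /m; field.
by rewrite /m; field.
Qed.

Lemma isseg_cont f a b : (forall z, I01 z -> cont setT f (seg_point a b z)) ->
  isseg f a b (seg f a b).
Proof.
move=> h; apply: cintP => z zI; apply: contM; last exact: cont_cst.
exact: (@cont_comp _ _ setT) (cont_seg_point _ _ _ _) (h z zI).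
Qed.

Lemma isseg_disc f c r a b : (forall w, disc c r w -> cont setT f w) ->
  disc c r a -> disc c r b -> isseg f a b (seg f a b).
Proof. by move=> h ha hb; apply: isseg_cont => z zI; apply: h; exact: seg_point_disc. Qed.

Definition tri f a b c := seg f a b + seg f b c + seg f c a.

Lemma seg_rev f c r a b : (forall w, disc c r w -> cont setT f w) ->
  disc c r a -> disc c r b -> seg f b a = - seg f a b.
Proof. by move=> h ha hb; apply: cintE; apply: isseg_rev; exact: isseg_disc h _ _. Qed.

Lemma seg_half f c r a b : (forall w, disc c r w -> cont setT f w) ->
  disc c r a -> disc c r b ->
  seg f a b = seg f a ((a + b) / 2) + seg f ((a + b) / 2) b.
Proof.
move=> h ha hb; have hm : disc c r ((a + b) / 2).
  have -> : (a + b) / 2 = seg_point a b (rc 2^-1).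
    by rewrite rcV rc_nat /seg_point; field.
  by apply: seg_point_disc => //; apply: I01_rc; lra.
have h1 := isseg_disc h ha hb; have h2 := isseg_disc h ha hm.
have -> : seg f ((a + b) / 2) b = seg f a b - seg f a ((a + b) / 2).
  exact: cintE (isseg_half h1 h2).
by ring.
Qed.

Lemma isseg_sub f g a b I J : isseg f a b I -> isseg g a b J ->
  isseg (fun w => f w - g w) a b (I - J).
Proof. by move=> /isintB h /h; apply: isint_ext => z _; rewrite mulrBl. Qed.

Lemma midE a b : (a + b) / 2 = seg_point a b (rc 2^-1).
Proof. by rewrite rcV rc_nat /seg_point; field. Qed.

Lemma mid_disc c r a b : disc c r a -> disc c r b -> disc c r ((a + b) / 2).
Proof. by move=> ha hb; rewrite midE; apply: seg_point_disc => //; apply: I01_rc; lra. Qed.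

Lemma mid_cdisc c r a b : cdisc c r a -> cdisc c r b -> cdisc c r ((a + b) / 2).
Proof. by move=> ha hb; rewrite midE; apply: seg_point_cdisc => //; apply: I01_rc; lra. Qed.

Lemma tri_half f z0 r a b c : (forall w, disc z0 r w -> cont setT f w) ->
  disc z0 r a -> disc z0 r b -> disc z0 r c ->
  let m1 := (a + b) / 2 in let m2 := (b + c) / 2 in let m3 := (c + a) / 2 in
  tri f a b c = tri f a m1 m3 + tri f m1 b m2 + tri f m3 m2 c + tri f m1 m2 m3.
Proof.
move=> h ha hb hc m1 m2 m3.
have h1 : disc z0 r m1 by exact: mid_disc.
have h2 : disc z0 r m2 by exact: mid_disc.
have h3 : disc z0 r m3 by exact: mid_disc.
rewrite /tri (seg_half h ha hb) (seg_half h hb hc) (seg_half h hc ha).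
rewrite -/m1 -/m2 -/m3.
rewrite (seg_rev h h1 h3) (seg_rev h h1 h2) (seg_rev h h2 h3); ring.
Qed.

Lemma cnorm_half z : cnorm (z / 2) = cnorm z / 2.
Proof. by rewrite cnormM cnormV cnorm_nat. Qed.

(** Among the four quarters of a triangle one keeps a quarter of the integral. The chosen triangles
    shrink to a point [l], near which [f] is affine up to a small relative error, and the affine
    part [g] has the primitive [G]. *)
Lemma goursat f z0 r a b c :
  (forall w, disc z0 r w -> exists l, cder setT f w l) ->
  disc z0 r a -> disc z0 r b -> disc z0 r c -> tri f a b c = 0.
Proof.
move=> df ha hb hc.
have cf w : disc z0 r w -> cont setT f w by move=> /df [l /cder_cont].
apply/eqP; rewrite -cnorm_eq0; apply/eqP/le_anti; rewrite cnorm_ge0 andbT leNgt.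
apply/negP; set delta := cnorm _ => delta0.
(* All triangles stay in the closed disc of radius [s < r], which keeps the limit point inside the
   open disc where [f] is differentiable. *)
pose s := Num.max (cnorm (a - z0)) (Num.max (cnorm (b - z0)) (cnorm (c - z0))).
have sr : s < r by rewrite !gt_max; apply/and3P.
have sdisc w : cdisc z0 s w -> disc z0 r w by exact: cdisc_disc.
pose K := 1 + cnorm (b - a) + cnorm (c - b) + cnorm (a - c).
pose T := (C * C * C)%type.
pose t3 (p : T) := tri f p.1.1 p.1.2 p.2.
pose m1 (p : T) := (p.1.1 + p.1.2) / 2.
pose m2 (p : T) := (p.1.2 + p.2) / 2.
pose m3 (p : T) := (p.2 + p.1.1) / 2.
pose T1 p : T := (p.1.1, m1 p, m3 p). pose T2 p : T := (m1 p, p.1.2, m2 p).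
pose T3 p : T := (m3 p, m2 p, p.2). pose T4 p : T := (m1 p, m2 p, m3 p).
pose big p q := cnorm (t3 p) / 4 <= cnorm (t3 q).
pose step p := if `[< big p (T1 p) >] then T1 p else
  if `[< big p (T2 p) >] then T2 p else
  if `[< big p (T3 p) >] then T3 p else T4 p.
pose u n := iter n step (a, b, c).
have uS n : u n.+1 = step (u n) by [].
pose good n (p : T) := [/\ cdisc z0 s p.1.1, cdisc z0 s p.1.2 & cdisc z0 s p.2] /\
  [/\ cnorm (p.1.2 - p.1.1) <= K / 2 ^+ n, cnorm (p.2 - p.1.2) <= K / 2 ^+ n &
      cnorm (p.1.1 - p.2) <= K / 2 ^+ n].
have hS n : K / 2 ^+ n.+1 = K / 2 ^+ n / 2.
  by rewrite exprS; field; rewrite expf_neq0.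
have stepE n p : good n p -> [/\ good n.+1 (step p), big p (step p) &
    cnorm ((step p).1.1 - p.1.1) <= K / 2 ^+ n].
  case: p => [[x y] v] [[/= hx hy hv] [/= e1 e2 e3]].
  have k0 : 0 <= K / 2 ^+ n by apply: le_trans e1; exact: cnorm_ge0.
  have M1 := mid_cdisc hx hy; have M2 := mid_cdisc hy hv; have M3 := mid_cdisc hv hx.
  have E1 (p q : C) : cnorm (q - p) <= K / 2 ^+ n ->
     cnorm ((q - p) / 2) <= K / 2 ^+ n / 2 by rewrite cnorm_half; lra.
  have E1' (p q : C) : cnorm (q - p) <= K / 2 ^+ n ->
     cnorm ((p - q) / 2) <= K / 2 ^+ n / 2 by rewrite cnormB; exact: E1.
  have tE := tri_half cf (sdisc _ hx) (sdisc _ hy) (sdisc _ hv).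
  have g1 : good n.+1 (T1 (x, y, v)).
    split=> //=; rewrite hS; split.
    - by rewrite /m1 /= (_ : _ - _ = (y - x) / 2); [exact: E1|field].
    - by rewrite /m1 /m3 /= (_ : _ - _ = (v - y) / 2); [exact: E1|field].
    - by rewrite /m3 /= (_ : _ - _ = (x - v) / 2); [exact: E1|field].
  have g2 : good n.+1 (T2 (x, y, v)).
    split=> //=; rewrite hS; split.
    - by rewrite /m1 /= (_ : _ - _ = (y - x) / 2); [exact: E1|field].
    - by rewrite /m2 /= (_ : _ - _ = (v - y) / 2); [exact: E1|field].
    - by rewrite /m1 /m2 /= (_ : _ - _ = (x - v) / 2); [exact: E1|field].
  have g3 : good n.+1 (T3 (x, y, v)).
    split=> //=; rewrite hS; split.
    - by rewrite /m2 /m3 /= (_ : _ - _ = (y - x) / 2); [exact: E1|field].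
    - by rewrite /m2 /= (_ : _ - _ = (v - y) / 2); [exact: E1|field].
    - by rewrite /m3 /= (_ : _ - _ = (x - v) / 2); [exact: E1|field].
  have g4 : good n.+1 (T4 (x, y, v)).
    split=> //=; rewrite hS; split.
    - by rewrite /m2 /m1 /= (_ : _ - _ = (v - x) / 2); [exact: E1'|field].
    - by rewrite /m2 /m3 /= (_ : _ - _ = (x - y) / 2); [exact: E1'|field].
    - by rewrite /m3 /m1 /= (_ : _ - _ = (y - v) / 2); [exact: E1'|field].
  have d0 : cnorm (x - x) <= K / 2 ^+ n by rewrite subrr cnorm0.
  have d1 : cnorm (m1 (x, y, v) - x) <= K / 2 ^+ n.
    rewrite /m1 /= (_ : _ - _ = (y - x) / 2); last by field.
    by have := E1 _ _ e1; lra.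
  have d3 : cnorm (m3 (x, y, v) - x) <= K / 2 ^+ n.
    rewrite /m3 /= (_ : _ - _ = (v - x) / 2); last by field.
    by have := E1' _ _ e3; lra.
  rewrite /step; case: asboolP => b1; first by [].
  case: asboolP => b2; first by [].
  case: asboolP => b3; first by [].
  split=> //; move: b1 b2 b3; rewrite /big /t3 /= tE => /negP b1 /negP b2 /negP b3.
  move: b1 b2 b3; rewrite -!ltNge.
  set q1 := tri f x _ _; set q2 := tri f _ y _; set q3 := tri f _ _ v.
  set q4 := tri f _ _ _ => b1 b2 b3.
  have := cnormD (q1 + q2 + q3) q4; have := cnormD (q1 + q2) q3.
  by have := cnormD q1 q2; lra.
have p0 n : 0 < (4 ^+ n : R)^-1 by rewrite invr_gt0 exprn_gt0.
have un n : good n (u n) /\ delta / 4 ^+ n <= cnorm (t3 (u n)).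
  elim: n => [|n [g hn]].
    rewrite expr0 divr1; split=> //; rewrite /u /=.
    have c1 := cnorm_ge0 (b - a); have c2 := cnorm_ge0 (c - b).
    have c3 := cnorm_ge0 (a - c).
    rewrite /good /= expr0 divr1 /cdisc /K; split; split; try lra;
    by rewrite !le_max lexx ?orbT.
  have [g' bg _] := stepE _ _ g; rewrite uS; split=> //.
  move: bg; rewrite /big exprS invfM; have := p0 n; lra.
have [n|l hl] := @geometric_limit _ (fun n => (u n).1.1) K.
  by have [g _] := un n; have [_ _] := stepE _ _ g; rewrite -uS.
have K1 : 1 <= K.
  rewrite /K; have c1 := cnorm_ge0 (b - a); have c2 := cnorm_ge0 (c - b).
  by have c3 := cnorm_ge0 (a - c); lra.
have Dl : disc z0 r l.
  rewrite /disc; have rs0 : 0 < r - s by rewrite subr_gt0.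
  have [n hn] := half_pow_small (4 * K) rs0.
  have [[[g _ _] _] _] := un n.
  have := cnormD3 l (u n).1.1 z0; rewrite (cnormB l (u n).1.1).
  by have := hl n; move: g; rewrite /cdisc; lra.
have [m /cderP dm] := df _ Dl.
(* With [q = K / 2^n], the sides have length at most [q] and lie within [5 q] of [l], so each side
   errs by at most [5 e q^2], which is [5/16] of [delta / 4^n]; three sides give [15/16], less than
   the whole. *)
pose e := delta / (16 * K ^+ 2).
have e0 : 0 < e by rewrite divr_gt0 // mulr_gt0 // exprn_gt0 //; lra.
have [d d0 hd] := dm _ e0.
have [n hn] := half_pow_small (5 * K) d0.
have [[[gx gy gv] [e1 e2 e3]] hT] := un n; have hx := hl n.
move: gx gy gv e1 e2 e3 hT hx; case: (u n) => [[x y] v] /= gx gy gv e1 e2 e3 hT hx.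
pose q := K / 2 ^+ n.
have hy : cnorm (y - l) <= 5 * q by have := cnormD3 y x l; rewrite /q; lra.
have hv : cnorm (v - l) <= 5 * q.
  by have := cnormD3 v x l; rewrite (cnormB v x) /q; lra.
have {}hx : cnorm (x - l) <= 5 * q.
  by have := cnorm_ge0 (y - x); rewrite /q; lra.
have q0 : 0 <= q by have := cnorm_ge0 (y - x); rewrite /q; lra.
pose g w := f l + m * (w - l).
pose G w := (f l - m * l) * w + (m / 2) * w ^+ 2.
have dG w : cder setT G w (g w).
  apply: cder_eq (cderD (cderMl _ (cder_id _ _)) (cderMl _ (cderX 2 (cder_id _ _)))).
  by rewrite /g /=; field.
have main p1 p2 : cdisc l (5 * q) p1 -> cdisc l (5 * q) p2 ->
    cdisc z0 s p1 -> cdisc z0 s p2 -> cnorm (p2 - p1) <= q ->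
    cnorm (seg f p1 p2 - (G p2 - G p1)) <= e * (5 * q) * q.
  move=> h1 h2 /sdisc s1 /sdisc s2 h12.
  have h := isseg_sub (isseg_disc cf s1 s2) (@isseg_exact g G p1 p2 (fun z _ => dG _)).
  apply: le_trans (isseg_bound (M := e * (5 * q)) h _) _.
    move=> z zI; have hz := seg_point_cdisc zI h1 h2.
    rewrite /g opprD addrA; apply: le_trans (hd _ I _) _.
      by apply: le_lt_trans hz _; rewrite /q; lra.
    by apply: ler_wpM2l => //; exact: ltW.
  by apply: ler_wpM2l => //; apply: mulr_ge0; [exact: ltW|lra].
have := main x y hx hy gx gy e1; have := main y v hy hv gy gv e2.
have := main v x hv hx gv gx e3; move: hT; rewrite /t3 /tri /=.
have -> : seg f x y + seg f y v + seg f v x = (seg f x y - (G y - G x)) +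
   (seg f y v - (G v - G y)) + (seg f v x - (G x - G v)) by ring.
set s1 := seg f x y - _; set s2 := seg f y v - _; set s3 := seg f v x - _.
have := cnormD (s1 + s2) s3; have := cnormD s1 s2.
have -> : e * (5 * q) * q = 5 / 16 * (delta / 4 ^+ n).
  rewrite /e /q (_ : (4 : R) = 2 * 2) ?exprMn; last by ring.
  by field; rewrite expf_neq0 //= lt0r_neq0 //; lra.
have : 0 < delta / 4 ^+ n by rewrite mulr_gt0.
by lra.
Qed.

Lemma disc_primitive f z0 r :
  (forall w, disc z0 r w -> exists l, cder setT f w l) ->
  exists F, forall w, disc z0 r w -> cder setT F w (f w).
Proof.
move=> df; exists (seg f z0) => w hw; apply/cderP => e e0.
have cf v : disc z0 r v -> cont setT f v by move=> /df [l /cder_cont].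
have r0 : disc z0 r z0.
  by rewrite /disc subrr cnorm0; apply: le_lt_trans hw; exact: cnorm_ge0.
have [d d0 hd] := nearbyI (disc_nearby hw) (cf w hw e e0).
exists d => // v _ hv.
have dv : disc z0 r v by have [] := hd v I hv.
have -> : seg f z0 v - seg f z0 w = seg f w v.
  have := goursat df r0 hw dv; rewrite /tri (seg_rev cf r0 dv) => /eqP.
  by rewrite subr_eq0 => /eqP <-; rewrite addrC addKr.
have h := isseg_sub (isseg_disc cf hw dv) (@isseg_exact (fun=> f w) (fun z => f w * z) w v
   (fun z _ => cder_eq (mulr1 _) (cderMl (f w) (cder_id _ _)))).
rewrite mulrBr; apply: isseg_bound h _ => z zI.
have hz : cnorm (seg_point w v z - w) < d.
  have -> : seg_point w v z - w = z * (v - w) by rewrite /seg_point; ring.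
  have [t /andP[t0 t1] ->] := zI; rewrite cnormM cnorm_rc ger0_norm //.
  by apply: le_lt_trans hv; rewrite ler_piMl ?cnorm_ge0.
by have [_ /ltW] := hd _ I hz.
Qed.

End Segment.

(** * Circles and Cauchy integrals with an arbitrary continuous density *)

Section Circle.
Variable R : realType.
Local Notation C := (Cplx R).
Implicit Types (f g phi : C -> C) (a b c z w : C) (r : R).

Lemma cder_quadratic D f z l (A : R) :
  nearby D z (fun w => cnorm (f w - f z - l * (w - z)) <= A * cnorm (w - z) ^+ 2) ->
  cder D f z l.
Proof.
move=> h; apply/cderP => e e0.
have d0 : 0 < e / (`|A| + 1) by rewrite divr_gt0 // ltr_wpDl.
apply: nearbyW (nearbyI h (nearbyT D (nearby_ball z d0))) => w _ [h1 h2].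
apply: le_trans h1 _; rewrite expr2 mulrA ler_wpM2r ?cnorm_ge0 //.
have n0 := cnorm_ge0 (w - z); have A0 := normr_ge0 A.
move: h2; rewrite ltr_pdivlMr; last by lra.
have : A * cnorm (w - z) <= `|A| * cnorm (w - z) by rewrite ler_wpM2r // ler_norm.
by lra.
Qed.

Lemma cder0_cst c r f a b : (forall w, disc c r w -> cder setT f w 0) ->
  disc c r a -> disc c r b -> f a = f b.
Proof.
move=> h ha hb; have : isseg (fun=> 0) a b (f b - f a).
  by apply: isseg_exact => z zI; apply: h; exact: seg_point_disc.
move=> /isseg_bound h1; apply/esym/eqP; rewrite -subr_eq0 -cnorm_eq0.
apply/eqP/le_anti; rewrite cnorm_ge0 andbT -[leRHS](mul0r (cnorm (b - a))).
by apply: h1 => z _; rewrite cnorm0.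
Qed.

Lemma cderI0_cst f : (forall z, I01 z -> cder (@I01 R) f z 0) -> f 1 = f 0.
Proof.
move=> h; have : isint (fun=> 0) (f 1 - f 0) by exists f.
move=> /isint_bound h1; apply/eqP; rewrite -subr_eq0 -cnorm_eq0.
by apply/eqP/le_anti; rewrite cnorm_ge0 andbT; apply: h1 => z _; rewrite cnorm0.
Qed.

Lemma contI_bounded phi : contI phi ->
  exists M : R, forall z, I01 z -> cnorm (phi z) <= M.
Proof.
move=> cphi; have h z : I01 z -> cont (@I01 R) (fun w => rc (cnorm (phi w))) z.
  move=> zI e e0; apply: nearbyW (cphi z zI e e0) => w _.
  apply: le_lt_trans; rewrite -rcB cnorm_rc ler_norml.
  have := cnormD (phi w - phi z) (phi z); have := cnormD (phi z - phi w) (phi w).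
  by rewrite !subrK (cnormB (phi z)); lra.
have [t _ ht] := EVT_max ler01 (continuous_subspaceT (contI_clamp h)).
exists (cnorm (phi (rc (Num.max 0 (Num.min 1 t))))) => z [s s01 ->].
by have := ht s; rewrite in_itv /= (clampE s01) => /(_ s01).
Qed.

Definition tau : C := rc (2 * pi) * ci R.

Lemma ci_sqr : ci R * ci R = -1.
Proof. by rewrite -expr2; exact: sqr_i. Qed.

Lemma ci_neq0 : ci R != 0.
Proof. by apply/eqP => h; have := ci_sqr; rewrite h mul0r => /eqP; rewrite eq_sym oppr_eq0 oner_eq0. Qed.

Lemma tau_neq0 : tau != 0.
Proof. by rewrite mulf_neq0 ?ci_neq0 // rc_eq0 mulf_neq0 // lt0r_neq0 // pi_gt0. Qed.

(** This is [exp(2 pi i t)] at [t = Re z]: a path and not a holomorphic function, differentiated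
    only relative to [I01]. *)
Definition ei z : C :=
  rc (cos (2 * pi * complex.Re z)) + ci R * rc (sin (2 * pi * complex.Re z)).

Lemma ei0 : ei 0 = 1.
Proof. by rewrite /ei /= mulr0 cos0 sin0 rc0 mulr0 addr0. Qed.

Lemma ei1 : ei 1 = 1.
Proof. by rewrite /ei /= mulr1 mulr_natl cos2pi sin2pi rc0 mulr0 addr0. Qed.

Lemma cder_ei z : I01 z -> cder (@I01 R) ei z (tau * ei z).
Proof.
move=> [t t01 ->].
have d : is_derive t 1 (fun s : R => 2 * pi * s) (2 * pi).
  have := @is_deriveZ R R R id (2 * pi) t 1 1 (is_derive_id t 1).
  by rewrite [_ *: 1]mulr1.
have dc : is_derive t 1 (fun s : R => cos (2 * pi * s)) (- sin (2 * pi * t) * (2 * pi)).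
  exact: is_derive1_comp.
have ds : is_derive t 1 (fun s : R => sin (2 * pi * s)) (cos (2 * pi * t) * (2 * pi)).
  exact: is_derive1_comp.
apply: cder_eq (cderD (cder_real dc) (cderMl (ci R) (cder_real ds))).
rewrite /ei Re_rc /tau !rcM rcN; have := ci_sqr.
set i := ci R => i2; set u := rc (cos _); set v := rc (sin _).
have -> : rc 2 * rc pi * i * (u + i * v) =
    rc 2 * rc pi * i * u + rc 2 * rc pi * v * (i * i) by ring.
by rewrite i2; ring.
Qed.

Lemma cnorm_ei z : cnorm (ei z) = 1.
Proof.
apply/eqP; rewrite -(@eqrXn2 _ 2) ?cnorm_ge0 // expr1n cnorm_sqr /ei.
set u := cos _; set v := sin _.
have -> : complex.Re (rc u + ci R * rc v) = u by rewrite /=; ring.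
have -> : complex.Im (rc u + ci R * rc v) = v by rewrite /=; ring.
by rewrite cos2Dsin2.
Qed.

Definition circ c r z := c + rc r * ei z.
(** The velocity of the path [circ c r]. *)
Definition dcirc c r z := tau * (circ c r z - c).

Lemma circ01 c r : circ c r 1 = circ c r 0.
Proof. by rewrite /circ ei0 ei1. Qed.

Lemma cnorm_circ c r z : 0 < r -> cnorm (circ c r z - c) = r.
Proof.
by move=> r0; rewrite /circ addrC addKr cnormM cnorm_ei cnorm_rc mulr1 gtr0_norm.
Qed.

Lemma cder_circ c r z : I01 z -> cder (@I01 R) (circ c r) z (dcirc c r z).
Proof.
move=> zI; apply: cder_eq (cderD (cder_cst _ c z) (cderMl (rc r) (cder_ei zI))).
by rewrite /dcirc /circ; ring.
Qed.

Lemma contI_circ c r : contI (circ c r).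
Proof. by move=> z zI; exact: cder_cont (cder_circ c r zI). Qed.

Lemma contI_dcirc c r : contI (dcirc c r).
Proof.
move=> z zI; apply: contM; first exact: cont_cst.
by apply: contB; [exact: contI_circ|exact: cont_cst].
Qed.

Lemma circ_dist c r z w : 0 < r -> r - cnorm (z - c) <= cnorm (circ c r w - z).
Proof.
by move=> r0; have := cnormD3 (circ c r w) z c; rewrite cnorm_circ //; lra.
Qed.

Lemma circ_neq c r z w : 0 < r -> disc c r z -> circ c r w - z != 0.
Proof.
move=> r0 hz; rewrite -cnorm_gt0; apply: (lt_le_trans _ (circ_dist c z w r0)).
by rewrite subr_gt0.
Qed.

(** The velocity of the circle is part of the density [phi], so every continuous [phi] gives a
    holomorphic function of [z]. *)
Definition cauchyI c r (m : nat) phi z :=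
  cint (fun t => phi t / (circ c r t - z) ^+ m).

Lemma contI_cauchy c r m phi z : 0 < r -> contI phi -> disc c r z ->
  contI (fun t => phi t / (circ c r t - z) ^+ m).
Proof.
move=> r0 cphi hz t tI; apply: contM_div; first exact: cphi.
  by apply: contX; apply: contB; [exact: contI_circ|exact: cont_cst].
by rewrite expf_neq0 // circ_neq.
Qed.

Lemma cauchy_int c r m phi z : 0 < r -> contI phi -> disc c r z ->
  isint (fun t => phi t / (circ c r t - z) ^+ m) (cauchyI c r m phi z).
Proof. by move=> r0 cphi hz; apply: cintP; exact: contI_cauchy. Qed.

(** For the reciprocals [x] and [y] of [zeta - z] and [zeta - w], the remainder
    [y^m - x^m - m (w - z) x^(m+1)] has the factor [(w - z)^2], uniformly on the circle. Order 1
    gives the derivative of [f], order 2 shows that this derivative is holomorphic. *)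
Lemma cder_cauchy c r m phi z : (0 < m <= 2)%N -> 0 < r -> contI phi -> disc c r z ->
  cder setT (cauchyI c r m phi) z (m%:R * cauchyI c r m.+1 phi z).
Proof.
move=> m12 r0 cphi hz; have [M hM] := contI_bounded cphi.
have M0 : 0 <= M by apply: le_trans (hM _ (@I01_0 R)); exact: cnorm_ge0.
have hzr : cnorm (z - c) < r by [].
pose d := (r - cnorm (z - c)) / 2; have d0 : 0 < d.
  by rewrite divr_gt0 // subr_gt0.
pose B := d^-1; have B0 : 0 < B by rewrite invr_gt0.
have hdist t w : cnorm (w - z) < d -> cnorm (circ c r t - w)^-1 <= B.
  move=> hw; rewrite cnormV lef_pV2 ?posrE //; last first.
    by rewrite cnorm_gt0 circ_neq // /disc; have := cnormD3 w z c; rewrite /d in hw; lra.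
  have := circ_dist c z t r0; have := cnormD3 (circ c r t) w z.
  by rewrite /d in hw *; lra.
(* The cofactor of [(w - z)^2] is bounded by [B^3] for [m = 1] and by [3 B^4] for [m = 2]; the
   constant covers both. *)
apply: (@cder_quadratic _ _ _ _ (M * (3 * B ^+ 3 * (1 + B)))).
exists d => // w _ hw.
have hw' : disc c r w by rewrite /disc; have := cnormD3 w z c; rewrite /d in hw; lra.
have := isintB (isintB (cauchy_int m r0 cphi hw') (cauchy_int m r0 cphi hz))
  (isintMl (m%:R * (w - z)) (cauchy_int m.+1 r0 cphi hz)).
rewrite -[_ - _ * (w - z)]/(_ - _ * (w - z)) (mulrAC m%:R _ (w - z)).
move=> /isint_bound; apply=> t tI.
have n1 := circ_neq t r0 hz; have n2 := circ_neq t r0 hw'.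
have bx := hdist t z; have by_ := hdist t w hw.
rewrite subrr cnorm0 in bx; have {}bx := bx d0.
set x := (circ c r t - z)^-1 in bx; set y := (circ c r t - w)^-1 in by_.
have h0 := cnorm_ge0 (w - z).
have hx0 := cnorm_ge0 x; have hy0 := cnorm_ge0 y.
have B2 : B ^+ 3 <= 3 * B ^+ 3 * (1 + B).
  have : 0 <= B ^+ 3 by rewrite exprn_ge0 ?ltW.
  have : 0 <= B ^+ 3 * B by rewrite mulr_ge0 ?exprn_ge0 ?ltW.
  by nra.
have B3 : 3 * B ^+ 4 <= 3 * B ^+ 3 * (1 + B).
  have : 0 <= B ^+ 3 by rewrite exprn_ge0 ?ltW.
  by rewrite (exprSr B 3); lra.
have hp : cnorm (phi t) <= M by exact: hM.
have hp0 := cnorm_ge0 (phi t).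
have xyB : cnorm (x ^+ 2 * y) <= B ^+ 3.
  rewrite cnormM cnormX (exprSr B 2); apply: ler_pM; [by rewrite exprn_ge0|exact: hy0| |exact: by_].
  by rewrite ler_pXn2r ?nnegrE // ltW.
have main (E : C) (N : R) : cnorm E <= N -> N <= 3 * B ^+ 3 * (1 + B) ->
   cnorm (phi t * ((w - z) ^+ 2 * E)) <= M * (3 * B ^+ 3 * (1 + B)) * cnorm (w - z) ^+ 2.
  move=> hE hN; rewrite (cnormM (phi t)) (cnormM (_ ^+ 2)) cnormX mulrCA [leRHS]mulrC.
  apply: ler_wpM2l; first exact: exprn_ge0.
  by apply: ler_pM => //; [exact: cnorm_ge0|lra].
case: m m12 => [|[|[|//]]] // _.
  rewrite (_ : _ - _ = phi t * ((w - z) ^+ 2 * (x ^+ 2 * y))); first exact: main xyB B2.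
  by rewrite /x /y; field; apply/andP.
rewrite (_ : _ - _ = phi t * ((w - z) ^+ 2 * (x ^+ 2 * y * (y + 2 * x)))).
  apply: main (_ : _ <= 3 * B ^+ 4) B3.
  rewrite cnormM (_ : 3 * B ^+ 4 = B ^+ 3 * (B + 2 * B)); last by ring.
  apply: ler_pM => //; try exact: cnorm_ge0.
  apply: le_trans (cnormD _ _) _; apply: lerD => //.
  by rewrite cnormM cnorm_nat ler_wpM2l.
by rewrite /x /y; field; apply/andP.
Qed.

(** The derivative in [z] vanishes, because the kernel of order two has a primitive that closes up
    around the circle; at the centre the integrand is the constant [tau]. *)
Lemma cauchy_one c r z : 0 < r -> disc c r z -> cauchyI c r 1 (dcirc c r) z = tau.
Proof.
move=> r0 hz; have cd := @contI_dcirc c r.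
have d0 w : disc c r w -> cder setT (cauchyI c r 1 (dcirc c r)) w 0.
  move=> hw; apply: cder_eq (cder_cauchy _ r0 cd hw) => //.
  rewrite mul1r; apply: cintE.
  exists (fun t => - (circ c r t - w)^-1); last by rewrite circ01 subrr.
  move=> t tI; apply: cder_eq (cderN (cderV (cderB (cder_circ c r tI) (cder_cst _ w _)) _)).
    by rewrite subr0 mulNr opprK.
  exact: circ_neq.
have hc : disc c r c by rewrite /disc subrr cnorm0.
rewrite (cder0_cst d0 hz hc); apply: cintE.
apply: isint_ext (isint_cst tau) => t tI.
by rewrite expr1 /dcirc mulfK // circ_neq.
Qed.

End Circle.

(** * Cauchy's formula and its local consequences *)

Section Cauchy.
Variable R : realType.
Local Notation C := (Cplx R).
Implicit Types (f g phi F G h k q : C -> C) (a b c z w : C) (r : R).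

Lemma cauchy_ext c r m phi psi z : (forall t, I01 t -> phi t = psi t) ->
  0 < r -> contI phi -> disc c r z -> cauchyI c r m phi z = cauchyI c r m psi z.
Proof.
move=> e r0 cphi hz; apply/esym/cintE.
by apply: isint_ext (cauchy_int m r0 cphi hz) => t tI; rewrite e.
Qed.

Lemma contI_compcirc c r0 r f : 0 < r -> r < r0 ->
  (forall w, disc c r0 w -> cont setT f w) -> contI (fun t => f (circ c r t)).
Proof.
move=> rp rr cf t tI; apply: (@cont_comp _ _ setT) (contI_circ _ _ tI) _ => //.
by apply: cf; rewrite /disc cnorm_circ.
Qed.

Lemma contI_density c r0 r f : 0 < r -> r < r0 ->
  (forall w, disc c r0 w -> cont setT f w) ->
  contI (fun t => f (circ c r t) * dcirc c r t).
Proof.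
move=> rp rr cf t tI; apply: contM; last exact: contI_dcirc.
exact: contI_compcirc rp rr cf _ _.
Qed.

Definition cauchy_formula c r f := forall z, disc c r z ->
  cauchyI c r 1 (fun t => f (circ c r t) * dcirc c r t) z = tau R * f z.

Lemma second_order_bound c r F G f a b (M : R) :
  (forall w, disc c r w -> cder setT G w (F w)) ->
  (forall w, disc c r w -> cder setT F w (f w)) ->
  (forall w, disc c r w -> cnorm (f w) <= M) ->
  disc c r a -> disc c r b ->
  cnorm (G b - G a - F a * (b - a)) <= M * cnorm (b - a) ^+ 2.
Proof.
move=> dG dF hM ha hb.
have M0 : 0 <= M by apply: le_trans (hM _ ha); exact: cnorm_ge0.
have lip w : disc c r w -> cnorm (F w - F a) <= M * cnorm (w - a).
  move=> hw; have : isseg f a w (F w - F a).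
    by apply: isseg_exact => z zI; apply: dF; exact: seg_point_disc.
  by move=> /isseg_bound; apply => z zI; apply: hM; exact: seg_point_disc.
have h1 : isseg F a b (G b - G a).
  by apply: isseg_exact => z zI; apply: dG; exact: seg_point_disc.
have h := isseg_sub h1 (@isseg_exact _ (fun=> F a) (fun z => F a * z) a b
   (fun z _ => cder_eq (mulr1 _) (cderMl (F a) (cder_id _ _)))).
rewrite mulrBr expr2 mulrA; apply: isseg_bound h _ => z zI.
apply: le_trans (lip _ _) _; first exact: seg_point_disc.
apply: ler_wpM2l => //.
have -> : seg_point a b z - a = z * (b - a) by rewrite /seg_point; ring.
have [t /andP[t0 t1] ->] := zI; rewrite cnormM cnorm_rc ger0_norm //.
by rewrite ler_piMl ?cnorm_ge0.
Qed.

(* Deform the circle to the point [z] along [s |-> z + s (zeta - z)]; since [G]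
   has a second derivative bounded by [M], the integral varies quadratically. *)
Lemma cauchy_formula_C2 c r0 r F G f (M : R) : 0 < r -> r < r0 ->
  (forall w, disc c r0 w -> cder setT G w (F w)) ->
  (forall w, disc c r0 w -> cder setT F w (f w)) ->
  (forall w, disc c r0 w -> cnorm (f w) <= M) -> cauchy_formula c r G.
Proof.
move=> rp rr dG dF hM z hz.
have rp0 : 0 < r0 by exact: lt_trans rr.
have hc : disc c r0 c by rewrite /disc subrr cnorm0.
have M0 : 0 <= M by apply: le_trans (hM _ hc); exact: cnorm_ge0.
have hz0 : disc c r0 z by apply: lt_trans rr.
have cG w : disc c r0 w -> cont setT G w by move=> /dG /cder_cont.
have cF w : disc c r0 w -> cont setT F w by move=> /dF /cder_cont.
have zD t : disc c r0 (circ c r t) by rewrite /disc cnorm_circ.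
have sD s t : I01 s -> disc c r0 (seg_point z (circ c r t) s) by move=> sI; exact: seg_point_disc.
have csp s : contI (fun t => seg_point z (circ c r t) s).
  move=> t tI; apply: contD; first exact: cont_cst.
  apply: contM; first exact: cont_cst.
  by apply: contB; [exact: contI_circ|exact: cont_cst].
pose dens s t := G (seg_point z (circ c r t) s) * dcirc c r t.
have cdens s : I01 s -> contI (dens s).
  move=> sI t tI; apply: contM; last exact: contI_dcirc.
  exact: (@cont_comp _ _ setT) (csp s t tI) (cG _ (sD _ _ sI)).
pose J s := cauchyI c r 1 (dens s) z.
have J1 : J 1 = cauchyI c r 1 (fun t => G (circ c r t) * dcirc c r t) z.
  by apply: cauchy_ext => // [t tI|]; [rewrite /dens seg_point1|exact: cdens (@I01_1 R)].
have J0 : J 0 = tau R * G z.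
  rewrite -(cauchy_one rp hz) mulrC; apply: cintE.
  apply: isint_ext (isintMl (G z) (cauchy_int 1 rp (@contI_dcirc _ c r) hz)) => t tI.
  by rewrite /dens seg_point0 mulrA.
rewrite -J1 -J0; apply: cderI0_cst => s sI.
apply: (@cder_quadratic _ _ _ _ _ (M * (2 * r) ^+ 2 * (cnorm (tau R) * r / (r - cnorm (z - c))))).
apply: nearby_all => u uI; rewrite mul0r subr0.
(* This integral is the candidate derivative of [J] at [s]. For [s != 0] its integrand is the
   [t]-derivative of [s^-1 G] along the shrunken circle, a closed path; for [s = 0] that of [F z]
   times the circle itself. *)
have I0 : isint (fun t => F (seg_point z (circ c r t) s) * dcirc c r t) 0.
  have [s0|s0] := eqVneq s 0.
    exists (fun t => F z * circ c r t); last by rewrite circ01 subrr.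
    by move=> t tI; rewrite s0 seg_point0; apply: cderMl; exact: cder_circ.
  exists (fun t => s^-1 * G (seg_point z (circ c r t) s)); last by rewrite circ01 subrr.
  move=> t tI.
  have dsp : cder (@I01 R) (fun t => seg_point z (circ c r t) s) t (0 + (0 * (circ c r t - z) + s * (dcirc c r t - 0))).
    apply: cderD; first exact: cder_cst.
    apply: cderM; first exact: cder_cst.
    by apply: cderB; [exact: cder_circ|exact: cder_cst].
  apply: cder_eq (cderMl _ (@cder_comp _ _ setT _ _ _ _ _ _ dsp (dG _ (sD s t sI)))) => //.
  by field.
have := isintB (isintB (cauchy_int 1 rp (cdens u uI) hz) (cauchy_int 1 rp (cdens s sI) hz))
  (isintMl (u - s) I0).
rewrite mulr0 subr0 => /isint_bound; apply => t tI.
have n0 := circ_neq t rp hz.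
set zt := circ c r t in n0 *.
have -> : dens u t / (zt - z) ^+ 1 - dens s t / (zt - z) ^+ 1 -
   (u - s) * (F (seg_point z zt s) * dcirc c r t) =
  (G (seg_point z zt u) - G (seg_point z zt s) - F (seg_point z zt s) * (seg_point z zt u - seg_point z zt s)) *
  (dcirc c r t / (zt - z)).
  rewrite /dens -/zt expr1 (_ : seg_point z zt u - seg_point z zt s = (u - s) * (zt - z)).
    by field.
  by rewrite /seg_point; ring.
have := second_order_bound dG dF hM (sD s t sI) (sD u t uI); rewrite -/zt.
have -> : seg_point z zt u - seg_point z zt s = (u - s) * (zt - z) by rewrite /seg_point; ring.
rewrite cnormM cnormM => h1; apply: le_trans (ler_pM _ _ h1 (lexx _)) _; rewrite ?cnorm_ge0 //.
have zt2 : cnorm (zt - z) <= 2 * r.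
  by have := cnormD3 zt c z; rewrite /zt cnorm_circ // (cnormB c z); move: hz; rewrite /disc; lra.
have e1 : cnorm (dcirc c r t / (zt - z)) <= cnorm (tau R) * r / (r - cnorm (z - c)).
  rewrite cnormM cnormV /dcirc cnormM cnorm_circ //.
  apply: ler_wpM2l; first by rewrite mulr_ge0 ?cnorm_ge0 // ltW.
  rewrite lef_pV2 ?posrE ?cnorm_gt0 ?subr_gt0 //; exact: circ_dist.
have e2 : (cnorm (u - s) * cnorm (zt - z)) ^+ 2 <= cnorm (u - s) ^+ 2 * (2 * r) ^+ 2.
  rewrite exprMn; apply: ler_wpM2l; first by rewrite exprn_ge0 ?cnorm_ge0.
  by rewrite ler_pXn2r ?nnegrE ?cnorm_ge0 // mulr_ge0 // ltW.
have e3 : M * (cnorm (u - s) * cnorm (zt - z)) ^+ 2 <= M * (cnorm (u - s) ^+ 2 * (2 * r) ^+ 2).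
  exact: ler_wpM2l.
apply: le_trans (ler_pM _ _ e3 e1) _; rewrite ?cnorm_ge0 //.
  by rewrite mulr_ge0 // exprn_ge0 // mulr_ge0 // cnorm_ge0.
by rewrite le_eqVlt; apply/orP; left; apply/eqP; ring.
Qed.

(** Differentiating the formula for [F] in [z] squares the kernel; integration by parts around the
    circle moves the derivative back onto [F]. *)
Lemma cauchy_formula_deriv c r0 r F f : 0 < r -> r < r0 ->
  (forall w, disc c r0 w -> cder setT F w (f w)) ->
  (forall w, disc c r0 w -> cont setT f w) ->
  cauchy_formula c r F -> cauchy_formula c r f.
Proof.
move=> rp rr dF cf hF z hz.
have cF w : disc c r0 w -> cont setT F w by move=> /dF /cder_cont.
have hz0 : disc c r0 z by apply: lt_trans rr.
have cd := contI_density rp rr cF.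
have n0 := tau_neq0 R.
have d1 := cder_cauchy (isT : (0 < 1 <= 2)%N) rp cd hz.
have d2 : cder setT (cauchyI c r 1 (fun t => F (circ c r t) * dcirc c r t)) z (tau R * f z).
  have [d d0 hd] := disc_nearby hz.
  apply: cder_near (cderMl (tau R) (dF z hz0)); first by rewrite hF.
  by exists d => // w _ hw; rewrite hF //; exact: hd.
rewrite -(cder_unique d1 d2) mul1r; apply: cintE.
have I0 : isint (fun t => f (circ c r t) * dcirc c r t / (circ c r t - z)
   - F (circ c r t) * dcirc c r t / (circ c r t - z) ^+ 2) 0.
  exists (fun t => F (circ c r t) / (circ c r t - z)); last by rewrite circ01 subrr.
  move=> t tI; have hn := circ_neq t rp hz.
  have zD : disc c r0 (circ c r t) by rewrite /disc cnorm_circ.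
  have dz := cder_circ c r tI.
  apply: cder_eq (cder_div (@cder_comp _ _ setT _ _ _ _ _ _ dz (dF _ zD)) (cderB dz (cder_cst _ z _)) hn) => //.
  by field.
have := isintD I0 (cauchy_int 2 rp cd hz); rewrite add0r.
by apply: isint_ext => t tI; rewrite subrK expr1.
Qed.

Lemma cauchy_formula_bounded c r0 r f (M : R) : 0 < r -> r < r0 ->
  (forall w, disc c r0 w -> exists l, cder setT f w l) ->
  (forall w, disc c r0 w -> cnorm (f w) <= M) -> cauchy_formula c r f.
Proof.
move=> rp rr df hM; have [F dF] := disc_primitive df.
have [w /dF h|G dG] := @disc_primitive _ F c r0; first by exists (f w).
have cf w : disc c r0 w -> cont setT f w by move=> /df [l /cder_cont].
have cF w : disc c r0 w -> cont setT F w by move=> /dF /cder_cont.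
apply: (cauchy_formula_deriv rp rr dF cf).
apply: (cauchy_formula_deriv rp rr dG cF).
exact: cauchy_formula_C2 rp rr dG dF hM.
Qed.

Definition hol f z : Prop := nearby setT z (fun w => exists l, cder setT f w l).

Lemma hol_cder f z : hol f z -> exists l, cder setT f z l.
Proof. exact: nearby_pt. Qed.

Lemma hol_cont f z : hol f z -> cont setT f z.
Proof. by move=> /hol_cder [l /cder_cont]. Qed.

Lemma hol_near f g z : nearby setT z (fun w => f w = g w) -> hol f z -> hol g z.
Proof.
move=> /nearby_nearby fg hf; apply: nearbyW (nearbyI fg hf) => w _ [e [l dl]].
by exists l; apply: cder_near dl => //; exact: nearby_pt e.
Qed.

Lemma hol_cauchy f c : hol f c -> exists2 r0 : R, 0 < r0 &
  (forall w, disc c r0 w -> exists l, cder setT f w l) /\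
  (forall r, 0 < r -> r < r0 -> cauchy_formula c r f).
Proof.
move=> hf; have [r0 rp h] := nearbyI hf (cont_bounded (hol_cont hf)).
exists r0 => //; split=> [w hw|r r1 r2]; first by have [] := h w I hw.
apply: (cauchy_formula_bounded r1 r2 (M := cnorm (f c) + 1)) => w hw.
  by have [] := h w I hw.
by have [_ /ltW] := h w I hw.
Qed.

Lemma hol_deriv f z : hol f z -> exists f' : C -> C,
  nearby setT z (fun w => cder setT f w (f' w)) /\ hol f' z.
Proof.
move=> /hol_cauchy [r0 rp [df hC]].
pose r := r0 / 2; have r1 : 0 < r by rewrite /r; lra.
have r2 : r < r0 by rewrite /r; lra.
have cf w : disc z r0 w -> cont setT f w by move=> /df [l /cder_cont].
have cd := contI_density r1 r2 cf.
set phi := (fun t => _) in cd.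
have n0 := tau_neq0 R.
exists (fun w => (tau R)^-1 * (1 * cauchyI z r 2 phi w)); split.
  exists r => // w _ hw; have d := cder_cauchy (isT : (0 < 1 <= 2)%N) r1 cd hw.
  have [d' d0 hd] := disc_nearby hw.
  apply: cder_near (cderMl (tau R)^-1 d); first by rewrite hC // mulKf.
  by exists d' => // v _ hv; rewrite hC ?mulKf //; exact: hd.
exists r => // w _ hw; have d := cder_cauchy (isT : (0 < 2 <= 2)%N) r1 cd hw.
by eexists; apply: cderMl; apply: cderMl; exact: d.
Qed.

(** The quotient is a Cauchy integral whose density is divided by [zeta - p], since [1/(zeta - w) -
    1/(zeta - p) = (w - p) / ((zeta - w)(zeta - p))]; so it is holomorphic at [p] as well. *)
Lemma hol_divide k p : hol k p -> k p = 0 -> exists q,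
  hol q p /\ nearby setT p (fun w => k w = (w - p) * q w).
Proof.
move=> /hol_cauchy [r0 rp [dk hC]] k0.
pose r := r0 / 2; have r1 : 0 < r by rewrite /r; lra.
have r2 : r < r0 by rewrite /r; lra.
have ck w : disc p r0 w -> cont setT k w by move=> /dk [l /cder_cont].
have cd := contI_density r1 r2 ck.
set phi := (fun t => _) in cd.
have n0 := tau_neq0 R.
have hp : disc p r p by rewrite /disc subrr cnorm0.
pose psi t := phi t / (circ p r t - p).
have cpsi : contI psi.
  by move=> t tI; have := contI_cauchy 1 r1 cd hp tI.
exists (fun w => (tau R)^-1 * cauchyI p r 1 psi w); split.
  exists r => // w _ hw; have d := cder_cauchy (isT : (0 < 1 <= 2)%N) r1 cpsi hw.
  by eexists; apply: cderMl; exact: d.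
exists r => // w _ hw; rewrite mulrCA -[k w]subr0 -k0.
rewrite -[k w](mulKf n0) -[k p](mulKf n0) -(hC r r1 r2 w hw) -(hC r r1 r2 p hp) -mulrBr; congr (_ * _).
apply: (isint_unique (isintB (cauchy_int 1 r1 cd hw) (cauchy_int 1 r1 cd hp))).
apply: isint_ext (isintMl (w - p) (cauchy_int 1 r1 cpsi hw)) => t tI.
have h1 := circ_neq t r1 hw; have h2 := circ_neq t r1 hp.
by rewrite /psi !expr1; field; apply/andP.
Qed.

(** This takes the place of the subharmonicity of [log |h|]: [h z] is the average of [h] over each
    small circle, so [|h|] cannot stay at or below [1 - eta] on one. *)
Lemma mean_value_bound h z : hol h z -> h z = 1 -> exists2 r0 : R, 0 < r0 &
  forall r eta, 0 < r -> r < r0 -> 0 < eta ->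
  exists2 w, cnorm (w - z) = r & 1 - eta < cnorm (h w).
Proof.
move=> /hol_cauchy [r0 rp [dh hC]] h1; exists r0 => // r eta r1 r2 e0.
apply: contrapT => hno.
have ch w : disc z r0 w -> cont setT h w by move=> /dh [l /cder_cont].
have cd := contI_density r1 r2 ch.
have hz : disc z r z by rewrite /disc subrr cnorm0.
have := isintMl (tau R)^-1 (cauchy_int 1 r1 cd hz).
rewrite (hC r r1 r2 z hz) h1 mulr1 mulVf ?tau_neq0 // => /isint_bound hb.
have : cnorm (1 : C) <= 1 - eta.
  apply: hb => t tI.
  have -> : (tau R)^-1 * (h (circ z r t) * dcirc z r t / (circ z r t - z) ^+ 1) = h (circ z r t).
    by rewrite /dcirc; have := circ_neq t r1 hz; have := tau_neq0 R; move=> *; field; apply/andP.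
  rewrite leNgt; apply/negP => hlt; apply: hno; exists (circ z r t) => //.
  exact: cnorm_circ.
by rewrite cnorm1; lra.
Qed.

(** Riemann's argument: [(w - p)^2 q] is differentiable at [p] too, with value and derivative [0]
    there, so [w - p] can be divided out twice. *)
Lemma removable q p : nearby setT p (fun w => w != p -> exists l, cder setT q w l) ->
  (exists M : R, nearby setT p (fun w => w != p -> cnorm (q w) <= M)) ->
  exists q', hol q' p /\ nearby setT p (fun w => w != p -> q w = q' w).
Proof.
move=> hq [M hM].
pose k w := (w - p) ^+ 2 * q w.
have kp : k p = 0 by rewrite /k subrr expr0n mul0r.
have dk0 : cder setT k p 0.
  apply: (@cder_quadratic _ _ _ _ _ M); apply: nearbyW hM => w _ hw.
  rewrite kp subr0 mul0r subr0; have [->|wp] := eqVneq w p.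
    by rewrite kp subrr cnorm0 expr0n mulr0.
  by rewrite /k cnormM cnormX mulrC ler_wpM2r ?exprn_ge0 ?cnorm_ge0 //; exact: hw.
have hk : hol k p.
  apply: nearbyW hq => w _ hw; have [->|/hw [l dl]] := eqVneq w p; first by exists 0.
  by eexists; apply: cderM dl; apply: cderX; apply: cderB; [exact: cder_id|exact: cder_cst].
have [k1 [hk1 e1]] := hol_divide hk kp.
have k1p : k1 p = 0.
  have [l dl] := hol_cder hk1.
  have d1 := cderM (cderB (cder_id setT p) (cder_cst setT p p)) dl.
  have : cder setT k p ((1 - 0) * k1 p + (p - p) * l).
    apply: cder_near d1; first by rewrite kp subrr mul0r.
    by apply: nearbyW e1 => w _ ->.
  by move=> /(cder_unique dk0); rewrite subr0 mul1r subrr mul0r addr0.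
have [q' [hq' e2]] := hol_divide hk1 k1p.
exists q'; split=> //; apply: nearbyW (nearbyI e1 e2) => w _ [h1 h2] wp.
have n0 : w - p != 0 by rewrite subr_eq0.
apply: (mulfI (expf_neq0 2 n0)).
by rewrite -[LHS]/(k w) h1 h2 mulrA.
Qed.

End Cauchy.

(** * Closure properties of holomorphic functions *)

Section HolCalculus.
Variable R : realType.
Local Notation C := (Cplx R).
Implicit Types (f g : C -> C) (z w : C).

Lemma hol_cst c z : hol (fun=> c : C) z.
Proof. by apply: nearby_all => w _; exists 0; exact: cder_cst. Qed.

Lemma holD f g z : hol f z -> hol g z -> hol (fun w => f w + g w) z.
Proof.
move=> hf hg; apply: nearbyW (nearbyI hf hg) => w _ [[l dl] [m dm]].
by exists (l + m); exact: cderD.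
Qed.

Lemma holM f g z : hol f z -> hol g z -> hol (fun w => f w * g w) z.
Proof.
move=> hf hg; apply: nearbyW (nearbyI hf hg) => w _ [[l dl] [m dm]].
by eexists; apply: cderM; [exact: dl|exact: dm].
Qed.

Lemma holX f z n : hol f z -> hol (fun w => f w ^+ n) z.
Proof.
by move=> hf; apply: nearbyW hf => w _ [l dl]; eexists; apply: cderX; exact: dl.
Qed.

Lemma holV f z : hol f z -> f z != 0 -> hol (fun w => (f w)^-1) z.
Proof.
move=> hf f0; have nz := cont_nz (hol_cont hf) f0.
apply: nearbyW (nearbyI hf nz) => w _ [[l dl] w0].
by eexists; apply: cderV w0; exact: dl.
Qed.

Lemma hol_horner f (p : {poly C}) z : hol f z -> hol (fun w => p.[f w]) z.
Proof.
move=> hf; apply: nearbyW hf => w _ [l dl]; eexists.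
exact: (@cder_comp _ _ setT _ _ _ _ _ _ dl (cder_horner _ _ _)).
Qed.

End HolCalculus.

(** * An Ahlfors-Schwarz lemma without second derivatives *)

Section AhlforsSchwarz.
Variable R : realType.
Local Notation C := (Cplx R).
Implicit Types (f g : C -> C) (z w : C) (W : C -> R).

Definition conj z : C := (z^*)%C.

(** Divided by the first term on the right, this computes [1 + |T|^2] for the rotation
    [T = (w - z) / (1 + conj z * w)] of the sphere. *)
Lemma cnormD_sphere z w : (1 + cnorm z ^+ 2) * (1 + cnorm w ^+ 2) =
  cnorm (1 + conj z * w) ^+ 2 + cnorm (w - z) ^+ 2.
Proof. by rewrite !cnorm_sqr; case: z => a b; case: w => c d /=; ring. Qed.

(** The hyperbolic counterpart, for the map [r (w - z) / (r^2 - conj z * w)] of the disc of radius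
    [r] onto the unit disc. *)
Lemma cnorm_disc (r : R) z w : (r ^+ 2 - cnorm z ^+ 2) * (r ^+ 2 - cnorm w ^+ 2) =
  cnorm (rc (r ^+ 2) - conj z * w) ^+ 2 - (r * cnorm (w - z)) ^+ 2.
Proof. by rewrite exprMn !cnorm_sqr; case: z => a b; case: w => c d /=; ring. Qed.

Lemma conjM_id z : conj z * z = rc (cnorm z ^+ 2).
Proof.
case: z => a b; apply/eqP; rewrite eq_complex cnorm_sqr /=; apply/andP; split; apply/eqP; ring.
Qed.

Lemma bernoulli (x : R) n : 0 <= x -> 1 + n%:R * x <= (1 + x) ^+ n.
Proof.
move=> x0; elim: n => [|n IH]; first by rewrite mul0r addr0.
have h : 0 <= n%:R * x by rewrite mulr_ge0.
rewrite exprS; apply: le_trans (_ : (1 + x) * (1 + n%:R * x) <= _).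
  by rewrite -natr1; nra.
by apply: ler_wpM2l => //; lra.
Qed.

Lemma bernoulli4 (x : R) : x <= 1 -> 1 - 4 * x <= (1 - x) ^+ 4.
Proof.
move=> x1; have -> : (1 - x) ^+ 4 = 1 - 4 * x + x ^+ 2 * ((2 - x) ^+ 2 + 2) by ring.
by rewrite lerDl mulr_ge0 ?sqr_ge0 // addr_ge0 ?sqr_ge0.
Qed.

Lemma cder_sqr_norm f z l (k : R) : cder setT f z l -> f z = 0 -> 0 < k ->
  nearby setT z (fun w =>
    (cnorm l ^+ 2 - k) * cnorm (w - z) ^+ 2 <= cnorm (f w) ^+ 2 <=
    (cnorm l ^+ 2 + k) * cnorm (w - z) ^+ 2).
Proof.
move=> [phi [<- cphi fE]] f0 k0.
have [d d0 hd] := cont_bounded cphi.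
(* [A] bounds [|phi w| + |phi z|], so moduli within [k / A] of each other have squares within
   [k]. *)
pose A := 2 * cnorm (phi z) + 1.
have A0 : 0 < A by rewrite /A; have := cnorm_ge0 (phi z); lra.
have kA : 0 < k / A by rewrite divr_gt0.
apply: nearbyW (nearbyI (cont_bounded cphi) (cphi _ kA)) => w _ [h1 h2].
have := fE w I; rewrite f0 subr0 => ->; rewrite cnormM exprMn.
have s0 : 0 <= cnorm (w - z) ^+ 2 by rewrite exprn_ge0 ?cnorm_ge0.
have : `|cnorm (phi w) - cnorm (phi z)| <= cnorm (phi w - phi z).
  rewrite ler_norml; have := cnormD (phi w - phi z) (phi z).
  by have := cnormD (phi z - phi w) (phi w); rewrite !subrK (cnormB (phi z)); lra.
have x0 := cnorm_ge0 (phi w); have y0 := cnorm_ge0 (phi z).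
set x := cnorm (phi w) in h1 x0 *; set y := cnorm (phi z) in y0 h1 A A0 kA h2 *.
move=> h3; have : `|x - y| * (x + y) <= k / A * A.
  by apply: ler_pM => //; [lra|exact: le_trans h3 (ltW h2)|rewrite /A; lra].
rewrite divfK ?lt0r_neq0 // -[x + y]ger0_norm; last by lra.
rewrite -normrM (_ : (x - y) * (x + y) = x ^+ 2 - y ^+ 2); last by ring.
by rewrite ler_norml => h4; apply/andP; split; apply: ler_wpM2r => //; lra.
Qed.

Lemma cont_cnorm D f z : cont D f z -> cont D (fun w => rc (cnorm (f w))) z.
Proof.
move=> fz e e0; apply: nearbyW (fz e e0) => w _.
apply: le_lt_trans; rewrite -rcB cnorm_rc ler_norml.
have := cnormD (f w - f z) (f z); have := cnormD (f z - f w) (f w).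
by rewrite !subrK (cnormB (f z)); lra.
Qed.

(** A square replaces the closed disc because it is a product of compact intervals. *)
Lemma square_max (g : C -> R) (r : R) : 0 <= r ->
  (forall z, cont setT (fun w => rc (g w)) z) ->
  exists z, forall w, `|complex.Re w| <= r -> `|complex.Im w| <= r -> g w <= g z.
Proof.
move=> r0 cg; pose h (p : R * R) := g (rc p.1 + ci R * rc p.2).
have ch : continuous h.
  move=> p; apply/cvgrPdist_lt => e e0.
  have [d d0 hd] := cg (rc p.1 + ci R * rc p.2) e e0.
  have d20 : 0 < d / 2 by lra.
  exists (ball p.1 (d / 2), ball p.2 (d / 2)); first by split; exact: nbhsx_ballx.
  move=> q [/=]; rewrite /ball /= => q1 q2; rewrite distrC -cnorm_rc rcB; apply: hd => //.
  apply: le_lt_trans (cnorm_ReIm _) _; rewrite ReB ImB /= !(mul0r, mul1r, add0r, addr0, subr0, mulr0).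
  by rewrite (distrC q.1) (distrC q.2); lra.
have cA : compact (`[- r, r] `*` `[- r, r] : set (R * R)).
  by apply: compact_setX; exact: segment_compact.
have A0 : (`[- r, r] `*` `[- r, r] : set (R * R)) !=set0.
  by exists (0, 0); split; rewrite /= in_itv /=; lra.
have [[x y] _ hmax] := compact_EVT_max A0 cA (continuous_subspaceT ch).
exists (rc x + ci R * rc y) => w wr wi.
have := hmax (complex.Re w, complex.Im w); rewrite /h /= -ReImE; apply.
by rewrite inE; split; rewrite /= in_itv /= -ler_norml.
Qed.

(* The last clause is the curvature bound: [|l| / (1 + |phi|^2)] is the spherical
   derivative of [phi], and the holomorphic factor [K] carries no curvature. *)
Definition metric_chart (S : nat) (A : R) W z := exists K phi chi : C -> C,
  [/\ hol K z, hol phi z, hol chi z,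
    nearby setT z (fun w => W w = cnorm (K w) ^+ 2 *
      ((1 + cnorm (phi w) ^+ 2) * (1 + cnorm (chi w) ^+ 2)) ^+ S) &
    forall l m, cder setT phi z l -> cder setT chi z m ->
      W z <= A * ((cnorm l / (1 + cnorm (phi z) ^+ 2)) ^+ 2 +
                  (cnorm m / (1 + cnorm (chi z) ^+ 2)) ^+ 2) ^+ 2].

Lemma metric_chart_ge0 S A W z : metric_chart S A W z -> 0 <= W z.
Proof.
move=> [K [phi [chi [_ _ _ h _]]]]; rewrite (nearby_pt I h).
by rewrite mulr_ge0 ?exprn_ge0 ?cnorm_ge0 // mulr_ge0 // addr_ge0 ?exprn_ge0 ?cnorm_ge0.
Qed.

Lemma metric_chart_cont S A W z : metric_chart S A W z ->
  cont setT (fun w => rc (W w)) z.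
Proof.
move=> [K [phi [chi [hK hphi hchi h _]]]].
have c1 f : hol f z -> cont setT (fun w => 1 + rc (cnorm (f w)) ^+ 2) z.
  move=> hf; apply: contD; first exact: cont_cst.
  by apply: contX; apply: cont_cnorm; exact: hol_cont.
have e w : rc (cnorm (K w) ^+ 2 *
      ((1 + cnorm (phi w) ^+ 2) * (1 + cnorm (chi w) ^+ 2)) ^+ S) =
    rc (cnorm (K w)) ^+ 2 * ((1 + rc (cnorm (phi w)) ^+ 2) *
     (1 + rc (cnorm (chi w)) ^+ 2)) ^+ S.
  by rewrite /rc !(rmorphM, rmorphXn, rmorphD, rmorph1).
apply: cont_near (_ : cont setT (fun w => rc (cnorm (K w)) ^+ 2 *
    ((1 + rc (cnorm (phi w)) ^+ 2) * (1 + rc (cnorm (chi w)) ^+ 2)) ^+ S) z).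
- by rewrite -e (nearby_pt I h).
- by apply: nearbyW h => w _ ->; rewrite e.
apply: contM; first by apply: contX; apply: cont_cnorm; exact: hol_cont.
by apply: contX; apply: contM; exact: c1.
Qed.

(** The maximum principle in first-order terms. On a circle of small squared radius [s] the sphere
    factors gain about [S (|t1|^2 + |t2|^2) s] and the disc factor loses about [4 |t3|^2 s]. Were
    the gain larger, the point of the circle given by [mean_value_bound], where [|h|] is almost [1],
    would make the product exceed [1]. *)
Lemma max_comparison (S : nat) (h T1 T2 T3 : C -> C) z0 t1 t2 t3 :
  hol h z0 -> h z0 = 1 ->
  cder setT T1 z0 t1 -> cder setT T2 z0 t2 -> cder setT T3 z0 t3 ->
  T1 z0 = 0 -> T2 z0 = 0 -> T3 z0 = 0 ->
  nearby setT z0 (fun w => cnorm (h w) ^+ 2 *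
    ((1 + cnorm (T1 w) ^+ 2) * (1 + cnorm (T2 w) ^+ 2)) ^+ S *
    (1 - cnorm (T3 w) ^+ 2) ^+ 4 <= 1) ->
  S%:R * (cnorm t1 ^+ 2 + cnorm t2 ^+ 2) <= 4 * cnorm t3 ^+ 2.
Proof.
move=> hh h1 d1 d2 d3 z1 z2 z3 hle; rewrite leNgt; apply/negP.
set a := cnorm t1 ^+ 2; set b := cnorm t2 ^+ 2; set c := cnorm t3 ^+ 2 => hlt.
have a0 : 0 <= a by rewrite exprn_ge0 ?cnorm_ge0.
have b0 : 0 <= b by rewrite exprn_ge0 ?cnorm_ge0.
have c0 : 0 <= c by rewrite exprn_ge0 ?cnorm_ge0.
have S0 : 0 <= S%:R :> R by [].
pose D := (S%:R * (a + b) - 4 * c) / 2.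
have D0 : 0 < D by rewrite /D; lra.
(* [D] is half of the supposed gap; an error [k] in each of the three squared derivatives uses up
   the other half, leaving [A - B = D]. *)
pose k := D / (2 * S%:R + 4); have n4 : 0 < 2 * S%:R + 4 :> R by lra.
have k0 : 0 < k by rewrite divr_gt0.
pose B := 4 * (c + k); have B0 : 0 < B by rewrite /B; lra.
pose A := S%:R * (a + b - 2 * k).
have AE : A = D + B.
  have kD : k * (2 * S%:R + 4) = D by rewrite divfK ?lt0r_neq0.
  have D2 : S%:R * (a + b) - 4 * c = 2 * D by rewrite /D; field.
  by rewrite /A /B; move: kD D2; move: (D) => D' kD D2; lra.
have A0 : 0 < A by rewrite AE; lra.
have [r0 rp mv] := mean_value_bound hh h1.
have [d d0 hd] := nearbyI hle (nearbyI (cder_sqr_norm d1 z1 k0)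
  (nearbyI (cder_sqr_norm d2 z2 k0) (cder_sqr_norm d3 z3 k0))).
(* [Q] collects the smallness required of [s = e^2]: from [s Q <= 1] follow [s D <= 1],
   [s (c + k) <= 1] and [s A B <= D / 2]. *)
pose Q := 1 + 2 * A * B / D + D + c + k.
have q0 : 0 < 2 * A * B / D by apply: divr_gt0 => //; apply: mulr_gt0 => //; lra.
have Q1 : 1 <= Q by rewrite /Q; lra.
pose e := Num.min (r0 / 2) (Num.min (d / 2) Q^-1).
have e0 : 0 < e by rewrite !lt_min; apply/and3P; split; [lra|lra|rewrite invr_gt0; lra].
have er : e < r0 by apply: (@le_lt_trans _ _ (r0 / 2)); [rewrite ge_min lexx|lra].
have ed : e < d.
  by apply: (@le_lt_trans _ _ (d / 2)); [rewrite !ge_min lexx orbT|lra].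
have eQ : e <= Q^-1 by rewrite !ge_min lexx !orbT.
pose s := e ^+ 2; have s0 : 0 < s by rewrite exprn_gt0.
have sQ : s * Q <= 1.
  rewrite -ler_pdivlMr ?div1r; last by lra.
  have e1 : e <= 1 by apply: le_trans eQ _; rewrite invf_le1 //; lra.
  by apply: le_trans eQ; rewrite /s expr2 ler_piMr // ltW.
have sD : s * D <= 1 by have := mulr_gt0 s0 q0; rewrite /Q in sQ; nra.
have sc : s * (c + k) <= 1 by have := mulr_gt0 s0 q0; rewrite /Q in sQ; nra.
have sAB : s * (A * B) <= D / 2.
  have : s * (2 * A * B / D) <= 1.
    by rewrite /Q in sQ; have := mulr_gt0 s0 D0; have := mulr_gt0 s0 k0; nra.
  by rewrite mulrA ler_pdivrMr //; lra.
(* The loss [s D / 8] is affordable because [(1 - x/8)^2 (1 + x/2) >= 1] for [0 <= x <= 1], here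
   with [x = s D]. *)
have [|w wE hw] := mv e (s * D / 8) e0 er; first by rewrite divr_gt0 // mulr_gt0.
have := hd w I; rewrite wE => /(_ ed) [hm [/andP[l1 _] [/andP[l2 _] /andP[_ l3]]]].
rewrite -/s -/a -/b -/c in l1 l2 l3.
set u1 := cnorm (T1 w) ^+ 2 in l1 hm; set u2 := cnorm (T2 w) ^+ 2 in l2 hm.
set u3 := cnorm (T3 w) ^+ 2 in l3 hm.
have u10 : 0 <= u1 by rewrite exprn_ge0 ?cnorm_ge0.
have u20 : 0 <= u2 by rewrite exprn_ge0 ?cnorm_ge0.
have X1 : 1 + A * s <= ((1 + u1) * (1 + u2)) ^+ S.
  apply: le_trans (_ : (1 + (u1 + u2)) ^+ S <= _).
    apply: le_trans (bernoulli S _); last by rewrite addr_ge0.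
    by rewrite lerD2l /A -mulrA; apply: ler_wpM2l => //; lra.
  have u12 : 0 <= u1 * u2 by rewrite mulr_ge0.
  by case: (S) => [|n]; rewrite ?expr0 // ler_pXn2r // ?nnegrE; nra.
have Y1 : 1 - B * s <= (1 - u3) ^+ 4.
  by apply: le_trans (bernoulli4 _); rewrite /B; lra.
have XY : 1 + s * D / 2 <= ((1 + u1) * (1 + u2)) ^+ S * (1 - u3) ^+ 4.
  have Y0 : 0 <= (1 - u3) ^+ 4 by rewrite -[4%N]/(2 * 2)%N exprM sqr_ge0.
  apply: le_trans (ler_wpM2r Y0 X1).
  have p0 : 0 <= 1 + A * s by rewrite addr_ge0 // mulr_ge0 // ltW.
  apply: le_trans (ler_wpM2l p0 Y1).
  have : s * (s * (A * B)) <= s * (D / 2) by rewrite ler_pM2l.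
  by rewrite AE in p0 *; lra.
have H1 : (1 - s * D / 8) ^+ 2 < cnorm (h w) ^+ 2.
  by rewrite ltr_pXn2r ?nnegrE ?cnorm_ge0 //; lra.
move: hm; rewrite -mulrA.
set X := (_ * (1 - u3) ^+ 4) in XY *.
have : cnorm (h w) ^+ 2 * (1 + s * D / 2) <= cnorm (h w) ^+ 2 * X.
  by rewrite ler_wpM2l // exprn_ge0 ?cnorm_ge0.
set x := s * D in sD H1 XY *; set y := cnorm (h w) ^+ 2 in H1 *.
have x0 : 0 < x by rewrite mulr_gt0.
have : (1 - x / 8) ^+ 2 * (1 + x / 2) < y * (1 + x / 2) by rewrite ltr_pM2r //; lra.
have : 1 <= (1 - x / 8) ^+ 2 * (1 + x / 2).
  have : 0 <= x * (1 - x) by rewrite mulr_ge0 //; lra.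
  by have := mulr_gt0 x0 (mulr_gt0 x0 x0); lra.
by lra.
Qed.

(* [T] is [f] followed by the rotation of the sphere that sends [f z] to [0]. *)
Lemma moebius_chart f z : hol f z -> let c := 1 + cnorm (f z) ^+ 2 in
  exists E T : C -> C, [/\ hol E z, E z = rc c, T z = 0,
    (forall l, cder setT f z l -> cder setT T z (l / rc c)) &
    nearby setT z (fun w => cnorm (E w) ^+ 2 * (1 + cnorm (T w) ^+ 2) =
       c * (1 + cnorm (f w) ^+ 2))].
Proof.
move=> hf c; have c0 : 0 < c by rewrite /c ltr_wpDr // exprn_ge0 ?cnorm_ge0.
pose E w := 1 + conj (f z) * f w; pose T w := (f w - f z) / E w.
have hE : hol E z by apply: holD; [exact: hol_cst|apply: holM => //; exact: hol_cst].
have Ez : E z = rc c by rewrite /E conjM_id -rc1 -rcD.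
have nz : E z != 0 by rewrite Ez rc_eq0 lt0r_neq0.
exists E, T; split=> //; first by rewrite /T subrr mul0r.
  move=> l dl; have [e de] := hol_cder hE.
  apply: cder_eq (cder_div (cderB dl (cder_cst _ (f z) _)) de nz).
  by rewrite subrr mul0r !subr0 -Ez; field.
apply: nearbyW (cont_nz (hol_cont hE) nz) => w _ Ew.
rewrite cnormD_sphere -/(E w) mulrDr mulr1 /T (cnormM _ (E w)^-1) cnormV.
congr (_ + _); field; by rewrite cnorm_eq0.
Qed.

Lemma disc_chart (r : R) z : cnorm z ^+ 2 < r ^+ 2 -> let c := r ^+ 2 - cnorm z ^+ 2 in
  exists E T : C -> C, [/\ hol E z, E z = rc c, T z = 0,
    cder setT T z (rc r / rc c) &
    nearby setT z (fun w => cnorm (E w) ^+ 2 * (1 - cnorm (T w) ^+ 2) =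
       c * (r ^+ 2 - cnorm w ^+ 2))].
Proof.
move=> zr c; have c0 : 0 < c by rewrite subr_gt0.
pose E w := rc (r ^+ 2) - conj z * w; pose T w := (rc r * (w - z)) / E w.
have dE w : cder setT E w (0 - (0 * w + conj z * 1)).
  apply: cderB; first exact: cder_cst.
  by apply: cderM; [exact: cder_cst|exact: cder_id].
have hE : hol E z by apply: nearby_all => w _; eexists; exact: dE.
have Ez : E z = rc c by rewrite /E conjM_id -rcB.
have nz : E z != 0 by rewrite Ez rc_eq0 lt0r_neq0.
exists E, T; split=> //; first by rewrite /T subrr mulr0 mul0r.
  apply: cder_eq (cder_div (cderMl (rc r) (cderB (cder_id _ z) (cder_cst _ z _))) (dE z) nz).
  by rewrite subrr mulr0 mul0r !subr0 mulr1 -Ez; field.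
apply: nearbyW (cont_nz (hol_cont hE) nz) => w _ Ew.
have -> : cnorm (T w) ^+ 2 = (r * cnorm (w - z)) ^+ 2 / cnorm (E w) ^+ 2.
  rewrite /T (cnormM _ (E w)^-1) (cnormM (rc r)) cnormV cnorm_rc.
  by rewrite exprMn exprVn exprMn real_normK ?num_real // -exprMn.
have e0 : cnorm (E w) ^+ 2 != 0 by rewrite expf_neq0 // cnorm_eq0.
by rewrite /c cnorm_disc -/(E w) mulrBr mulr1 mulrCA divff // mulr1.
Qed.

(* At a maximum of [W z * (r^2 - |z|^2)^4] the charts above write the quotient by
   the maximal value as [|h|^2] times factors [1 + |T|^2] and [1 - |T|^2], with
   [h] holomorphic; [max_comparison] then compares the curvatures. *)
Lemma metric_disc_bound S (A : R) W (r : R) z : (0 < S)%N -> 0 <= A ->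
  (forall z, metric_chart S A W z) -> 0 < r -> cnorm z < r ->
  W z * (r ^+ 2 - cnorm z ^+ 2) ^+ 4 <= 16 * A * r ^+ 4.
Proof.
move=> S0 A0 hW r0 hz.
(* Up to a constant, [g] is the fourth power of the quotient of the metric by the Poincare metric of
   the disc. The truncation makes [g] continuous everywhere and zero outside the disc, so a positive
   maximum over the square lies inside the disc. *)
pose u w := Num.max 0 (r ^+ 2 - cnorm w ^+ 2).
pose g w := W w * u w ^+ 4.
have cu w : cont setT (fun w => rc (u w)) w.
  have h : cont setT (fun v => rc (r ^+ 2) - rc (cnorm v) ^+ 2) w.
    apply: contB; first exact: cont_cst.
    by apply: contX; apply: cont_cnorm; exact: cont_id.
  move=> e e0; apply: nearbyW (h e e0) => v _.
  apply: le_lt_trans; rewrite /rc -!rmorphXn -!rmorphB -!/(rc _) !cnorm_rc /u.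
  set x := r ^+ 2 - cnorm v ^+ 2; set y := r ^+ 2 - cnorm w ^+ 2.
  have := ler_norm (x - y); have := ler_norm (y - x); rewrite (distrC y x) => h1 h2.
  by rewrite ler_norml /Num.max; repeat case: ifP; lra.
have cg w : cont setT (fun w => rc (g w)) w.
  apply: (@cont_near _ _ (fun w => rc (W w) * rc (u w) ^+ 4)).
  - by rewrite /g /rc !(rmorphM, rmorphXn).
  - by apply: nearby_all => v _; rewrite /g /rc !(rmorphM, rmorphXn).
  by apply: contM; [exact: metric_chart_cont (hW w)|apply: contX; exact: cu].
have [z0 hmax] := square_max (ltW r0) cg.
have gz0 w : cnorm w < r -> g w <= g z0.
  by move=> wr; apply: hmax; [move: (Re_cnorm w)|move: (Im_cnorm w)]; move/le_trans; apply; exact: ltW.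
have uE w : cnorm w < r -> u w = r ^+ 2 - cnorm w ^+ 2.
  move=> wr; rewrite /u max_r // subr_ge0 ler_pXn2r ?nnegrE ?cnorm_ge0 // ltW //.
suff : g z0 <= 16 * A * r ^+ 4.
  by apply: le_trans; apply: le_trans (gz0 z hz); rewrite /g uE.
have [gle|ggt] := lerP (g z0) 0.
  by apply: le_trans gle _; apply: mulr_ge0; [exact: mulr_ge0|exact/exprn_ge0/ltW].
have W0 := metric_chart_ge0 (hW z0).
have u0 : 0 <= u z0 by rewrite /u le_max lexx.
have u1 : 0 < u z0.
  rewrite lt_def u0 andbT; apply/eqP => h; move: ggt.
  by rewrite /g h expr0n mulr0 ltxx.
have zr : cnorm z0 ^+ 2 < r ^+ 2.
  by move: u1; rewrite /u lt_max ltxx /= subr_gt0.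
have zr' : cnorm z0 < r by rewrite -(ltr_pXn2r (_ : 0 < 2)%N) ?nnegrE ?cnorm_ge0 // ltW.
have [K [phi [chi [hK hphi hchi hE hA]]]] := hW z0.
have [l dl] := hol_cder hphi; have [m dm] := hol_cder hchi.
have {}hA := hA l m dl dm.
have [E1 [T1 [hE1 E10 T10 dT1 e1]]] := moebius_chart hphi.
have [E2 [T2 [hE2 E20 T20 dT2 e2]]] := moebius_chart hchi.
have [E3 [T3 [hE3 E30 T30 dT3 e3]]] := disc_chart zr.
have WK := nearby_pt I hE.
set c1 := 1 + cnorm (phi z0) ^+ 2 in E10 dT1 e1 hA WK.
set c2 := 1 + cnorm (chi z0) ^+ 2 in E20 dT2 e2 hA WK.
set c3 := r ^+ 2 - cnorm z0 ^+ 2 in E30 dT3 e3.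
have c10 : 0 < c1 by rewrite /c1 ltr_wpDr // exprn_ge0 ?cnorm_ge0.
have c20 : 0 < c2 by rewrite /c2 ltr_wpDr // exprn_ge0 ?cnorm_ge0.
have c30 : 0 < c3 by rewrite subr_gt0.
have K0 : K z0 != 0.
  apply/eqP => h; move: ggt; rewrite /g WK h cnorm0 expr0n /= !mul0r ltxx //.
pose h w := K w * (E1 w * E2 w) ^+ S * E3 w ^+ 4.
have hh : hol h z0.
  by apply: holM; [apply: holM => //; apply: holX; exact: holM|exact: holX].
have hz0 : h z0 != 0.
  by rewrite /h !mulf_neq0 ?expf_neq0 ?mulf_neq0 // ?E10 ?E20 ?E30 rc_eq0 lt0r_neq0.
have hh' : hol (fun w => (h z0)^-1 * h w) z0 by apply: holM => //; exact: hol_cst.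
have hwn w : cnorm (h w) =
    cnorm (K w) * (cnorm (E1 w) * cnorm (E2 w)) ^+ S * cnorm (E3 w) ^+ 4.
  by rewrite /h cnormM (cnormM (K w)) !cnormX (cnormM (E1 w)).
have hn : cnorm (h z0) = cnorm (K z0) * (c1 * c2) ^+ S * c3 ^+ 4.
  by rewrite hwn E10 E20 E30 !cnorm_rc !gtr0_norm.
have g0 : g z0 = cnorm (K z0) ^+ 2 * (c1 * c2) ^+ S * c3 ^+ 4.
  by rewrite /g uE // WK.
have := max_comparison (S := S) hh' (mulVf hz0) (dT1 l dl) (dT2 m dm) dT3 T10 T20 T30.
have near_le : nearby setT z0 (fun w => cnorm ((h z0)^-1 * h w) ^+ 2 *
  ((1 + cnorm (T1 w) ^+ 2) * (1 + cnorm (T2 w) ^+ 2)) ^+ S *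
  (1 - cnorm (T3 w) ^+ 2) ^+ 4 <= 1).
  have nr : nearby setT z0 (fun w => cnorm w < r).
    exists (r - cnorm z0) => [|w _ hw]; first by rewrite subr_gt0.
    by have := cnormD (w - z0) z0; rewrite subrK; lra.
  apply: nearbyW (nearbyI nr (nearbyI hE (nearbyI e1 (nearbyI e2 e3)))) => w _.
  move=> [wr [We [f1 [f2 f3]]]].
  have gw : g w = cnorm (K w) ^+ 2 * ((1 + cnorm (phi w) ^+ 2) * (1 + cnorm (chi w) ^+ 2)) ^+ S *
     (r ^+ 2 - cnorm w ^+ 2) ^+ 4 by rewrite /g uE // We.
  have -> : cnorm ((h z0)^-1 * h w) ^+ 2 *
     ((1 + cnorm (T1 w) ^+ 2) * (1 + cnorm (T2 w) ^+ 2)) ^+ S *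
     (1 - cnorm (T3 w) ^+ 2) ^+ 4 = g w / g z0.
    have -> : cnorm ((h z0)^-1 * h w) ^+ 2 = (cnorm (h z0) ^+ 2)^-1 * (cnorm (K w) ^+ 2 *
       (cnorm (E1 w) ^+ 2 * cnorm (E2 w) ^+ 2) ^+ S * (cnorm (E3 w) ^+ 2) ^+ 4).
      rewrite cnormM cnormV exprMn exprVn (hwn w); congr (_ * _).
      rewrite exprMn exprMn (exprAC _ S 2) (exprMn 2 (cnorm (E1 w))).
      by rewrite (exprAC _ 4 2).
    transitivity ((cnorm (h z0) ^+ 2)^-1 * (cnorm (K w) ^+ 2 *
      ((cnorm (E1 w) ^+ 2 * (1 + cnorm (T1 w) ^+ 2)) *
       (cnorm (E2 w) ^+ 2 * (1 + cnorm (T2 w) ^+ 2))) ^+ S *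
      (cnorm (E3 w) ^+ 2 * (1 - cnorm (T3 w) ^+ 2)) ^+ 4)).
      by rewrite !exprMn; ring.
    rewrite f1 f2 f3 hn gw g0 !exprMn.
    have n1 : c1 ^+ S != 0 by rewrite expf_neq0 // lt0r_neq0.
    have n2 : c2 ^+ S != 0 by rewrite expf_neq0 // lt0r_neq0.
    have n3 : c3 != 0 by rewrite lt0r_neq0.
    have n4 : cnorm (K z0) != 0 by rewrite cnorm_eq0.
    by field; rewrite n1 n2 n3 n4.
  by rewrite ler_pdivrMr // mul1r; exact: gz0.
move=> /(_ near_le); rewrite !cnormM !cnormV !cnorm_rc !(gtr0_norm c10) !(gtr0_norm c20) !(gtr0_norm c30) (gtr0_norm r0).
set X := (cnorm l / c1) ^+ 2 + _ in hA * => hX.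
have X0 : 0 <= X by rewrite addr_ge0 ?sqr_ge0.
have hX2 : X <= 4 * (r / c3) ^+ 2.
  by apply: le_trans hX; rewrite ler_peMl // ler1n.
have : X ^+ 2 <= (4 * (r / c3) ^+ 2) ^+ 2.
  by rewrite ler_pXn2r ?nnegrE // mulr_ge0 // sqr_ge0.
move=> /(ler_wpM2l A0) h1; rewrite /g uE // -/c3.
apply: le_trans (ler_wpM2r (exprn_ge0 4 (ltW c30)) (le_trans hA h1)) _.
rewrite le_eqVlt; apply/orP; left; apply/eqP; field; exact: lt0r_neq0.
Qed.

(** For fixed [z] the weight in [metric_disc_bound] grows like [r^8] and the right side only like
    [r^4]. *)
Theorem metric_vanishes S (A : R) W : (0 < S)%N -> 0 <= A ->
  (forall z, metric_chart S A W z) -> forall z, W z = 0.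
Proof.
move=> S0 A0 hW z; apply/eqP; rewrite eq_le (metric_chart_ge0 (hW z)) andbT.
rewrite leNgt; apply/negP => h.
(* From [r >= 2 |z|] the bound becomes [W z * r^4 <= 256 A], whereas the last summand gives
   [W z * r > 256 A], and [r <= r^4]. *)
pose r := 1 + 2 * cnorm z + 256 * A / W z.
have n0 := cnorm_ge0 z.
have q0 : 0 <= 256 * A / W z by rewrite divr_ge0 ?mulr_ge0 // ltW.
have r1 : 1 <= r by rewrite /r; lra.
have zr : cnorm z < r by rewrite /r; lra.
have := metric_disc_bound S0 A0 hW (lt_le_trans ltr01 r1) zr.
have z2 : 2 * cnorm z <= r by rewrite /r; lra.
have zz : r ^+ 2 / 2 <= r ^+ 2 - cnorm z ^+ 2.
  have : (2 * cnorm z) ^+ 2 <= r ^+ 2 by apply: lerXn2r; rewrite ?nnegrE; lra.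
  by rewrite exprMn; have := sqr_ge0 (cnorm z); lra.
have r2 : 0 <= r ^+ 2 / 2 by rewrite divr_ge0 ?sqr_ge0.
have : (r ^+ 2 / 2) ^+ 4 <= (r ^+ 2 - cnorm z ^+ 2) ^+ 4.
  by apply: lerXn2r; rewrite ?nnegrE; lra.
move=> /(ler_wpM2l (ltW h)) h1 h2; have := le_trans h1 h2.
have -> : W z * (r ^+ 2 / 2) ^+ 4 = (W z / 16 * r ^+ 4) * r ^+ 4 by field.
have r4 : r <= r ^+ 4 by rewrite -[leLHS]expr1 ler_weXn2l.
rewrite ler_pM2r; last by rewrite exprn_gt0 //; lra.
have : W z * r <= W z * r ^+ 4 by rewrite ler_pM2l.
have : W z * r = W z + W z * (2 * cnorm z) + 256 * A.
  by rewrite /r; field; exact: lt0r_neq0.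
have : 0 <= W z * (2 * cnorm z) by rewrite mulr_ge0 ?mulr_ge0 // ltW.
by lra.
Qed.

End AhlforsSchwarz.

(** * Multiplicities of critical points and the splitting of P' *)

Section Multiplicities.
Variable K : numClosedFieldType.
Implicit Types (P Q : {poly K}) (a b d x y : K) (s t : seq K).

Lemma distinct_roots Q : Q != 0 -> {t : seq K | uniq t /\ forall x, (x \in t) = root Q x}.
Proof.
move=> Q0; have [rs E] := closed_field_poly_normal Q.
exists (undup rs); split=> [|x]; first exact: undup_uniq.
rewrite mem_undup E rootZ ?lead_coef_eq0 //.
by rewrite -[LHS]/(x \in rs) -root_prod_XsubC.
Qed.

Lemma factor_mup Q t : Q != 0 -> uniq t -> (forall x, (x \in t) = root Q x) ->
  Q = lead_coef Q *: \prod_(a <- t) ('X - a%:P) ^+ mup a Q.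
Proof.
move=> Q0 ut tE; have [rs E] := closed_field_poly_normal Q.
have l0 : lead_coef Q != 0 by rewrite lead_coef_eq0.
have mupE a : mup a Q = count_mem a rs.
  rewrite E -mul_polyC mupMr ?mu_prod_XsubC //.
  by rewrite rootC.
have memrs x : (x \in rs) = (x \in t).
  by rewrite tE E rootZ // root_prod_XsubC.
rewrite [LHS]E; congr (_ *: _).
have p : perm_eq (undup rs) t.
  by apply: uniq_perm; rewrite ?undup_uniq // => x; rewrite mem_undup memrs.
rewrite -(perm_big _ p) /= -prodr_undup_exp_count.
by apply: eq_bigr => a _; rewrite mupE.
Qed.

Lemma size_prod_XsubC_exp (t : seq K) (m : K -> nat) :
  size (\prod_(a <- t) ('X - a%:P) ^+ m a) = (\sum_(a <- t) m a).+1.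
Proof.
elim: t => [|a t IH]; first by rewrite !big_nil size_poly1.
rewrite !big_cons size_monicM ?monic_exp ?monicXsubC //; last first.
  by rewrite -size_poly_gt0 IH.
by rewrite IH size_exp_XsubC addnS.
Qed.

Lemma sum_mup Q t : Q != 0 -> uniq t -> (forall x, (x \in t) = root Q x) ->
  (\sum_(a <- t) mup a Q)%N.+1 = size Q.
Proof.
move=> Q0 ut tE; rewrite [in RHS](factor_mup Q0 ut tE).
by rewrite size_scale ?lead_coef_eq0 // size_prod_XsubC_exp.
Qed.

Lemma mup_gt0 Q a : Q != 0 -> (0 < mup a Q)%N = root Q a.
Proof. by move=> Q0; rewrite -XsubC_dvd // dvdp_XsubCl. Qed.

Lemma mup_deriv Q a : Q != 0 -> root Q a -> mup a Q = (mup a Q^`()).+1.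
Proof.
move=> Q0 ra; have := mup_gt0 a Q0; rewrite ra; case E : (mup a Q) => [//|k] _.
congr _.+1; have : ('X - a%:P) ^+ k.+1 %| Q by rewrite -mup_geq // E.
move=> /dvdpP [q Eq].
have qa : ~~ root q a.
  apply/negP => /factor_theorem [q' Eq'].
  have : (k.+2 <= mup a Q)%N.
    by rewrite mup_geq // Eq Eq' -mulrA -exprS dvdp_mulIr.
  by rewrite E ltnn.
have -> : Q^`() = ('X - a%:P) ^+ k * (q * k.+1%:R + ('X - a%:P) * q^`()).
  rewrite Eq derivM deriv_exp derivXsubC mul1r exprS mulr_natr; ring.
rewrite mupMl ?mup_XsubCX ?eqxx //.
rewrite /root !hornerE hornerMn hornerE subrr mul0r addr0 mulf_eq0 negb_or.
by rewrite qa pnatr_eq0.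
Qed.

(** Each root loses one unit of multiplicity in the derivative. Used for [Q = P - d], whose
    derivative does not depend on [d]: it converts numbers of distinct [d]-points into critical
    multiplicities. *)
Lemma count_roots Q n t : size Q = n.+1 -> uniq t -> (forall x, (x \in t) = root Q x) ->
  n = (size t + \sum_(a <- t) mup a Q^`())%N.
Proof.
move=> sQ ut tE; have Q0 : Q != 0 by rewrite -size_poly_gt0 sQ.
have := sum_mup Q0 ut tE; rewrite sQ => -[<-].
rewrite -sum1_size -big_split /= big_seq [RHS]big_seq.
by apply: eq_bigr => a; rewrite tE => /(mup_deriv Q0).
Qed.

Lemma root_prod_exp (t : seq K) (m : K -> nat) x :
  root (\prod_(a <- t) ('X - a%:P) ^+ m a) x -> x \in t.
Proof.
rewrite /root horner_prod prodf_seq_eq0 => /hasP[a at_ /=].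
rewrite horner_exp hornerXsubC expf_eq0 subr_eq0 => /andP[_ /eqP ->] //.
Qed.

Lemma size_deriv_char0 P (n : nat) : size P = n.+1 -> size P^`() = n.
Proof.
case: n => [sP|n sP].
  by rewrite (size1_polyC (_ : (size P <= 1)%N)) ?sP // derivC size_poly0.
apply/eqP; rewrite eqn_leq -ltnS -sP lt_size_deriv ?sP -?size_poly_gt0 ?sP //=.
rewrite ltnNge; apply/negP => /leq_sizeP /(_ n (leqnn n)) /eqP.
rewrite coef_deriv mulrn_eq0 /= => /eqP h.
have : lead_coef P != 0 by rewrite lead_coef_eq0 -size_poly_gt0 sP.
by rewrite /lead_coef sP h eqxx.
Qed.

(* [X] and [Y] collect, from each pair of critical points [(a, b)] with
   [P a = A P b], the one of smaller multiplicity, so that what remains of [P']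
   on the two sides has no common zero on the curve [P x = A P y]. *)
Lemma split_critical P (A : K) n gamma : size P = n.+1 -> P^`() != 0 -> A != 0 ->
  (forall a b, root P^`() a -> root P^`() b -> P.[a] = P.[b] -> a = b) ->
  root P^`() gamma -> (3 <= mup gamma P^`())%N ->
  (forall b, root P^`() b -> P.[gamma] = A * P.[b] ->
     (mup b P^`() + 3 <= mup gamma P^`())%N) ->
  exists X Y P1 Q1 : {poly K}, [/\ P^`() = X * Q1, P^`() = Y * P1,
    (forall x y, P.[x] = A * P.[y] -> root Q1 x -> root P1 y -> False) &
    exists dX dY, [/\ size X = dX.+1, size Y = dY.+1 & (dX + dY + 4 <= n)%N]].
Proof.
move=> sP P0 A0 inj rg g3 gpair.
have [cr [ucr crE]] := distinct_roots P0.
pose m a := mup a P^`().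
pose pr a b := P.[a] == A * P.[b].
(* Ties go to [Y]: with one strict and one weak inequality, exactly one member of each pair is
   collected. *)
pose inX a := has (fun b => pr a b && (m a < m b)%N) cr.
pose inY b := has (fun a => pr a b && (m b <= m a)%N) cr.
pose f a := ('X - a%:P) ^+ m a.
have facP := factor_mup P0 ucr crE.
pose c := lead_coef P^`().
have c0 : c != 0 by rewrite lead_coef_eq0.
pose Z p := \prod_(a <- [seq a <- cr | p a]) f a.
have ZE p : P^`() = Z p * (c *: Z (predC p)).
  by rewrite /Z !big_filter -scalerAr facP (bigID p).
exists (Z inX), (Z inY), (c *: Z (predC inY)), (c *: Z (predC inX)).
split=> //.
- move=> x y xy; rewrite !rootZ // => /root_prod_exp; rewrite mem_filter => /andP[/= nx xc].
  move=> /root_prod_exp; rewrite mem_filter => /andP[/= ny yc].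
  have pxy : pr x y by apply/eqP.
  have [lt|ge] := ltnP (m x) (m y).
    by move/negP: nx; apply; apply/hasP; exists y => //; rewrite pxy.
  by move/negP: ny; apply; apply/hasP; exists x => //; rewrite pxy.
exists (\sum_(a <- cr | inX a) m a)%N, (\sum_(b <- cr | inY b) m b)%N.
rewrite !size_prod_XsubC_exp !big_filter; split=> //.
(* The multiplicities in [Y] are charged to the first member of the pair. Then [t a] is the whole
   contribution of the pair of [a], namely [minn (m a) (m b)], or [0] if [a] has no partner. *)
pose s a := (\sum_(b <- cr | pr a b && (m b <= m a)) m b)%N.
pose t a := ((if inX a then m a else 0) + s a)%N.
have sumY : (\sum_(b <- cr | inY b) m b <= \sum_(a <- cr) s a)%N.
  rewrite /s (exchange_big_dep xpredT); last by []. rewrite big_mkcond /=.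
  apply: leq_sum => b _; case: ifP => // /hasP[a ac ab].
  by rewrite (big_rem a ac) /= ab leq_addr.
have sE a b : b \in cr -> pr a b -> s a = (if (m b <= m a)%N then m b else 0)%N.
  move=> bc pab; rewrite /s big_mkcond (big_rem b bc) /= pab big1_seq ?addn0 //.
  move=> b' /andP[_ b'c]; case: ifP => // /andP[/eqP p2 _].
  have b'c' := mem_rem b'c.
  suff e : b' = b by move: b'c; rewrite e mem_rem_uniqF.
  apply: inj; rewrite -?crE //; apply: (mulfI A0).
  by rewrite -p2; apply/eqP.
have s0 a : ~~ has (pr a) cr -> t a = 0%N.
  move=> na; rewrite /t /s big1_seq ?addn0; last first.
    by move=> b /andP[/andP[pab _] bc]; case/hasP: na; exists b.
  case: ifP => // /hasP[b bc /andP[pab _]].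
  by case/hasP: na; exists b.
have tE a b : b \in cr -> pr a b -> t a = minn (m a) (m b).
  move=> bc pab; rewrite /t (sE a b) //.
  have -> : inX a = (m a < m b)%N.
    apply/hasP/idP => [[b' b'c /andP[p2]]|lt]; last by exists b; rewrite ?pab.
    suff -> : b' = b by [].
    apply: inj; rewrite -?crE //; apply: (mulfI A0).
    by rewrite -(eqP p2); apply/eqP.
  by rewrite /minn; case: ltnP => h; rewrite ?add0n ?addn0.
have tle a : (t a <= m a)%N.
  have [/hasP[b bc pab]|/s0 ->] := boolP (has (pr a) cr); last exact: leq0n.
  by rewrite (tE a b bc pab); exact: geq_minl.
have tg : (t gamma + 3 <= m gamma)%N.
  have [/hasP[b bc pab]|/s0 ->] := boolP (has (pr gamma) cr); last exact: g3.
  rewrite (tE gamma b bc pab); apply: leq_trans (gpair b _ (eqP pab)); last by rewrite -crE.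
  by rewrite leq_add2r geq_minr.
have gc : gamma \in cr by rewrite crE.
(* The right side is [deg P' = n - 1], so the slack of [3] at [gamma] leaves [n - 4] for [X] and [Y]
   together. *)
have sm : (\sum_(a <- cr) t a + 3 <= \sum_(a <- cr) m a)%N.
  rewrite (big_rem gamma gc) [X in (_ <= X)%N](big_rem gamma gc) /= addnAC.
  by apply: (leq_add tg); apply: leq_sum => i _; exact: tle.
have := sum_mup P0 ucr crE.
have -> : size P^`() = n by exact: size_deriv_char0.
move=> <-; rewrite -/m addnS ltnS; apply: leq_trans sm.
by rewrite leq_add2r big_split /= -big_mkcond /= leq_add2l.
Qed.

End Multiplicities.

(** * Growth estimates on the curve P(x) = A P(y) *)

Section Growth.
Variable R : realType.
Local Notation C := (Cplx R).
Implicit Types (p q P X Y : {poly C}) (x y z a b : C).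

(** The weight of the spherical metric. Measured by it, the squared modulus of a polynomial of
    degree [d] has order [d]. *)
Definition ht x : R := 1 + cnorm x ^+ 2.

Lemma ht_ge1 x : 1 <= ht x.
Proof. by rewrite /ht lerDl sqr_ge0. Qed.

Lemma ht_gt0 x : 0 < ht x.
Proof. exact: lt_le_trans ltr01 (ht_ge1 x). Qed.

Lemma cnormD_sqr x y : cnorm (x + y) ^+ 2 <= 2 * cnorm x ^+ 2 + 2 * cnorm y ^+ 2.
Proof.
apply: le_trans (_ : (cnorm x + cnorm y) ^+ 2 <= _).
  by rewrite ler_pXn2r ?nnegrE ?cnorm_ge0 ?addr_ge0 ?cnorm_ge0 // cnormD.
by have := sqr_ge0 (cnorm x - cnorm y); lra.
Qed.

Lemma poly_upper p d : (size p <= d.+1)%N ->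
  exists2 B : R, 0 < B & forall x, cnorm p.[x] ^+ 2 <= B * ht x ^+ d.
Proof.
elim/poly_ind: p d => [|p c IH] d hs.
  exists 1 => // x; rewrite horner0 cnorm0 expr0n /= mul1r.
  by apply: exprn_ge0; exact: ltW (ht_gt0 x).
have c0 := sqr_ge0 (cnorm c).
have [p0|p0] := eqVneq p 0.
  exists (cnorm c ^+ 2 + 1) => [|x]; first by lra.
  rewrite p0 mul0r add0r hornerC.
  have h : 1 <= ht x ^+ d by apply: exprn_ege1; exact: ht_ge1.
  have : (cnorm c ^+ 2 + 1) * 1 <= (cnorm c ^+ 2 + 1) * ht x ^+ d.
    by apply: ler_wpM2l => //; lra.
  by lra.
rewrite size_MXaddC (negbTE p0) /= in hs.
case: d hs => [|d] hs.
  by move: p0; rewrite -size_poly_gt0; case: (size p) hs.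
have [B B0 hB] := IH d hs.
exists (2 * B + 2 * cnorm c ^+ 2) => [|x]; first by lra.
rewrite hornerMXaddC; apply: le_trans (cnormD_sqr _ _) _.
rewrite cnormM exprMn (exprS (ht x) d).
have t1 := ht_ge1 x; have h0 : 1 <= ht x * ht x ^+ d.
  by rewrite -exprS; apply: exprn_ege1.
have x2 : cnorm x ^+ 2 <= ht x by rewrite /ht; lra.
have h1 : cnorm p.[x] ^+ 2 * cnorm x ^+ 2 <= (B * ht x ^+ d) * ht x.
  by apply: ler_pM => //; exact: sqr_ge0.
have h2 : cnorm c ^+ 2 * 1 <= cnorm c ^+ 2 * (ht x * ht x ^+ d) by exact: ler_wpM2l.
by lra.
Qed.

(** Each linear factor satisfies [|x - a|^2 >= ht x / 4] as soon as [ht x >= 2 (1 + 2 |a|^2)]. *)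
Lemma poly_lower p d : size p = d.+1 -> exists c M : R, [/\ 0 < c, 1 <= M &
  forall x, M <= ht x -> c * ht x ^+ d <= cnorm p.[x] ^+ 2].
Proof.
move=> sp; have [rs E] := closed_field_poly_normal p.
have l0 : lead_coef p != 0 by rewrite lead_coef_eq0 -size_poly_gt0 sp.
have : exists c M : R, [/\ 0 < c, 1 <= M &
    forall x, M <= ht x -> c * ht x ^+ size rs <= cnorm (\prod_(a <- rs) ('X - a%:P)).[x] ^+ 2].
  elim: (rs) => [|a s [c [M [c0 M1 h]]]].
    by exists 1, 1; split=> // x _; rewrite big_nil hornerC cnorm1 expr1n mul1r.
  exists (c / 4), (Num.max M (2 * (1 + 2 * cnorm a ^+ 2))); split.
  - by lra.
  - by rewrite le_max M1.
  - move=> x; rewrite ge_max => /andP[/h hx ha].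
    rewrite big_cons hornerM cnormM exprMn hornerXsubC (exprS (ht x) (size s)).
    have := cnormD_sqr (x - a) a; rewrite subrK => h3.
    have h4 : ht x / 4 <= cnorm (x - a) ^+ 2 by rewrite /ht in ha *; lra.
    have -> : c / 4 * (ht x * ht x ^+ size s) = (ht x / 4) * (c * ht x ^+ size s) by field.
    apply: ler_pM => //; first by have := ht_gt0 x; lra.
    by apply: mulr_ge0; [exact: ltW|apply: exprn_ge0; exact: ltW (ht_gt0 x)].
move=> [c [M [c0 M1 h]]].
have -> : d = size rs.
  by apply: succn_inj; rewrite -sp E size_scale // size_prod_XsubC.
exists (cnorm (lead_coef p) ^+ 2 * c), M; split=> //.
  by apply: mulr_gt0 => //; rewrite exprn_gt0 // cnorm_gt0.
move=> x /h hx; rewrite [p in leRHS]E hornerZ cnormM exprMn -mulrA.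
by apply: ler_wpM2l => //; exact: sqr_ge0.
Qed.

(** Both sides of the equation have the same degree, so [x] and [y] grow at the same rate; this will
    force [f] and [g] to have the same poles. *)
Lemma curve_comparable P n (A : C) : size P = n.+2 -> exists2 B : R, 1 <= B &
  forall x y, P.[x] = A * P.[y] -> ht x <= B * ht y.
Proof.
move=> sP; have [c [M [c0 M1 h]]] := poly_lower sP.
have [B B0 hB] := poly_upper (eq_leq sP).
pose D := cnorm A ^+ 2 * B / c; have D0 : 0 <= D.
  by apply: divr_ge0; [apply: mulr_ge0; [exact: sqr_ge0|exact: ltW]|exact: ltW].
exists (M + D); first by lra.
move=> x y xy; have ty := ht_ge1 y; have tx := ht_ge1 x.
have [lt|ge] := ltP (ht x) M.
  have : (M + D) * 1 <= (M + D) * ht y by apply: ler_wpM2l => //; lra.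
  by lra.
have hx := h _ ge; have hy := hB y.
have e : cnorm P.[x] ^+ 2 = cnorm A ^+ 2 * cnorm P.[y] ^+ 2 by rewrite xy cnormM exprMn.
have h1 : ht x ^+ n.+1 <= D * ht y ^+ n.+1.
  rewrite /D mulrAC ler_pdivlMr // mulrC; apply: le_trans hx _; rewrite e -(mulrA (cnorm A ^+ 2)).
  by apply: ler_wpM2l => //; exact: sqr_ge0.
(* The root is taken by raising the goal to the power [n.+1], using [D <= M + D <= (M + D)^(n+1)],
   which holds as [M >= 1]. *)
rewrite -(ler_pXn2r (ltn0Sn n)) ?nnegrE; last 2 first.
- by lra.
- by apply: mulr_ge0; lra.
apply: le_trans h1 _; rewrite exprMn.
apply: ler_wpM2r; first by apply: exprn_ge0; lra.
apply: le_trans (_ : M + D <= _); first by lra.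
by rewrite -[leLHS]expr1; apply: ler_weXn2l => //; lra.
Qed.

Section Separation.
Variable D : C -> C -> Prop.

(** A uniform way of having no common zero on [D]. It passes to products, so it reduces to linear
    factors and takes the place of a compactness argument. *)
Definition separated p q := exists2 c : R, 0 < c &
  forall x y, D x y -> c <= cnorm p.[x] ^+ 2 + cnorm q.[y] ^+ 2.

Lemma separatedMr p q1 q2 : separated p q1 -> separated p q2 -> separated p (q1 * q2).
Proof.
move=> [c1 c10 h1] [c2 c20 h2]; pose c := Num.min c1 c2.
have c0 : 0 < c by rewrite lt_min c10.
(* Where [|p(x)|^2 < c / 2], both factors have squared modulus at least [c / 2]. *)
exists (Num.min (c / 2) ((c / 2) ^+ 2)) => [|x y Dxy].
  by rewrite lt_min exprn_gt0; lra.
have p0 := sqr_ge0 (cnorm p.[x]).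
have [ge|lt] := leP (c / 2) (cnorm p.[x] ^+ 2).
  rewrite ge_min; apply/orP; left; apply: le_trans ge _.
  by rewrite lerDl sqr_ge0.
rewrite ge_min; apply/orP; right.
have k1 : c <= c1 by rewrite ge_min lexx.
have k2 : c <= c2 by rewrite ge_min lexx orbT.
have l1 : c / 2 <= cnorm q1.[y] ^+ 2 by have := h1 _ _ Dxy; lra.
have l2 : c / 2 <= cnorm q2.[y] ^+ 2 by have := h2 _ _ Dxy; lra.
rewrite hornerM cnormM.
apply: le_trans (_ : cnorm q1.[y] ^+ 2 * cnorm q2.[y] ^+ 2 <= _); last by rewrite exprMn lerDr.
by rewrite expr2; apply: ler_pM => //; lra.
Qed.

Lemma separated_cst p (c : C) : c != 0 -> separated p c%:P.
Proof.
rewrite -cnorm_gt0 => c0; exists (cnorm c ^+ 2) => [|x y _]; first exact: exprn_gt0.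
by rewrite hornerC lerDr sqr_ge0.
Qed.

Lemma separated_roots p q : q != 0 -> (forall b, root q b -> separated p ('X - b%:P)) ->
  separated p q.
Proof.
move=> q0 h; have [rs E] := closed_field_poly_normal q.
have l0 : lead_coef q != 0 by rewrite lead_coef_eq0.
rewrite E -mul_polyC; apply: separatedMr; first exact: separated_cst.
have : {subset rs <= root q}.
  by move=> b bs; rewrite -[_ \in _]/(root q b) E rootZ // root_prod_XsubC.
elim: (rs) => [|b s IH] hs; first by rewrite big_nil; apply: separated_cst; exact: oner_neq0.
rewrite big_cons; apply: separatedMr; first by apply: h; apply: hs; exact: mem_head.
by apply: IH => a as_; apply: hs; rewrite inE as_ orbT.
Qed.

End Separation.

Lemma separated_sym D p q : separated D p q -> separated (fun y x => D x y) q p.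
Proof. by move=> [c c0 h]; exists c => // x y /h; rewrite addrC. Qed.

(** For linear factors with roots [a] and [b]: on the curve the nonzero number [P(a) - A P(b)] is a
    combination of [x - a] and [y - b] with coefficients bounded in terms of [M], so these two
    cannot both be small. *)
Lemma curve_separated P (A : C) Q1 P1 (M : R) : Q1 != 0 -> P1 != 0 ->
  (forall x y, P.[x] = A * P.[y] -> root Q1 x -> root P1 y -> False) ->
  separated (fun x y => [/\ P.[x] = A * P.[y], ht x <= M & ht y <= M]) Q1 P1.
Proof.
move=> Q0 P0 hno; apply: separated_roots => // b rb.
apply: (@separated_sym (fun y x => [/\ P.[x] = A * P.[y], ht x <= M & ht y <= M])).
apply: separated_roots => // a ra.
have dab : P.[a] - A * P.[b] != 0.
  by rewrite subr_eq0; apply/eqP => h; exact: hno h ra rb.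
have fac c : exists2 U : {poly C}, forall x, P.[x] - P.[c] = U.[x] * (x - c) & True.
  have : root (P - P.[c]%:P) c by rewrite /root !hornerE subrr.
  move=> /factor_theorem [U E]; exists U => // x.
  have := congr1 (fun p => p.[x]) E; rewrite !hornerE; exact.
have [U hU _] := fac a; have [V hV _] := fac b.
have [BU BU0 hBU] := poly_upper (leqnSn (size U)).
have [BV BV0 hBV] := poly_upper (leqnSn (size V)).
pose d := cnorm (P.[a] - A * P.[b]) ^+ 2.
have d0 : 0 < d by rewrite exprn_gt0 // cnorm_gt0.
pose M' := `|M| + 1; have M1 : 1 <= M' by rewrite /M'; have := normr_ge0 M; lra.
have MM : M <= M' by rewrite /M'; have := ler_norm M; lra.
pose L := 2 * BU * M' ^+ size U + 2 * cnorm A ^+ 2 * (BV * M' ^+ size V) + 1.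
have u0 : 0 <= 2 * BU * M' ^+ size U.
  by apply: mulr_ge0; [lra|apply: exprn_ge0; lra].
have v0 : 0 <= 2 * cnorm A ^+ 2 * (BV * M' ^+ size V).
  apply: mulr_ge0; first by have := sqr_ge0 (cnorm A); lra.
  by apply: mulr_ge0; [lra|apply: exprn_ge0; lra].
have L0 : 0 < L by rewrite /L; lra.
exists (d / L); first exact: divr_gt0.
move=> y x [xy hx hy]; rewrite ler_pdivrMr // !hornerXsubC.
have e : P.[a] - A * P.[b] = - (U.[x] * (x - a)) + A * (V.[y] * (y - b)).
  by rewrite -hU -hV mulrBr -xy; ring.
have := cnormD_sqr (- (U.[x] * (x - a))) (A * (V.[y] * (y - b))).
rewrite -e -/d cnormN (cnormM U.[x]) (cnormM A) (cnormM V.[y]) !exprMn.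
have hx' := le_trans hx MM; have hy' := le_trans hy MM.
have bU : cnorm U.[x] ^+ 2 <= BU * M' ^+ size U.
  apply: le_trans (hBU x) _; apply: ler_wpM2l; first exact: ltW.
  by apply: lerXn2r; rewrite ?nnegrE //; [exact: ltW (ht_gt0 x)|lra].
have bV : cnorm V.[y] ^+ 2 <= BV * M' ^+ size V.
  apply: le_trans (hBV y) _; apply: ler_wpM2l; first exact: ltW.
  by apply: lerXn2r; rewrite ?nnegrE //; [exact: ltW (ht_gt0 y)|lra].
have s1 := sqr_ge0 (cnorm (x - a)); have s2 := sqr_ge0 (cnorm (y - b)).
have a2 := sqr_ge0 (cnorm A).
set sx := cnorm (x - a) ^+ 2 in s1 *; set sy := cnorm (y - b) ^+ 2 in s2 *.
have k1 : cnorm U.[x] ^+ 2 * sx <= BU * M' ^+ size U * sx by exact: ler_wpM2r.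
have k2 : cnorm A ^+ 2 * (cnorm V.[y] ^+ 2 * sy) <= cnorm A ^+ 2 * (BV * M' ^+ size V * sy).
  by apply: ler_wpM2l => //; exact: ler_wpM2r.
have k3 : 0 <= 2 * BU * M' ^+ size U * sy by exact: mulr_ge0.
have k4 : 0 <= 2 * cnorm A ^+ 2 * (BV * M' ^+ size V) * sx by exact: mulr_ge0.
rewrite /L; lra.
Qed.

(* To be used with [l = f'], [m = g'] and [h] the pulled back form. *)
Lemma key_bound P n (A : C) X Y P1 Q1 dX dY S :
  size P = n.+2 -> A != 0 -> P^`() != 0 -> P^`() = X * Q1 -> P^`() = Y * P1 ->
  size X = dX.+1 -> size Y = dY.+1 -> size P1 = (S + 2 + dX).+1 ->
  (forall x y, P.[x] = A * P.[y] -> root Q1 x -> root P1 y -> False) ->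
  exists2 B : R, 0 <= B & forall x y h l m : C, P.[x] = A * P.[y] ->
    l * X.[x] = h * P1.[y] -> A * m * Y.[y] = h * Q1.[x] ->
    cnorm (h ^+ 2) ^+ 2 * (ht x * ht y) ^+ S <=
      B * ((cnorm l / ht x) ^+ 2 + (cnorm m / ht y) ^+ 2) ^+ 2.
Proof.
move=> sP A0 P'0 EX EY sX sY sP1 hno.
have Q10 : Q1 != 0 by apply: contraNneq P'0 => h; rewrite EX h mulr0.
have P10 : P1 != 0 by rewrite -size_poly_gt0 sP1.
have [B B1 hB] := curve_comparable A sP.
have [BX BX0 hBX] := poly_upper (eq_leq sX).
have [BY BY0 hBY] := poly_upper (eq_leq sY).
have [c1 [M [c10 M1 hM]]] := poly_lower sP1.
have M2 : M <= B * M by rewrite ler_peMl //; lra.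
have [c2 c20 hc2] := @curve_separated P A Q1 P1 (B * M) Q10 P10 hno.
have BM1 : 1 <= B * M by lra.
pose K1 := BX * B ^+ (dX + 2) / c1.
pose K2 := (BX * (B * M) ^+ (dX + 2) + cnorm A ^+ 2 * (BY * (B * M) ^+ (dY + 2))) * (B * M) ^+ S / c2.
have pw k : 0 < (B * M) ^+ k by apply: exprn_gt0; lra.
have pB k : 0 < B ^+ k by apply: exprn_gt0; lra.
have K10 : 0 <= K1 by apply: divr_ge0; [apply: mulr_ge0|]; apply: ltW.
have nA := sqr_ge0 (cnorm A).
have K20 : 0 <= K2.
  apply: divr_ge0; last exact: ltW.
  apply: mulr_ge0; last exact: ltW.
  by apply: addr_ge0; [|apply: mulr_ge0 => //]; apply: mulr_ge0; exact: ltW.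
exists (B ^+ S * (K1 + K2) ^+ 2).
  by apply: mulr_ge0; [exact: ltW|exact: sqr_ge0].
move=> x y h l m xy e1 e2.
have tx0 := ht_gt0 x; have ty0 := ht_gt0 y.
set F := (cnorm l / ht x) ^+ 2 + _.
have E1 : cnorm h ^+ 2 * cnorm P1.[y] ^+ 2 <= (cnorm l / ht x) ^+ 2 * (BX * ht x ^+ (dX + 2)).
  rewrite -exprMn -cnormM -e1 cnormM exprMn.
  have -> : (cnorm l / ht x) ^+ 2 * (BX * ht x ^+ (dX + 2)) = cnorm l ^+ 2 * (BX * ht x ^+ dX).
    by rewrite exprD; field; exact: lt0r_neq0.
  by apply: ler_wpM2l => //; exact: sqr_ge0.
have E2 : cnorm h ^+ 2 * cnorm Q1.[x] ^+ 2 <=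
    cnorm A ^+ 2 * ((cnorm m / ht y) ^+ 2 * (BY * ht y ^+ (dY + 2))).
  rewrite -exprMn -cnormM -e2 cnormM (cnormM A) !exprMn.
  have -> : cnorm A ^+ 2 * (cnorm m ^+ 2 * (ht y)^-1 ^+ 2 * (BY * ht y ^+ (dY + 2))) =
     cnorm A ^+ 2 * cnorm m ^+ 2 * (BY * ht y ^+ dY).
    by rewrite exprD; field; exact: lt0r_neq0.
  by apply: ler_wpM2l => //; rewrite mulr_ge0 ?sqr_ge0.
have s1 := sqr_ge0 (cnorm l / ht x); have s2 := sqr_ge0 (cnorm m / ht y).
have h0 := sqr_ge0 (cnorm h).
have F0 : 0 <= F by rewrite /F addr_ge0.
have txy := hB x y xy.
have main : cnorm h ^+ 2 * ht y ^+ S <= (K1 + K2) * F.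
  (* Near infinity the relation for [l] alone bounds [h], since [P1] has degree [S + 2 + dX]. On the
     bounded part of the curve [P1] may vanish; there both relations are added and [Q1], [P1] are
     separated. *)
  have [ge|lt] := leP M (ht y).
    suff : cnorm h ^+ 2 * ht y ^+ S <= K1 * F.
      by have := mulr_ge0 K20 F0; lra.
    apply: le_trans (_ : K1 * (cnorm l / ht x) ^+ 2 <= _); last first.
      by apply: ler_wpM2l => //; rewrite /F lerDl.
    rewrite /K1 (mulrAC _ c1^-1) ler_pdivlMr //.
    have t0 : 0 < ht y ^+ (dX + 2) by exact: exprn_gt0.
    rewrite -(ler_pM2r t0).
    have -> : cnorm h ^+ 2 * ht y ^+ S * c1 * ht y ^+ (dX + 2) =
       cnorm h ^+ 2 * (c1 * ht y ^+ (S + 2 + dX)) by rewrite !exprD; ring.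
    apply: le_trans (ler_wpM2l h0 (hM y ge)) _; apply: le_trans E1 _.
    have -> : BX * B ^+ (dX + 2) * (cnorm l / ht x) ^+ 2 * ht y ^+ (dX + 2) =
       (cnorm l / ht x) ^+ 2 * (BX * (B * ht y) ^+ (dX + 2)) by rewrite (exprMn (dX + 2) B (ht y)); ring.
    apply: ler_wpM2l => //; apply: ler_wpM2l; first exact: ltW.
    by apply: lerXn2r; rewrite ?nnegrE //; [exact: ltW|apply: mulr_ge0; lra].
  have ty : ht y <= B * M by lra.
  have tx : ht x <= B * M by apply: le_trans txy _; apply: ler_wpM2l; lra.
  suff : cnorm h ^+ 2 * ht y ^+ S <= K2 * F.
    by have := mulr_ge0 K10 F0; lra.
  have hc := ler_wpM2l h0 (hc2 x y (And3 xy tx ty)).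
  have tS : ht y ^+ S <= (B * M) ^+ S.
    by apply: lerXn2r; rewrite ?nnegrE //; [exact: ltW|lra].
  apply: le_trans (ler_wpM2l h0 tS) _.
  rewrite /K2 (mulrAC _ c2^-1) ler_pdivlMr // (mulrAC (cnorm h ^+ 2)) [leRHS]mulrAC.
  apply: ler_wpM2r; first exact: ltW.
  apply: le_trans hc _; rewrite mulrDr.
  have G1 : (cnorm l / ht x) ^+ 2 * (BX * ht x ^+ (dX + 2)) <=
      F * (BX * (B * M) ^+ (dX + 2)).
    apply: ler_pM => //.
    - by apply: mulr_ge0; [exact: ltW|apply: exprn_ge0; exact: ltW].
    - by rewrite /F lerDl.
    - apply: ler_wpM2l; first exact: ltW.
      by apply: lerXn2r; rewrite ?nnegrE //; [exact: ltW|lra].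
  have G2 : cnorm A ^+ 2 * ((cnorm m / ht y) ^+ 2 * (BY * ht y ^+ (dY + 2))) <=
      cnorm A ^+ 2 * (F * (BY * (B * M) ^+ (dY + 2))).
    apply: ler_wpM2l => //; apply: ler_pM => //.
    - by apply: mulr_ge0; [exact: ltW|apply: exprn_ge0; exact: ltW].
    - by rewrite /F lerDr.
    - apply: ler_wpM2l; first exact: ltW.
      by apply: lerXn2r; rewrite ?nnegrE //; [exact: ltW|lra].
  by lra.
(* [main] involves [ht y] only; after squaring it bounds [ht y ^+ (2 S)], which dominates the mixed
   product by [curve_comparable]. *)
have p1 : (ht x * ht y) ^+ S <= (B * ht y ^+ 2) ^+ S.
  apply: lerXn2r; rewrite ?nnegrE.
  - by apply: mulr_ge0; exact: ltW.
  - by apply: mulr_ge0; [lra|exact: sqr_ge0].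
  - by rewrite expr2 mulrA; apply: ler_wpM2r => //; exact: ltW.
have q0 : 0 <= cnorm (h ^+ 2) ^+ 2 by exact: sqr_ge0.
apply: le_trans (ler_wpM2l q0 p1) _.
have -> : cnorm (h ^+ 2) ^+ 2 * (B * ht y ^+ 2) ^+ S = B ^+ S * (cnorm h ^+ 2 * ht y ^+ S) ^+ 2.
  by rewrite cnormX (exprMn S B) (exprMn 2 (cnorm h ^+ 2)) (exprAC (ht y) 2 S) mulrCA.
rewrite -(mulrA (B ^+ S)) -(exprMn 2 (K1 + K2)); apply: ler_wpM2l; first exact: ltW.
apply: lerXn2r; rewrite ?nnegrE //.
  by apply: mulr_ge0 => //; apply: exprn_ge0; exact: ltW.
by apply: mulr_ge0 => //; exact: addr_ge0.
Qed.

End Growth.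

(** * Meromorphic functions near their poles *)

Section Meromorphic.
Variable R : realType.
Local Notation C := (Cplx R).
Implicit Types (f g : C -> option C) (h F : C -> C) (z w u v : C).

(* The junk value [0] at a pole makes [1 / fval f] correct there. *)
Definition fval f z : C := odflt 0 (f z).

Definition mero f : Prop :=
  (forall z, isSome (f z) -> hol (fval f) z /\ nearby setT z (fun w => isSome (f w))) /\
  (forall z, f z = None -> forall M : R, nearby setT z (fun w => w != z ->
     isSome (f w) /\ M < cnorm (fval f w))).

Lemma nbhs_nearby z (Q : C -> Prop) : nbhs z Q -> nearby setT z Q.
Proof.
move=> /nbhs_ballP [e /= e0 he]; exists (complex.Re e).
  by move: e0; rewrite ltcE /= => /andP[].
move=> w _ hw; apply: he; rewrite /ball /= distrC normE.
have -> : e = rc (complex.Re e) by rewrite /rc RRe_real // gtr0_real.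
by rewrite rc_lt.
Qed.

Lemma derivable_cder h z : derivable h z 1 -> exists l, cder setT h z l.
Proof.
rewrite /derivable => /cvg_ex[l hl]; exists l; apply/cderP => e e0.
have e0' : 0 < rc e by rewrite -rc0 rc_lt.
move/cvgrPdist_le: hl => hl; have [d d0 hd] := nbhs_nearby (hl (rc e) e0').
exists d => // w _ hw; have [->|wz] := eqVneq w z.
  by rewrite !subrr mulr0 subr0 cnorm0 mulr0.
have wz0 : w - z != 0 by rewrite subr_eq0.
have := hd (w - z) I; rewrite subr0 => /(_ hw wz0); rewrite normE rc_le.
rewrite [_ *: 1]mulr1 -[(h \o shift z) _]/(h (w - z + z)) subrK.
have -> : h w - h z - l * (w - z) = - (l - (w - z)^-1 * (h w - h z)) * (w - z) by field.
by rewrite cnormM cnormN => h1; apply: ler_wpM2r; rewrite ?cnorm_ge0.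
Qed.

Lemma meromorphic_mero f : meromorphic f -> mero f.
Proof.
move=> hf; split=> z.
  move=> fz; have near_some : nearby setT z (fun w => isSome (f w)).
    by have := hf z; case: (f z) fz => // u _ [/nbhs_nearby].
  split=> //; apply: nearbyW near_some => w _ fw.
  by have := hf w; case: (f w) fw => // u _ [_ /derivable_cder].
move=> fz M; have := hf z; rewrite fz => /(_ M) /nbhs_nearby.
apply: nearbyW => w _ h wz; have [u fw hu] := h wz.
by rewrite /fval fw /=; split=> //; rewrite -rc_lt -normE.
Qed.

Lemma punctured z (Q : C -> Prop) : nearby setT z Q -> exists2 w, w != z & Q w.
Proof.
move=> [d d0 hd]; exists (z + rc (d / 2)).
  by rewrite -subr_eq0 addrC addKr rc_eq0 lt0r_neq0 //; lra.
apply: hd => //; rewrite addrC addKr cnorm_rc ger0_norm; lra.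
Qed.

Lemma cont_punctured0 h z : cont setT h z -> nearby setT z (fun w => w != z -> h w = 0) ->
  h z = 0.
Proof.
move=> ch h0; apply/eqP; apply: contraT => hz.
have [w wz [h1 h2]] := punctured (nearbyI h0 (cont_nz ch hz)).
by rewrite h1 // eqxx in h2.
Qed.

(** [1 / f] is bounded near the pole, so its singularity is removable, and the extension vanishes
    there because [|f|] tends to infinity. This agrees with the value at the pole, as [fval f z = 0]
    and [0^-1 = 0]. *)
Lemma hol_inverse f z : mero f -> f z = None -> hol (fun w => (fval f w)^-1) z.
Proof.
move=> [fin inf] fz; pose F w := (fval f w)^-1.
have Fb M : nearby setT z (fun w => w != z -> isSome (f w) /\ Num.max 1 M < cnorm (fval f w)).
  exact: inf.
have [||q [hq e]] := @removable _ F z.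
- apply: nearbyW (Fb 0) => w _ h /h [fw]; rewrite gt_max => /andP[h1 _].
  have [/hol_cder [l dl] _] := fin w fw.
  eexists; apply: cderV; first exact: dl.
  by rewrite -cnorm_gt0; apply: lt_trans h1.
- exists 1; apply: nearbyW (Fb 0) => w _ h /h [fw]; rewrite gt_max => /andP[h1 _].
  by rewrite /F cnormV invf_le1 ?ltW //; apply: lt_trans h1.
have Fz : F z = 0 by rewrite /F /fval fz invr0.
have qz : q z = 0.
  apply/eqP; apply: contraT => q0; have qp : 0 < cnorm (q z) by rewrite cnorm_gt0.
  have [w wz [h1 [h2 h3]]] := punctured (nearbyI (Fb (2 / cnorm (q z)))
     (nearbyI e (cont_neq0 (hol_cont hq) q0))).
  have [_ ] := h1 wz; rewrite gt_max => /andP[_ h4].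
  move: h3; rewrite -h2 // /F cnormV => h3.
  have p0 : 0 < cnorm (fval f w) by apply: lt_trans h4; rewrite divr_gt0.
  move: h4; rewrite ltr_pdivrMr //; move: h3.
  by rewrite -[X in _ < X]div1r ltr_pdivlMr //; lra.
apply: hol_near hq; apply: nearbyW e => w _ h.
by have [->|/h <- //] := eqVneq w z; rewrite qz -/(F z) Fz.
Qed.

(** At a pole [1 / f] would have derivative [0] in a full neighbourhood, hence be constant and equal
    to its value [0], which is absurd off the pole. So there are no poles, and a disc containing
    both points finishes. *)
Lemma mero_const f : mero f -> (forall z, isSome (f z) -> cder setT (fval f) z 0) ->
  forall z w, f z = f w.
Proof.
move=> mf d0; have [fin inf] := mf.
have nopole z : isSome (f z).
  case E : (f z) => [//|]; exfalso.
  have hF := hol_inverse mf E; set F := (fun w => (fval f w)^-1) in hF.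
  have [F' [dF hF']] := hol_deriv hF.
  have dF0 : nearby setT z (fun w => w != z -> cder setT F w 0).
    apply: nearbyW (inf z E 1) => w _ h /h [fw h1].
    apply: cder_eq (cderV (d0 w fw) _); first by rewrite oppr0 mul0r.
    by rewrite -cnorm_gt0; apply: lt_trans h1.
  have F'0 : F' z = 0.
    apply: cont_punctured0 (hol_cont hF') _.
    by apply: nearbyW (nearbyI dF dF0) => w _ [h1 h2] /h2; exact: cder_unique.
  have [d d1 hd] := nearbyI dF dF0.
  have cst w : disc z d w -> cder setT F w 0.
    move=> hw; have [h1 h2] := hd w I hw.
    have [e|/h2 //] := eqVneq w z; by rewrite e F'0 in h1; rewrite e.
  have [w wz [h1 h2]] := punctured (nearbyI (inf z E 1) (nearby_ball z d1)).
  have [_ h3] := h1 wz.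
  have zz : disc z d z by rewrite /disc subrr cnorm0.
  have := cder0_cst cst h2 zz; rewrite /F {2}/fval E invr0 => /eqP.
  by rewrite invr_eq0 -cnorm_eq0 => /eqP h4; rewrite h4 in h3; move: h3; rewrite ltr10.
move=> z w; have e : fval f z = fval f w.
  apply: (@cder0_cst _ 0 (cnorm z + cnorm w + 1)) => [v _||].
  - exact: d0.
  - by rewrite /disc subr0; have := cnorm_ge0 w; lra.
  - by rewrite /disc subr0; have := cnorm_ge0 z; lra.
by move: e; rewrite /fval; have := nopole z; have := nopole w; case: (f z) (f w) => [u|] [v|] //= _ _ ->.
Qed.

Definition cderiv h z : C := xget 0 [set l : C | cder setT h z l].

Lemma cderivE h z l : cder setT h z l -> cderiv h z = l.
Proof. by move=> dl; apply: cder_unique (dl); exact: (@xgetI _ _ [set l : C | cder setT h z l] l). Qed.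

Lemma hol_cderiv h z : hol h z -> hol (cderiv h) z /\ nearby setT z (fun w => cder setT h w (cderiv h w)).
Proof.
move=> /hol_deriv [h' [dh hh']]; split.
  by apply: hol_near hh'; apply: nearbyW dh => w _ /cderivE.
by apply: nearbyW dh => w _ d; rewrite (cderivE d).
Qed.

(** The reciprocal polynomial, which expresses [p] at infinity in the coordinate [1 / u]. *)
Definition revp (p : {poly C}) : {poly C} := \poly_(i < size p) p`_((size p).-1 - i).

Lemma revpE p u : u != 0 -> p.[u] = u ^+ (size p).-1 * (revp p).[u^-1].
Proof.
move=> u0; rewrite horner_poly horner_coef mulr_sumr.
case E : (size p) => [|k]; first by rewrite !big_ord0.
rewrite (reindex_inj rev_ord_inj) /=; apply: eq_bigr => i _.
rewrite subSS mulrCA; congr (_ * _).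
by rewrite exprVn expfB_cond // (negbTE u0) add0n -ltnS ltn_ord.
Qed.

Lemma revp0 p : (revp p).[0] = lead_coef p.
Proof.
rewrite horner_coef0 coef_poly; case: ifP => [|/negbT]; first by rewrite subn0.
by rewrite -leqNgt leqn0 size_poly_eq0 => /eqP ->; rewrite lead_coef0.
Qed.

(** The roots of [p] are isolated: once the root [h z] is divided out with its multiplicity, the
    cofactor stays nonzero along [h] near [z]. *)
Lemma poly_isolated (p : {poly C}) h z : p != 0 -> cont setT h z ->
  nearby setT z (fun w => root p (h w)) -> nearby setT z (fun w => h w = h z).
Proof.
move=> p0 ch hr; have [m [q + E]] := multiplicity_XsubC p (h z); rewrite p0 /= => qz.
have cq : cont setT (fun w => q.[h w]) z.
  exact: (@cont_comp _ _ setT) ch (cont_horner _ _ _).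
apply: nearbyW (nearbyI hr (cont_nz cq qz)) => w _ [].
by rewrite E rootM /root => /orP[->//|]; rewrite horner_exp hornerXsubC expf_eq0 subr_eq0 => /andP[_ /eqP].
Qed.

End Meromorphic.

(** * The metric attached to a solution of P(f) = A P(g) *)

Section Curve.
Variable R : realType.
Local Notation C := (Cplx R).
Implicit Types (z w u v : C).
Variables (P X Y P1 Q1 : {poly C}) (A : C) (n dX dY S : nat).
Hypotheses (S0 : (0 < S)%N) (sP : size P = n.+2) (A0 : A != 0)
  (P'0 : P^`() != 0) (EX : P^`() = X * Q1) (EY : P^`() = Y * P1)
  (sX : size X = dX.+1) (sY : size Y = dY.+1) (sP1 : size P1 = (S + 2 + dX).+1)
  (hno : forall x y, P.[x] = A * P.[y] -> root Q1 x -> root P1 y -> False).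
Variables f g : C -> option C.
Hypotheses (mf : mero f) (mg : mero g)
  (fg : forall z, isSome (f z) -> isSome (g z) ->
     P.[fval f z] = A * P.[fval g z]).

Let ff := fval f.
Let gg := fval g.
Let F w := (ff w)^-1.
Let G w := (gg w)^-1.

(** If [f2] were finite at the pole of [f1], it would be bounded nearby, and so would [f1] by
    comparison. *)
Lemma pole_comparable (f1 f2 : C -> option C) (B : R) z : mero f1 -> mero f2 ->
  (forall w, isSome (f1 w) -> isSome (f2 w) -> ht (fval f1 w) <= B * ht (fval f2 w)) ->
  f1 z = None -> f2 z = None.
Proof.
move=> [_ inf1] [fin2 _] hB f1z; case E : (f2 z) => [v|//]; exfalso.
have f2z : isSome (f2 z) by rewrite E.
have [h2 s2] := fin2 z f2z.
pose b := cnorm (fval f2 z) + 1; pose M := `|B| * (1 + b ^+ 2).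
have [w wz [h1 [h3 h4]]] := punctured (nearbyI (inf1 z f1z (1 + M)) (nearbyI s2
  (cont_bounded (hol_cont h2)))).
have [s1 h5] := h1 wz; have := hB w s1 h3.
have b0 : 0 <= b by rewrite /b addr_ge0 ?cnorm_ge0.
have M0 : 0 <= M by rewrite mulr_ge0 // addr_ge0 ?sqr_ge0.
have Tb : ht (fval f2 w) <= 1 + b ^+ 2.
  by rewrite /ht lerD2l ler_pXn2r ?nnegrE ?cnorm_ge0 // ltW.
have k1 : B * ht (fval f2 w) <= `|B| * ht (fval f2 w).
  by apply: ler_wpM2r; [exact: ltW (ht_gt0 _)|exact: ler_norm].
have k2 : `|B| * ht (fval f2 w) <= M by apply: ler_wpM2l.
have k3 : 1 + M <= cnorm (fval f1 w) ^+ 2.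
  apply: le_trans (ltW h5) _; rewrite expr2 ler_peMr ?cnorm_ge0 //.
  by apply: le_trans (ltW h5); lra.
by rewrite {1}/ht; lra.
Qed.

Lemma poles z : (f z == None) = (g z == None).
Proof.
have [B _ hB] := curve_comparable A sP; have [B' _ hB'] := curve_comparable A^-1 sP.
apply/eqP/eqP => h.
  by apply: (@pole_comparable f g B _ mf mg _ h) => w sf sg; apply: hB; exact: fg.
apply: (@pole_comparable g f B' _ mg mf _ h) => w sg sf; apply: hB'.
by rewrite fg // mulKf.
Qed.

Lemma someE z : isSome (f z) = isSome (g z).
Proof. by have := poles z; case: (f z); case: (g z). Qed.

Lemma fin_hol z : isSome (f z) -> hol ff z /\ hol gg z.
Proof.
move=> sf; split; first by have [] := mf.1 z sf.
by rewrite someE in sf; have [] := mg.1 z sf.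
Qed.

Lemma fin_near z : isSome (f z) -> nearby setT z (fun w => isSome (f w)).
Proof. by move=> sf; have [] := mf.1 z sf. Qed.

Lemma curveE z : isSome (f z) -> P.[ff z] = A * P.[gg z].
Proof. by move=> sf; apply: fg => //; rewrite -someE. Qed.

Lemma der_curve z l m : isSome (f z) -> cder setT ff z l -> cder setT gg z m ->
  l * P^`().[ff z] = A * m * P^`().[gg z].
Proof.
move=> sf dl dm.
have d1 := @cder_comp _ _ setT _ (horner P) _ _ _ (fun _ _ => I) dl (cder_horner _ P _).
have d2 := cderMl A (@cder_comp _ _ setT _ (horner P) _ _ _ (fun _ _ => I) dm (cder_horner _ P _)).
have d3 : cder setT (fun w => A * P.[gg w]) z (P^`().[ff z] * l).
  apply: cder_near d1; first exact: curveE.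
  by apply: nearbyW (fin_near sf) => w _; exact: curveE.
by have := cder_unique d3 d2; rewrite mulrC => ->; ring.
Qed.

(** Two expressions of the form multiplied by [X(f) Y(g)]. They agree where both make sense, by
    [cross], and [hno] makes at least one denominator nonzero at every finite point, so [H] is
    holomorphic off the poles. *)
Let H w := if P1.[gg w] != 0 then cderiv ff w * X.[ff w] / P1.[gg w]
  else A * cderiv gg w * Y.[gg w] / Q1.[ff w].

Lemma Q1_neq0 z : isSome (f z) -> P1.[gg z] = 0 -> Q1.[ff z] != 0.
Proof. by move=> sf h; apply/eqP => h'; apply: hno (curveE sf) _ _; exact/eqP. Qed.

Lemma cross z : isSome (f z) ->
  cderiv ff z * X.[ff z] * Q1.[ff z] = A * cderiv gg z * Y.[gg z] * P1.[gg z].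
Proof.
move=> sf; have [hf hg] := fin_hol sf.
have [l dl] := hol_cder hf; have [m dm] := hol_cder hg.
have := der_curve sf dl dm; rewrite (cderivE dl) (cderivE dm) {1}EX EY !hornerM.
by rewrite !mulrA.
Qed.

Lemma H_X z : isSome (f z) -> cderiv ff z * X.[ff z] = H z * P1.[gg z].
Proof.
move=> sf; rewrite /H; have [h|h] := eqVneq P1.[gg z] 0; last by rewrite divfK.
have q0 := Q1_neq0 sf h; have := cross sf; rewrite h !mulr0 => /eqP.
by rewrite mulf_eq0 (negbTE q0) orbF => /eqP.
Qed.

Lemma H_Y z : isSome (f z) -> A * cderiv gg z * Y.[gg z] = H z * Q1.[ff z].
Proof.
move=> sf; rewrite /H; have [h|h] := eqVneq P1.[gg z] 0.
  by rewrite divfK //; exact: Q1_neq0.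
by rewrite [RHS]mulrAC cross // mulfK.
Qed.

Let x0 := lead_coef X.
Let p0 := lead_coef P1.
(* At a pole [nu] is the common value of [|f / g|], and the second branch of [W] is
   the limit of the first. *)
Let nu := cnorm (n.+1.-root A).
(** Near a pole [H] is [F' f^(2 + dX) / g^(S + 2 + dX)] up to a holomorphic factor, so in
    [|H|^4 (|f| |g|)^(2 S)] only the ratio [|f / g|] survives, to the power [2 N]. *)
Let N := (S + 4 + 2 * dX)%N.
Let w0 := cnorm (x0 / p0) ^+ 4 * (nu ^+ N) ^+ 2.
Let W z := if isSome (f z) then
    cnorm (H z ^+ 2) ^+ 2 * (ht (ff z) * ht (gg z)) ^+ S
  else cnorm (cderiv F z) ^+ 4 * w0.

Lemma H_hol z : isSome (f z) -> exists2 H' : C -> C, hol H' z &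
  nearby setT z (fun w => H w = H' w).
Proof.
move=> sf; have [hf hg] := fin_hol sf.
have [hDf _] := hol_cderiv hf; have [hDg _] := hol_cderiv hg.
have hX := hol_horner X hf; have hY := hol_horner Y hg.
have hP1 := hol_horner P1 hg; have hQ1 := hol_horner Q1 hf.
have [h|h] := eqVneq P1.[gg z] 0.
  have q0 := Q1_neq0 sf h.
  exists (fun w => A * cderiv gg w * Y.[gg w] / Q1.[ff w]).
    apply: holM; last exact: holV.
    by apply: holM => //; apply: holM => //; exact: hol_cst.
  apply: nearbyW (nearbyI (fin_near sf) (cont_nz (hol_cont hQ1) q0)) => w _ [sw qw].
  by rewrite H_Y // mulfK.
exists (fun w => cderiv ff w * X.[ff w] / P1.[gg w]).
  by apply: holM; [exact: holM|exact: holV].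
apply: nearbyW (nearbyI (fin_near sf) (cont_nz (hol_cont hP1) h)) => w _ [sw pw].
by rewrite H_X // mulfK.
Qed.

Lemma chart_finite (B B' : R) z : B <= B' ->
  (forall x y h l m : C, P.[x] = A * P.[y] ->
    l * X.[x] = h * P1.[y] -> A * m * Y.[y] = h * Q1.[x] ->
    cnorm (h ^+ 2) ^+ 2 * (ht x * ht y) ^+ S <=
      B * ((cnorm l / ht x) ^+ 2 + (cnorm m / ht y) ^+ 2) ^+ 2) ->
  isSome (f z) -> metric_chart S B' W z.
Proof.
move=> BB hB sf; have [hf hg] := fin_hol sf; have [H' hH' HE] := H_hol sf.
exists (fun w => H' w ^+ 2), ff, gg; split=> //.
- exact: holX.
- apply: nearbyW (nearbyI HE (fin_near sf)) => w _ [<- sw].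
  by rewrite /W sw.
- move=> l m dl dm; rewrite /W sf.
  have e1 := H_X sf; have e2 := H_Y sf; rewrite (cderivE dl) in e1; rewrite (cderivE dm) in e2.
  apply: le_trans (hB _ _ _ _ _ (curveE sf) e1 e2) _.
  by apply: ler_wpM2r => //; exact: sqr_ge0.
Qed.

(** [f / g] is bounded near the pole because [ht] of [f] and of [g] are comparable, so it extends.
    Comparing leading coefficients in [P(f) = A P(g)] then gives [U z ^+ n.+1 = A], which determines
    the modulus of [U z]. *)
Lemma root_ratio z : f z = None -> exists2 U : C -> C, hol U z &
  cnorm (U z) = nu /\ nearby setT z (fun w => w != z -> U w = ff w / gg w).
Proof.
move=> fz; have gz : g z = None by apply/eqP; rewrite -poles fz.
have [B _ hB] := curve_comparable A sP.
have hF := hol_inverse mf fz; have hG := hol_inverse mg gz.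
have big := nearbyI (mf.2 z fz 1) (mg.2 z gz 1).
have [||U [hU UE]] := @removable _ (fun w => ff w / gg w) z.
- apply: nearbyW big => w _ [h1 h2] wz.
  have [s1 k1] := h1 wz; have [s2 k2] := h2 wz.
  have [/hol_cder [l dl] /hol_cder [m dm]] := fin_hol s1.
  eexists; apply: cder_div; [exact: dl|exact: dm|].
  by rewrite -cnorm_gt0; apply: lt_trans k2.
- exists (1 + 2 * `|B|); apply: nearbyW big => w _ [h1 h2] wz.
  have [s1 k1] := h1 wz; have [s2 k2] := h2 wz.
  have v0 : 0 < cnorm (gg w) by apply: lt_trans k2.
  have := hB _ _ (curveE s1); rewrite cnormM cnormV ler_pdivrMr // => hT.
  have B0 := normr_ge0 B; have BB := ler_norm B.
  have v1 : 1 <= cnorm (gg w) ^+ 2 by rewrite expr_ge1 // ltW.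
  have k3 : B * ht (gg w) <= `|B| * ht (gg w) by apply: ler_wpM2r; [exact: ltW (ht_gt0 _)|].
  have k4 : `|B| * ht (gg w) <= `|B| * (2 * cnorm (gg w) ^+ 2).
    by apply: ler_wpM2l => //; rewrite /ht; lra.
  have k5 : cnorm (ff w) ^+ 2 <= (1 + 2 * `|B|) * cnorm (gg w) ^+ 2.
    by move: hT; rewrite {1}/ht; have := sqr_ge0 (cnorm (gg w)); lra.
  rewrite -(ler_pXn2r (_ : 0 < 2)%N) ?nnegrE ?cnorm_ge0 //; last first.
    by apply: mulr_ge0; lra.
  apply: le_trans k5 _; rewrite exprMn; apply: ler_wpM2r; first exact: sqr_ge0.
  by rewrite expr2; apply: ler_peMr; lra.
exists U => //; split; last first.
  by apply: nearbyW UE => w _ h /h.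
(* Off the pole this is [(P(f) - A P(g)) / g^(n+1) = 0]; written with reciprocal polynomials it
   continues to the pole. *)
pose h w := U w ^+ n.+1 * (revp P).[F w] - A * (revp P).[G w].
have hh : hol h z.
  apply: holD; first by apply: holM; [exact: holX|exact: hol_horner].
  apply: (@hol_near _ (fun w => (- A) * (revp P).[G w])).
    by apply: nearby_all => w _; rewrite mulNr.
  by apply: holM; [exact: hol_cst|exact: hol_horner].
have hz : h z = 0.
  apply: cont_punctured0 (hol_cont hh) _.
  apply: nearbyW (nearbyI big UE) => w _ [[h1 h2] h3] wz.
  have [s1 k1] := h1 wz; have [s2 k2] := h2 wz.
  have u0 : ff w != 0 by rewrite -cnorm_gt0; apply: lt_trans k1.
  have v0 : gg w != 0 by rewrite -cnorm_gt0; apply: lt_trans k2.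
  have := curveE s1; rewrite (revpE P u0) (revpE P v0) sP /= => e.
  rewrite /h -h3 // exprMn exprVn mulrAC e /F /G; field.
  by rewrite expf_neq0.
have Fz : F z = 0 by rewrite /F /ff /fval fz invr0.
have Gz : G z = 0 by rewrite /G /gg /fval gz invr0.
have lP : lead_coef P != 0 by rewrite lead_coef_eq0 -size_poly_gt0 sP.
move: hz; rewrite /h Fz Gz !revp0 -mulrBl => /eqP.
rewrite mulf_eq0 (negbTE lP) orbF subr_eq0 => /eqP UA.
apply/eqP; rewrite -(@eqrXn2 _ n.+1) ?cnorm_ge0 // /nu -!cnormX UA.
by rewrite rootCK.
Qed.

Lemma ht_inv u : u != 0 -> ht u = cnorm u ^+ 2 * ht u^-1.
Proof.
move=> u0; rewrite /ht cnormV exprVn mulrDr mulr1 mulfV; first by rewrite addrC.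
by rewrite expf_neq0 // cnorm_eq0.
Qed.

(** In the coordinates [1/f] and [1/g] the sphere factors shed powers of [|f|] and [|g|] that cancel
    those in [H]; what remains is a holomorphic factor and a power of the ratio [U]. *)
Lemma chart_pole (B' : R) z : w0 <= B' -> f z = None -> metric_chart S B' W z.
Proof.
move=> wB fz; have gz : g z = None by apply/eqP; rewrite -poles fz.
have hF := hol_inverse mf fz; have hG := hol_inverse mg gz.
have [U hU [Uz UE]] := root_ratio fz.
have [hDF dF] := hol_cderiv hF.
have Fz : F z = 0 by rewrite /F /ff /fval fz invr0.
have Gz : G z = 0 by rewrite /G /gg /fval gz invr0.
have p00 : p0 != 0 by rewrite lead_coef_eq0 -size_poly_gt0 sP1.
have Pz : (revp P1).[G z] != 0 by rewrite Gz revp0.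
have hP := hol_horner (revp P1) hG.
exists (fun w => (cderiv F w * (revp X).[F w] / (revp P1).[G w]) ^+ 2 * U w ^+ N), F, G; split=> //.
- apply: holM; last exact: holX.
  apply: holX; apply: holM; last exact: holV.
  by apply: holM => //; exact: hol_horner.
- have big := nearbyI (mf.2 z fz 1) (mg.2 z gz 1).
  apply: nearbyW (nearbyI big (nearbyI UE (nearbyI dF (cont_nz (hol_cont hP) Pz)))) => w _.
  move=> [[h1 h2] [h3 [dFw Pw]]]; have [->|wz] := eqVneq w z.
    rewrite /W fz /= Fz Gz cnorm0 expr0n /= !addr0 !mulr1 expr1n mulr1 !revp0 -/x0 -/p0 /w0.
    have e : cnorm (cderiv F z * x0 / p0) = cnorm (cderiv F z) * cnorm (x0 / p0).
      by rewrite -mulrA cnormM.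
    rewrite (cnormM (_ ^+ 2)) !cnormX Uz e; set nuN := nu ^+ N; ring.
  have [s1 k1] := h1 wz; have [s2 k2] := h2 wz; have {}h3 := h3 wz.
  have u0 : ff w != 0 by rewrite -cnorm_gt0; apply: lt_trans k1.
  have v0 : gg w != 0 by rewrite -cnorm_gt0; apply: lt_trans k2.
  have P1v : P1.[gg w] != 0 by rewrite (revpE P1 v0) mulf_neq0 // expf_neq0.
  have [/hol_cder [l dl] _] := fin_hol s1.
  have DFE : cderiv F w = - l / ff w ^+ 2 by apply: cderivE; exact: cderV.
  have HE : H w = - (cderiv F w * (revp X).[F w] / (revp P1).[G w]) *
      (ff w ^+ (2 + dX) / gg w ^+ (S + 2 + dX)).
    rewrite /H P1v (cderivE dl) DFE (revpE P1 v0) (revpE X u0) sX sP1 /= (exprD _ 2 dX).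
    by field; rewrite Pw u0 expf_neq0.
  rewrite /W s1 HE; set kap := cderiv F w * _ / _.
  rewrite (ht_inv u0) (ht_inv v0) h3.
  rewrite (_ : 1 + cnorm (F w) ^+ 2 = ht (ff w)^-1) // (_ : 1 + cnorm (G w) ^+ 2 = ht (gg w)^-1) //.
  rewrite (cnormM (kap ^+ 2)) !cnormX (cnormM (- kap)) cnormN cnormM (cnormM (ff w)) !cnormV !cnormX.
  have a0 : cnorm (ff w) != 0 by rewrite cnorm_eq0.
  have b0 : cnorm (gg w) != 0 by rewrite cnorm_eq0.
  move: a0 b0; set a := cnorm (ff w); set b := cnorm (gg w); set k := cnorm kap => a0 b0.
  set t1 := ht _; set t2 := ht _.
  pose q := a / b; have aE : a = q * b by rewrite /q divfK.
  have -> : (a ^+ 2 * t1 * (b ^+ 2 * t2)) ^+ S =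
     (a ^+ S) ^+ 2 * (b ^+ S) ^+ 2 * (t1 * t2) ^+ S.
    by rewrite mulrACA (exprMn S) (exprMn S (a ^+ 2)) (exprAC a) (exprAC b).
  have bS : b ^+ S != 0 by rewrite expf_neq0.
  have bd : b ^+ (2 + dX) != 0 by rewrite expf_neq0.
  rewrite -/q (_ : a ^+ S = q ^+ S * b ^+ S); last by rewrite -(exprMn S) -aE.
  have -> : a ^+ (2 + dX) / b ^+ (S + 2 + dX) = q ^+ (2 + dX) / b ^+ S.
    by rewrite aE (exprMn (2 + dX)) -addnA (exprD b S); field; apply/andP.
  have -> : q ^+ N = q ^+ S * (q ^+ (2 + dX)) ^+ 2.
    by rewrite -exprM -exprD; congr (_ ^+ _); rewrite /N; ring.
  by field.
(* At the pole [F] and [G] vanish, so both spherical weights are [1] and the bound reduces to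
   [|l|^4 <= (|l|^2 + |m|^2)^2]. *)
- move=> l m dl dm; rewrite /W fz /= Fz Gz cnorm0 expr0n /= !addr0 !divr1 (cderivE dl).
  set s := cnorm l ^+ 2 + cnorm m ^+ 2.
  have ls : cnorm l ^+ 4 <= s ^+ 2.
    rewrite (_ : 4%N = (2 * 2)%N) // exprM ler_pXn2r ?nnegrE ?sqr_ge0 ?addr_ge0 ?sqr_ge0 //.
    by rewrite /s lerDl sqr_ge0.
  rewrite mulrC; have w00 : 0 <= w0.
    by apply: mulr_ge0; [rewrite exprn_ge0 ?cnorm_ge0|exact: sqr_ge0].
  apply: ler_pM => //; exact: (exprn_ge0 4 (cnorm_ge0 _)).
Qed.

Lemma curve_constant z w : f z = f w.
Proof.
have [B B0 hB] := key_bound sP A0 P'0 EX EY sX sY sP1 hno.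
have w00 : 0 <= w0.
  by apply: mulr_ge0; [rewrite exprn_ge0 ?cnorm_ge0|exact: sqr_ge0].
have W0 v : W v = 0.
  apply: (@metric_vanishes _ S (B + w0) W) => //; first exact: addr_ge0.
  move=> v'; case E : (f v') => [u|].
    by apply: (@chart_finite B) => //; [rewrite lerDl|rewrite E].
  by apply: chart_pole => //; rewrite lerDr.
have H0 v : isSome (f v) -> H v = 0.
  move=> sv; have := W0 v; rewrite /W sv => /eqP; rewrite mulf_eq0.
  rewrite (expf_eq0 (_ * _)) (gt_eqF (mulr_gt0 (ht_gt0 _) (ht_gt0 _))) andbF orbF.
  by rewrite expf_eq0 /= cnorm_eq0 expf_eq0 /= => /eqP.
have X0 : X != 0 by rewrite -size_poly_gt0 sX.
apply: (mero_const mf) => v sv; have [hf _] := fin_hol sv.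
have [hDf dDf] := hol_cderiv hf.
(* From [H = 0] only [f' X(f) = 0] follows. If [f'] is nonzero at [v], then [f] takes nearby values
   among the roots of [X], so it is locally constant after all. *)
suff e : cderiv ff v = 0 by have := nearby_pt I dDf; rewrite e.
apply/eqP; apply: contraT => Dv.
have : nearby setT v (fun w => root X (ff w)).
  apply: nearbyW (nearbyI (fin_near sv) (cont_nz (hol_cont hDf) Dv)) => w' _ [sw dw].
  have := H_X sw; rewrite H0 // mul0r => /eqP; rewrite mulf_eq0 (negbTE dw).
  by [].
move=> /(poly_isolated X0 (hol_cont hf)) cst.
have : cder setT ff v 0.
  by apply: cder_near (cder_cst _ (ff v) _) => //; apply: nearbyW cst => w' _ ->.
by move=> /cderivE e; rewrite e eqxx in Dv.
Qed.

End Curve.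

(** * From numbers of distinct points to multiplicities *)

Section Counting.
Variable K : numClosedFieldType.
Implicit Types (P Q : {poly K}) (d : K) (t : seq K).

Lemma card_roots Q t (N : nat) : uniq t -> (forall x, (x \in t) = root Q x) ->
  ([set z | root Q z] #= `I_N)%card -> size t = N.
Proof.
move=> ut tE; have -> : [set z | root Q z] = [set` seq_fset tt t].
  by apply/seteqP; split=> x; rewrite /mkset seq_fsetE tE.
by move=> /card_eq_fsetP; rewrite size_seq_fset undup_id.
Qed.

Lemma card_roots_ge Q t (N : nat) : uniq t -> (forall x, (x \in t) = root Q x) ->
  (`I_N #<= [set z | root Q z])%card -> (N <= size t)%N.
Proof.
move=> ut tE hN; rewrite -card_le_II; apply: card_le_trans hN _.
have -> : [set z | root Q z] = [set` seq_fset tt t].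
  by apply/seteqP; split=> x; rewrite /mkset seq_fsetE tE.
have /card_eqPle[] // : ([set` seq_fset tt t] #= `I_(size t))%card.
by apply/card_eq_fsetP; rewrite size_seq_fset undup_id.
Qed.

(** Stated for the case that [gamma] has the fewer points; the theorem exchanges [gamma] and [delta]
    otherwise. A partner [b] has at least [p + 3] points over [P.[b]], so its multiplicity is at
    most [n - p - 3], against [n - p] for [gamma]. *)
Lemma split_of_counts P n gamma delta (A : K) p q :
  size P = n.+1 -> P^`() != 0 -> A != 0 -> A != 1 -> P.[gamma] != 0 ->
  (forall a b, root P^`() a -> root P^`() b -> P.[a] = P.[b] -> a = b) ->
  root P^`() gamma ->
  ([set z | root (P - P.[gamma]%:P) z] #= `I_p)%card ->
  ([set z | root (P - P.[delta]%:P) z] #= `I_q)%card ->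
  (p + 3 <= q)%N ->
  (forall d, d != P.[gamma] -> d != P.[delta] ->
     (`I_(p + 3) #<= [set z | root (P - d%:P) z])%card) ->
  exists X Y P1 Q1 : {poly K}, [/\ P^`() = X * Q1, P^`() = Y * P1,
    (forall x y, P.[x] = A * P.[y] -> root Q1 x -> root P1 y -> False) &
    exists dX dY, [/\ size X = dX.+1, size Y = dY.+1 & (dX + dY + 4 <= n)%N]].
Proof.
move=> sP P'0 A0 A1 Pg inj rg hp hq pq hd.
have n0 : (0 < n)%N.
  case: n sP => // sP; move: P'0.
  by rewrite (size1_polyC (_ : (size P <= 1)%N)) ?sP // derivC eqxx.
have sd d : size (P - d%:P) = n.+1.
  rewrite size_polyDl // size_polyN sP.
  by apply: leq_ltn_trans (size_polyC_leq1 d) _; rewrite ltnS.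
have cnt d t : uniq t -> (forall x, (x \in t) = root (P - d%:P) x) ->
    n = (size t + \sum_(a <- t) mup a P^`())%N.
  by move=> ut tE; rewrite (count_roots (sd d) ut tE) derivB derivC subr0.
have nz d : P - d%:P != 0 by rewrite -size_poly_gt0 sd.
have rootE d x : root (P - d%:P) x = (P.[x] == d).
  by rewrite /root !hornerE subr_eq0.
have [tg [utg tgE]] := distinct_roots (nz P.[gamma]).
have [td [utd tdE]] := distinct_roots (nz P.[delta]).
(* By critical injectivity [gamma] is the only critical point over its value, so the sum in [cnt]
   has a single nonzero term. *)
have mg : n = (p + mup gamma P^`())%N.
  rewrite (cnt _ _ utg tgE) (card_roots utg tgE hp); congr addn.
  have gt : gamma \in tg by rewrite tgE rootE.
  rewrite (big_rem gamma gt) /= big1_seq ?addn0 // => a /andP[_ at_].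
  apply: mupNroot; apply/negP => ra.
  have ag : a = gamma by apply: inj => //; apply/eqP; rewrite -rootE -tgE (mem_rem at_).
  by move: at_; rewrite ag mem_rem_uniqF.
(* With [p + 3 <= q] this gives [gamma] multiplicity at least [3], the slack required when [gamma]
   has no partner. *)
have qn : (q <= n)%N.
  by rewrite (cnt _ _ utd tdE) (card_roots utd tdE hq) leq_addr.
apply: (split_critical sP P'0 A0 inj rg); first by lia.
move=> b rb Pgb.
have [t [ut tE]] := distinct_roots (nz P.[b]).
have mb : (size t + mup b P^`() <= n)%N.
  rewrite (cnt _ _ ut tE) leq_add2l.
  have bt : b \in t by rewrite tE rootE.
  by rewrite (big_rem b bt) /= leq_addr.
(* Otherwise [P.[gamma] = A * P.[gamma]] with [P.[gamma] != 0], forcing [A = 1]. *)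
have bg : P.[b] != P.[gamma].
  apply/eqP => e; move: Pgb; rewrite e => /eqP.
  by rewrite -[X in X == _]mul1r (inj_eq (mulIf Pg)) eq_sym (negbTE A1).
have : (p + 3 <= size t)%N.
  have [e|bd] := eqVneq P.[b] P.[delta].
    by move: hq; rewrite -e => /(card_roots ut tE) ->.
  exact: card_roots_ge ut tE (hd _ bg bd).
move: mb mg; move: (size t) (mup b _) (mup gamma _) => s m1 m2; clear; lia.
Qed.

End Counting.

Theorem theorem6p2p2 (R : realType) (n : nat) (P : {poly Cplx R})
    (gamma delta : Cplx R) (p q : nat)
    (hdeg : size P = n.+1)
    (hinj : critically_injective P)
    (hsimple : only_simple_zeros P)
    (hUPM : UPM P)
    (hgamma : critical_point P gamma)
    (hdelta : critical_point P delta)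
    (hneq : gamma != delta)
    (hp : (points_of P P.[gamma] #= `I_p)%card)
    (hq : (points_of P P.[delta] #= `I_q)%card)
    (hpq : 3 <= `|p%:Z - q%:Z|)
    (hd : forall d : Cplx R, d != P.[gamma] -> d != P.[delta] ->
      (`I_(minn (p + 3) (q + 3)) #<= points_of P d)%card) :
  SUPM P.
Proof.
move=> f g A mf mg ncf ncg A0 fg.
have [A1|A1] := eqVneq A 1; first by apply: hUPM => //; rewrite -A1.
have P'0 : P^`() != 0.
  apply/eqP => h; have := hinj gamma delta hgamma hdelta hneq.
  have sP1 : (size P <= 1)%N.
    by have := size_deriv_char0 hdeg; rewrite h size_poly0 hdeg => <-.
  by rewrite (size1_polyC sP1) !hornerC eqxx.
have P0 : P != 0 by rewrite -size_poly_gt0 hdeg.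
(* A zero of [P] that is also critical would be a multiple zero; this is where simplicity of the
   zeros enters. *)
have crit0 a : critical_point P a -> P.[a] != 0.
  move=> ca; apply/eqP => /eqP ra; have := hsimple a ra.
  by rewrite (mup_deriv P0 ra) => -[] /eqP; rewrite -leqn0 leqNgt mup_gt0 // ca.
have inj a b : root P^`() a -> root P^`() b -> P.[a] = P.[b] -> a = b.
  by move=> ra rb e; apply/eqP; apply: contraT => /(hinj a b ra rb); rewrite e eqxx.
have [X [Y [P1 [Q1 [EX EY hno [dX [dY [sX sY hn]]]]]]]] :
  exists X Y P1 Q1 : {poly Cplx R}, [/\ P^`() = X * Q1, P^`() = Y * P1,
    (forall x y, P.[x] = A * P.[y] -> root Q1 x -> root P1 y -> False) &
    exists dX dY, [/\ size X = dX.+1, size Y = dY.+1 & (dX + dY + 4 <= n)%N]].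
  have [pq|qp] := leqP (p + 3) q.
    apply: (split_of_counts hdeg P'0 A0 A1 (crit0 _ hgamma) inj hgamma hp hq pq) => d d1 d2.
    by have := hd d d1 d2; rewrite (minn_idPl _) //; lia.
  have {}qp : (q + 3 <= p)%N by lia.
  apply: (split_of_counts hdeg P'0 A0 A1 (crit0 _ hdelta) inj hdelta hq hp qp) => d d1 d2.
  by have := hd d d2 d1; rewrite (minn_idPr _) //; lia.
have [k nE] : exists k, n = k.+1 by exists n.-1; lia.
have [S [SE S0]] : exists S, n = (S + 3 + dX + dY)%N /\ (0 < S)%N.
  by exists (n - 3 - dX - dY)%N; lia.
have P10 : P1 != 0 by apply: contraNneq P'0 => h; rewrite EY h mulr0.
have sP1 : size P1 = (S + 2 + dX).+1.
  have Y0 : Y != 0 by rewrite -size_poly_gt0 sY.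
  have := size_deriv_char0 hdeg; rewrite EY size_mul // sY SE addSn /=.
  by move: (size P1) => s; clear; lia.
have sP : size P = k.+2 by rewrite hdeg nE.
have fg' z : isSome (f z) -> isSome (g z) -> P.[fval f z] = A * P.[fval g z].
  rewrite /fval; have := fg z; case: (f z) => [u|//]; case: (g z) => [v|//] h _ _.
  exact: h.
have [z [w zw]] := ncf; exfalso; apply: zw.
exact: (curve_constant S0 sP A0 P'0 EX EY sX sY sP1 hno
  (meromorphic_mero mf) (meromorphic_mero mg) fg').
Qed.
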